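(* Let $\mathbb{K}$ be a principal ideal domain and let $(G,M)$ and $(G',M')$ be marked groups. Then there is an isomorphism of chain complexes $$\Omega(G,M)\otimes\Omega(G',M')\cong\Omega(G\times G',M\vee M'),\qquad M\vee M'=(M\times1)\cup(1\times M').$$ Consequently, setting $H_*=\mathsf{PH}_*(G,M)$, $H'_*=\mathsf{PH}_*(G',M')$ and $H''_*=\mathsf{PH}_*(G\times G',M\vee M')$, for every $n$ there is a natural short exact sequence $$0\to\bigoplus_{i+j=n}H_i\otimes H'_j\to H''_n\to\bigoplus_{i+j=n-1}\mathsf{Tor}_1^{\mathbb{K}}(H_i,H'_j)\to0.$$
   Context: A marked group is a pair $(G,M)$ where $G$ is a group and $M\subseteq G$ is a subset containing the unit. A morphism $(G,M)\to(G_1,M_1)$ is a group homomorphism taking $M$ into $M_1$. $\mathsf{N}G$ is the normalized chain complex over $\mathbb{K}$ of the nerve of $G$ (viewed as a one-object category): $(\mathsf{N}G)_0=\mathbb{K}$; $(\mathsf{N}G)_n$ is free on symbols $\langle g_1,\dots,g_n\rangle$ with $g_i\in G\setminus\{1\}$, a symbol with some $g_i=1$ being $0$; the differential is $\partial=\sum_{i=0}^n(-1)^i\tilde d_i$, where $\tilde d_0$ deletes $g_1$, $\tilde d_n$ deletes $g_n$, and $\tilde d_i$ ($1\le i\le n-1$) replaces $g_i,g_{i+1}$ by the product $g_{i+1}g_i$. $\mathsf{N}M\subseteq\mathsf{N}G$ is the graded submodule with $(\mathsf{N}M)_0=\mathbb{K}$ and $(\mathsf{N}M)_n$ spanned by the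 symbols with all $g_i\in M$. $\Omega(G,M)$ is the subcomplex of $\mathsf{N}G$ with $\Omega_n(G,M)=(\mathsf{N}M)_n\cap\partial^{-1}((\mathsf{N}M)_{n-1})$, and $\mathsf{PH}_*(G,M)=H_*(\Omega(G,M))$. *)

(* Defs.v *)
From HB Require Import structures.
From mathcomp Require Import all_boot all_algebra ring_quotient zify.
From mathcomp Require Import boolp classical_sets.
From mathcomp.multinomials Require Import freeg.

Set Implicit Arguments.
Unset Strict Implicit.
Unset Printing Implicit Defensive.

Import GRing.Theory.
Local Open Scope quotient_scope.
Local Open Scope ring_scope.

Definition principal_ideal_domain (K : idomainType) : Prop :=
  forall I : set K,
    I 0 -> (forall x y, I x -> I y -> I (x + y)) ->
    (forall a x, I x -> I (a * x)) ->
  exists a, forall x, I x <-> exists b, x = b * a.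

Section LinearMaps.
Variable K : comNzRingType.
Implicit Types U V W : lmodType K.

Definition mk_linear U V (f : U -> V) (fL : linear f) : {linear U -> V} :=
  HB.pack f (GRing.isLinear.Build K U V *:%R f fL).
Arguments mk_linear : simpl never.

Lemma mk_linearE U V (f : U -> V) (fL : linear f) : mk_linear fL =1 f.
Proof. by []. Qed.

Section FreeModule.
Variables (A : choiceType) (V : lmodType K) (f : A -> V).

Lemma fglift_linear : linear (fglift f : {freeg A / K} -> V).
Proof.
have fB : additive (fglift f) by exact: lift_is_additive.
have f0 : fglift f 0 = 0 by have := fB 0 0; rewrite !subrr.
have fD x y : fglift f (x + y) = fglift f x + fglift f y.
  by have := fB (x + y) y; rewrite addrK => ->; rewrite subrK.
have fZ a x : fglift f (a *: x) = a *: fglift f x.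
  elim/freeg_ind_dom0: x => [|k x D _ _ IH]; first by rewrite !(scaler0, f0).
  rewrite scalerDr !fD IH scalerDr; congr (_ + _).
  have -> : a *: << k *g x >> = << a * k *g x >> :> {freeg A / K}.
    by apply/eqP/freeg_eqP => y; rewrite coeffZ !coeffU mulrA.
  by rewrite !liftU scalerA.
by move=> a x y; rewrite fD fZ.
Qed.

Definition free_lift : {linear {freeg A / K} -> V} := mk_linear fglift_linear.

Lemma free_liftU a : free_lift << a >> = f a.
Proof. by rewrite mk_linearE liftU scale1r. Qed.

End FreeModule.

Lemma free_ext (A : choiceType) V (f g : {linear {freeg A / K} -> V}) :
  (forall a, f << a >> = g << a >>) -> f =1 g.
Proof.
move=> fg; elim/freeg_ind_dom0 => [|k x D _ _ IH]; first by rewrite !linear0.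
have -> : << k *g x >> = k *: << x >> :> {freeg A / K}.
  by apply/eqP/freeg_eqP => y; rewrite coeffZ !coeffU mul1r.
by rewrite !linearD !linearZ /= IH fg.
Qed.

Definition free_map (A B : choiceType) (h : A -> B) :
    {linear {freeg A / K} -> {freeg B / K}} :=
  free_lift (fun a => << h a >>).

End LinearMaps.

Section Submodules.
Variable K : comNzRingType.
Implicit Types U V W : lmodType K.

Definition span V (X : set V) : {pred V} := fun x =>
  `[< exists2 s : seq (K * V),
        (forall c, c \in s -> X c.2) & x = \sum_(c <- s) c.1 *: c.2 >].

Section Span.
Variables (V : lmodType K) (X : set V).

Lemma span_subproof : submod_closed (span X).
Proof.
split; first by apply/asboolP; exists [::] => //; rewrite big_nil.
move=> a _ _ /asboolP[s sX ->] /asboolP[t tX ->]; apply/asboolP.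
exists ([seq (a * c.1, c.2) | c <- s] ++ t).
  by move=> c; rewrite mem_cat => /orP[/mapP[d /sX Xd ->]|/tX].
rewrite big_cat big_map scaler_sumr; congr (_ + _).
by apply: eq_bigr => c _; rewrite scalerA.
Qed.
HB.instance Definition _ :=
  GRing.isSubmodClosed.Build K V (span X) span_subproof.

Lemma sub_span x : X x -> x \in span X.
Proof.
move=> Xx; apply/asboolP; exists [:: (1, x)]; last by rewrite big_seq1 scale1r.
by move=> c; rewrite inE => /eqP ->.
Qed.

Lemma span_min (S : submodClosed V) x :
  (forall y, X y -> y \in S) -> x \in span X -> x \in S.
Proof.
move=> XS /asboolP[s sX ->]; rewrite big_seq; apply: rpred_sum => c /sX Xc.
exact/rpredZ/XS.
Qed.

End Span.

Section KerIm.
Variables (U V : lmodType K) (f : {linear U -> V}).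

Definition lin_ker : {pred U} := fun x => f x == 0.

Lemma lin_ker_subproof : submod_closed lin_ker.
Proof.
split; first by rewrite unfold_in linear0.
by move=> a x y; rewrite !unfold_in linearP => /eqP-> /eqP->; rewrite scaler0 addr0.
Qed.
HB.instance Definition _ :=
  GRing.isSubmodClosed.Build K U lin_ker lin_ker_subproof.

Definition lin_im : {pred V} := fun y => `[< exists x, y = f x >].

Lemma lin_im_subproof : submod_closed lin_im.
Proof.
split; first by apply/asboolP; exists 0; rewrite linear0.
move=> a _ _ /asboolP[x ->] /asboolP[y ->]; apply/asboolP.
by exists (a *: x + y); rewrite linearP.
Qed.
HB.instance Definition _ :=
  GRing.isSubmodClosed.Build K V lin_im lin_im_subproof.

End KerIm.

Section Submodule.
Variables (V : lmodType K) (S : submodClosed V).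

Record submodule : predArgType :=
  Submodule { submodule_val : V; _ : submodule_val \in S }.

HB.instance Definition _ := [isSub for submodule_val].
HB.instance Definition _ := [Choice of submodule by <:].
HB.instance Definition _ := [SubChoice_isSubLmodule of submodule by <:].

End Submodule.

Section SubmoduleMap.
Variables (U V : lmodType K) (f : {linear U -> V}).
Variables (S : submodClosed U) (T : submodClosed V).
Hypothesis fST : forall x, x \in S -> f x \in T.

Definition submodule_fun (x : submodule S) : submodule T :=
  Submodule (fST (valP x)).

Lemma submodule_fun_linear : linear submodule_fun.
Proof. by move=> a x y; apply/val_inj; rewrite /= !linearP. Qed.

Definition submodule_map : {linear submodule S -> submodule T} :=
  mk_linear submodule_fun_linear.

End SubmoduleMap.

Section Quotient.
Variables (V : lmodType K) (S : submodClosed V).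

Definition submod_zmodClosed : zmodClosed V :=
  HB.pack (GRing.SubmodClosed.sort S)
    (GRing.isZmodClosed.Build V (GRing.SubmodClosed.sort S)
       (GRing.submod_closedB (submodClosedP S))).

Definition quotient_module := Quotient.quot submod_zmodClosed.
HB.instance Definition _ := Choice.on quotient_module.
HB.instance Definition _ := Quotient.on quotient_module.
HB.instance Definition _ := GRing.Zmodule.on quotient_module.

Definition quotient_proj (x : V) : quotient_module := \pi_quotient_module x.

Lemma quotient_projP x y :
  (quotient_proj x == quotient_proj y) = (x - y \in S).
Proof. exact: esym (Quotient.idealrBE submod_zmodClosed x y). Qed.

Lemma quotient_repr x : quotient_proj (repr x) = x.
Proof. by rewrite /quotient_proj reprK. Qed.

Lemma quotient_projD x y :
  quotient_proj (x + y) = quotient_proj x + quotient_proj y.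
Proof. by rewrite /quotient_proj !piE. Qed.

Definition quotient_scale (a : K) (q : quotient_module) : quotient_module :=
  quotient_proj (a *: repr q).

Lemma quotient_scale_proj a x :
  quotient_scale a (quotient_proj x) = quotient_proj (a *: x).
Proof.
apply/eqP; rewrite quotient_projP -scalerBr rpredZ // -quotient_projP.
by rewrite quotient_repr.
Qed.

Lemma quotient_scaleA a b q :
  quotient_scale a (quotient_scale b q) = quotient_scale (a * b) q.
Proof. by rewrite -[q]quotient_repr !quotient_scale_proj scalerA. Qed.

Lemma quotient_scale1 : left_id 1 quotient_scale.
Proof. by move=> q; rewrite -[q]quotient_repr !quotient_scale_proj scale1r. Qed.

Lemma quotient_scaleDr : right_distributive quotient_scale +%R.
Proof.
move=> a p q; rewrite -[p]quotient_repr -[q]quotient_repr.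
by rewrite -quotient_projD !quotient_scale_proj scalerDr quotient_projD.
Qed.

Lemma quotient_scaleDl q : {morph quotient_scale^~ q : a b / a + b}.
Proof.
move=> a b; rewrite -[q]quotient_repr !quotient_scale_proj.
by rewrite -quotient_projD scalerDl.
Qed.

HB.instance Definition _ := GRing.Zmodule_isLmodule.Build K quotient_module
  quotient_scaleA quotient_scale1 quotient_scaleDr quotient_scaleDl.

Lemma quotient_proj_linear : linear quotient_proj.
Proof.
by move=> a x y; rewrite quotient_projD -quotient_scale_proj.
Qed.
HB.instance Definition _ :=
  GRing.isLinear.Build K V quotient_module *:%R quotient_proj
    quotient_proj_linear.

End Quotient.

Section QuotientMap.
Variables (U V : lmodType K) (f : {linear U -> V}).
Variables (S : submodClosed U) (T : submodClosed V).
Hypothesis fST : forall x, x \in S -> f x \in T.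

Definition quotient_fun (q : quotient_module S) : quotient_module T :=
  quotient_proj T (f (repr q)).

Lemma quotient_fun_proj x :
  quotient_fun (quotient_proj S x) = quotient_proj T (f x).
Proof.
apply/eqP; rewrite quotient_projP -linearB; apply: fST.
by rewrite -quotient_projP quotient_repr.
Qed.

Lemma quotient_fun_linear : linear quotient_fun.
Proof.
move=> a p q; rewrite -[p]quotient_repr -[q]quotient_repr.
by rewrite -linearP !quotient_fun_proj !linearP.
Qed.

Definition quotient_map :
  {linear quotient_module S -> quotient_module T} :=
  mk_linear quotient_fun_linear.

End QuotientMap.

Section Subquotient.

Section Def.
Variables (V : lmodType K) (Z B : submodClosed V).

Definition sub_preim : {pred submodule Z} := fun z => val z \in B.

Lemma sub_preim_subproof : submod_closed sub_preim.
Proof.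
have inE z : (z \in sub_preim) = (val z \in B) by [].
split; first by rewrite inE linear0 rpred0.
by move=> a x y; rewrite !inE linearP => Bx By; rewrite rpredD ?rpredZ.
Qed.
HB.instance Definition _ :=
  GRing.isSubmodClosed.Build K _ sub_preim sub_preim_subproof.

(* Z / (Z :&: B); in all uses below B is contained in Z. *)
Definition subquotient : lmodType K := quotient_module sub_preim.

End Def.

Variables (U V : lmodType K) (f : {linear U -> V}).
Variables (Z B : submodClosed U) (Z' B' : submodClosed V).
Hypothesis fZ : forall x, x \in Z -> f x \in Z'.
Hypothesis fB : forall x, x \in B -> f x \in B'.

Definition subquotient_map : {linear subquotient Z B -> subquotient Z' B'} :=
  @quotient_map _ _ (submodule_map fZ) (@sub_preim _ Z B) (@sub_preim _ Z' B')
    (fun z => @fB (val z)).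

End Subquotient.

Section Tensor.

Section Def.
Variables U V : lmodType K.

Definition tensor_rel : set {freeg (U * V)%type / K} := [set r |
  [\/ exists u u' v, r = << (u + u', v) >> - << (u, v) >> - << (u', v) >>,
      exists u v v', r = << (u, v + v') >> - << (u, v) >> - << (u, v') >>,
      exists a u v, r = << (a *: u, v) >> - a *: << (u, v) >>
    | exists a u v, r = << (u, a *: v) >> - a *: << (u, v) >>]].

Definition tensor : lmodType K := quotient_module (span tensor_rel).

Definition pure_tensor (u : U) (v : V) : tensor :=
  quotient_proj (span tensor_rel) << (u, v) >>.

Lemma tensor_rel0 r : tensor_rel r -> quotient_proj (span tensor_rel) r = 0.
Proof.
move=> /sub_span r0; apply/eqP.
by rewrite -(linear0 (quotient_proj _)) quotient_projP subr0.
Qed.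

Lemma pure_tensorDl u u' v :
  pure_tensor (u + u') v = pure_tensor u v + pure_tensor u' v.
Proof.
apply/eqP; rewrite -subr_eq0 opprD addrA -!linearB; apply/eqP.
by apply: tensor_rel0; apply: Or41; exists u, u', v.
Qed.

Lemma pure_tensorDr u v v' :
  pure_tensor u (v + v') = pure_tensor u v + pure_tensor u v'.
Proof.
apply/eqP; rewrite -subr_eq0 opprD addrA -!linearB; apply/eqP.
by apply: tensor_rel0; apply: Or42; exists u, v, v'.
Qed.

Lemma pure_tensorZl a u v : pure_tensor (a *: u) v = a *: pure_tensor u v.
Proof.
apply/eqP; rewrite -subr_eq0 -linearZ -linearB; apply/eqP.
by apply: tensor_rel0; apply: Or43; exists a, u, v.
Qed.

Lemma pure_tensorZr a u v : pure_tensor u (a *: v) = a *: pure_tensor u v.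
Proof.
apply/eqP; rewrite -subr_eq0 -linearZ -linearB; apply/eqP.
by apply: tensor_rel0; apply: Or44; exists a, u, v.
Qed.

Lemma tensor_ext (W : lmodType K) (f g : {linear tensor -> W}) :
  (forall u v, f (pure_tensor u v) = g (pure_tensor u v)) -> f =1 g.
Proof.
move=> fg q; rewrite -[q]quotient_repr.
pose p : {linear {freeg (U * V)%type / K} -> tensor} :=
  quotient_proj (span tensor_rel).
by apply: (@free_ext _ _ _ (f \o p) (g \o p)) => -[u v]; apply: fg.
Qed.

End Def.

Section Map.
Variables (U V U' V' : lmodType K).
Variables (f : {linear U -> U'}) (g : {linear V -> V'}).

Lemma tensor_map_subproof r : r \in span (@tensor_rel U V) ->
  free_map K (fun p => (f p.1, g p.2)) r \in span (@tensor_rel U' V').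
Proof.
set F := free_map K _ => /asboolP[s sR ->]; rewrite linear_sum big_seq.
apply: rpred_sum => c /sR Rc; rewrite linearZ; apply/rpredZ/sub_span.
case: Rc => [[u [u' [v ->]]]|[u [v [v' ->]]]|[a [u [v ->]]]|[a [u [v ->]]]].
- apply: Or41; exists (f u), (f u'), (g v).
  by rewrite !linearB /F !free_liftU /= linearD.
- apply: Or42; exists (f u), (g v), (g v').
  by rewrite !linearB /F !free_liftU /= linearD.
- apply: Or43; exists a, (f u), (g v).
  by rewrite linearB linearZ /F !free_liftU /= linearZ.
- apply: Or44; exists a, (f u), (g v).
  by rewrite linearB linearZ /F !free_liftU /= linearZ.
Qed.

Definition tensor_map : {linear tensor U V -> tensor U' V'} :=
  quotient_map tensor_map_subproof.

Lemma tensor_map_pure u v :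
  tensor_map (pure_tensor u v) = pure_tensor (f u) (g v).
Proof.
rewrite mk_linearE quotient_fun_proj; last exact: tensor_map_subproof.
by rewrite free_liftU.
Qed.

End Map.

Lemma tensor_map_square (U V U1 V1 U2 V2 U3 V3 : lmodType K)
    (f : {linear U -> U1}) (g : {linear V -> V1})
    (f' : {linear U1 -> U3}) (g' : {linear V1 -> V3})
    (h : {linear U -> U2}) (k : {linear V -> V2})
    (h' : {linear U2 -> U3}) (k' : {linear V2 -> V3}) :
  (forall u, f' (f u) = h' (h u)) -> (forall v, g' (g v) = k' (k v)) ->
  forall x, tensor_map f' g' (tensor_map f g x) =
            tensor_map h' k' (tensor_map h k x).
Proof.
move=> ff' gg'; apply: (@tensor_ext _ _ _ (tensor_map f' g' \o tensor_map f g)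
                                          (tensor_map h' k' \o tensor_map h k)).
move=> u v.
have E1 : tensor_map f' g' (tensor_map f g (pure_tensor u v)) =
          pure_tensor (f' (f u)) (g' (g v)) by rewrite !tensor_map_pure.
have E2 : tensor_map h' k' (tensor_map h k (pure_tensor u v)) =
          pure_tensor (h' (h u)) (k' (k v)) by rewrite !tensor_map_pure.
by apply: etrans E1 (etrans _ (esym E2)); rewrite ff' gg'.
Qed.

Lemma tensor_map_comp0 (U V U1 V1 U2 V2 : lmodType K)
    (f : {linear U -> U1}) (g : {linear V -> V1})
    (f' : {linear U1 -> U2}) (g' : {linear V1 -> V2}) :
  (forall u, f' (f u) = 0) \/ (forall v, g' (g v) = 0) ->
  forall x, tensor_map f' g' (tensor_map f g x) = 0.
Proof.
move=> fg0; apply: (@tensor_ext _ _ _ (tensor_map f' g' \o tensor_map f g) \0).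
move=> u v.
have E : tensor_map f' g' (tensor_map f g (pure_tensor u v)) =
         pure_tensor (f' (f u)) (g' (g v)) by rewrite !tensor_map_pure.
apply: etrans E _; case: fg0 => ->.
  by rewrite -(scale0r (0 : U2)) pure_tensorZl scale0r.
by rewrite -(scale0r (0 : V2)) pure_tensorZr scale0r.
Qed.

End Tensor.

Section Tor.

(* The canonical free cover of the kernel of f, mapped into U. *)
Definition syzygy U V (f : {linear U -> V}) :
    {linear {freeg (submodule (lin_ker f)) / K} -> U} :=
  free_lift (fun x : submodule (lin_ker f) => val x).

Section Def.
Variables A B : lmodType K.

(* The beginning F2 -> F1 -> F0 -> A -> 0 of the canonical free resolution. *)
Definition resolution_aug : {linear {freeg A / K} -> A} :=
  free_lift (fun x : A => x).
Definition resolution_d1 := syzygy resolution_aug.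
Definition resolution_d2 := syzygy resolution_d1.

Definition Tor1 : lmodType K :=
  subquotient (lin_ker (tensor_map resolution_d1 (idfun : {linear B -> B})))
              (lin_im (tensor_map resolution_d2 (idfun : {linear B -> B}))).
End Def.

Section SyzygyMap.
Variables (U V U' V' : lmodType K).
Variables (f : {linear U -> V}) (f' : {linear U' -> V'}).
Variables (a : {linear U -> U'}) (b : {linear V -> V'}).
Hypothesis abf : forall x, f' (a x) = b (f x).

Lemma syzygy_map_subproof x : x \in lin_ker f -> a x \in lin_ker f'.
Proof. by rewrite !unfold_in abf => /eqP ->; rewrite linear0. Qed.

Definition syzygy_map :
    {linear {freeg (submodule (lin_ker f)) / K} ->
            {freeg (submodule (lin_ker f')) / K}} :=
  free_map K (submodule_map syzygy_map_subproof).

Lemma syzygy_mapP x : syzygy f' (syzygy_map x) = a (syzygy f x).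
Proof.
apply: (@free_ext _ _ _ (syzygy f' \o syzygy_map) (a \o syzygy f)) => u.
transitivity (syzygy f' << submodule_map syzygy_map_subproof u >>).
  by congr (syzygy f' _); apply: free_liftU.
by rewrite [LHS]free_liftU; congr (a _); apply/esym/free_liftU.
Qed.

End SyzygyMap.

Section Map.
Variables (A A' B B' : lmodType K).
Variables (f : {linear A -> A'}) (g : {linear B -> B'}).

Lemma resolution_augP x :
  resolution_aug A' (free_map K f x) = f (resolution_aug A x).
Proof.
apply: (@free_ext _ _ _ (resolution_aug A' \o free_map K f)
          (f \o resolution_aug A)) => u.
transitivity (resolution_aug A' << f u >>).
  by congr (resolution_aug A' _); apply: free_liftU.
by rewrite [LHS]free_liftU; congr (f _); apply/esym/free_liftU.
Qed.

Definition resolution_map1 := syzygy_map resolution_augP.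
Definition resolution_map2 := syzygy_map (syzygy_mapP resolution_augP).

Lemma Tor1_map_ker x :
  x \in lin_ker (tensor_map (resolution_d1 A) (idfun : {linear B -> B})) ->
  tensor_map resolution_map1 g x
    \in lin_ker (tensor_map (resolution_d1 A') (idfun : {linear B' -> B'})).
Proof.
rewrite !unfold_in => /eqP x0; apply/eqP.
have <- : tensor_map (free_map K f) g
  (tensor_map (resolution_d1 A) (idfun : {linear B -> B}) x) = 0.
  by rewrite x0 linear0.
apply: tensor_map_square => [u|v]; last by [].
exact: (syzygy_mapP resolution_augP).
Qed.

Lemma Tor1_map_im x :
  x \in lin_im (tensor_map (resolution_d2 A) (idfun : {linear B -> B})) ->
  tensor_map resolution_map1 g x
    \in lin_im (tensor_map (resolution_d2 A') (idfun : {linear B' -> B'})).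
Proof.
move=> /asboolP[y ->]; apply/asboolP; exists (tensor_map resolution_map2 g y).
apply: tensor_map_square => [u|v]; last by [].
exact: esym (syzygy_mapP (syzygy_mapP resolution_augP) u).
Qed.

Definition Tor1_map : {linear Tor1 A B -> Tor1 A' B'} :=
  subquotient_map Tor1_map_ker Tor1_map_im.

End Map.
End Tor.

Section DirectSum.
Variable I : Type.

(* Only used for finite I, where the direct sum is the product. *)
Definition direct_sum (M : I -> lmodType K) := forall i, M i.

Section Instances.
Variable M : I -> lmodType K.
Implicit Types x y z : direct_sum M.

HB.instance Definition _ := Choice.on (direct_sum M).

Let sum0 : direct_sum M := fun=> 0.
Let sumN x : direct_sum M := fun i => - x i.
Let sumD x y : direct_sum M := fun i => x i + y i.
Let sumZ a x : direct_sum M := fun i => a *: x i.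

Lemma sumDA : associative sumD.
Proof. by move=> x y z; apply: functional_extensionality_dep => i; apply: addrA. Qed.
Lemma sumDC : commutative sumD.
Proof. by move=> x y; apply: functional_extensionality_dep => i; apply: addrC. Qed.
Lemma sum0D : left_id sum0 sumD.
Proof. by move=> x; apply: functional_extensionality_dep => i; apply: add0r. Qed.
Lemma sumND : left_inverse sum0 sumN sumD.
Proof. by move=> x; apply: functional_extensionality_dep => i; apply: addNr. Qed.
HB.instance Definition _ :=
  GRing.isZmodule.Build (direct_sum M) sumDA sumDC sum0D sumND.

Lemma sumZA a b x : sumZ a (sumZ b x) = sumZ (a * b) x.
Proof. by apply: functional_extensionality_dep => i; apply: scalerA. Qed.
Lemma sumZ1 : left_id 1 sumZ.
Proof. by move=> x; apply: functional_extensionality_dep => i; apply: scale1r. Qed.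
Lemma sumZDr : right_distributive sumZ +%R.
Proof. by move=> a x y; apply: functional_extensionality_dep => i; apply: scalerDr. Qed.
Lemma sumZDl x : {morph sumZ^~ x : a b / a + b}.
Proof. by move=> a b; apply: functional_extensionality_dep => i; apply: scalerDl. Qed.
HB.instance Definition _ :=
  GRing.Zmodule_isLmodule.Build K (direct_sum M) sumZA sumZ1 sumZDr sumZDl.

Lemma direct_sumP a x y i :
  (a *: x + y : direct_sum M) i = a *: (x i) + y i.
Proof. by []. Qed.

End Instances.

Section Map.
Variables (M N : I -> lmodType K) (f : forall i, {linear M i -> N i}).

Definition direct_sum_fun (x : direct_sum M) : direct_sum N :=
  fun i => f i (x i).

Lemma direct_sum_fun_linear : linear direct_sum_fun.
Proof.
by move=> a x y; apply: functional_extensionality_dep => i; apply: linearP.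
Qed.

Definition direct_sum_map : {linear direct_sum M -> direct_sum N} :=
  mk_linear direct_sum_fun_linear.

End Map.
End DirectSum.

End Submodules.

(* The pairs (i, j) with k + i + j = n. *)
Definition bidegree (k n : nat) := {p : nat * nat | (k + p.1 + p.2 == n)%N}.

Section Graded.
Variable K : comNzRingType.
Implicit Types A B : nat -> lmodType K.

Definition graded_tensor A B n : lmodType K :=
  direct_sum (fun p : bidegree 0 n => tensor (A (val p).1) (B (val p).2)).

(* The direct sum of Tor_1 (A i) (B j) over i + j = n - 1; it is 0 if n = 0. *)
Definition graded_Tor1 A B n : lmodType K :=
  direct_sum (fun p : bidegree 1 n => Tor1 (A (val p).1) (B (val p).2)).

Section Maps.
Variables (A A' B B' : nat -> lmodType K).
Variables (f : forall i, {linear A i -> A' i}).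
Variables (g : forall i, {linear B i -> B' i}).

Definition graded_tensor_map n :
    {linear graded_tensor A B n -> graded_tensor A' B' n} :=
  direct_sum_map (fun p : bidegree 0 n =>
    tensor_map (f (val p).1) (g (val p).2)).

Definition graded_Tor1_map n :
    {linear graded_Tor1 A B n -> graded_Tor1 A' B' n} :=
  direct_sum_map (fun p : bidegree 1 n =>
    Tor1_map (f (val p).1) (g (val p).2)).

End Maps.
End Graded.

Section ChainComplexes.
Variable K : comNzRingType.

Record chain_complex := ChainComplex {
  chain :> nat -> lmodType K;
  chain_diff : forall n, {linear chain n.+1 -> chain n};
  chain_diffK : forall n x, chain_diff n (chain_diff n.+1 x) = 0
}.

Record chain_map (C D : chain_complex) := ChainMap {
  chain_fun :> forall n, {linear C n -> D n};
  chain_funP : forall n x,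
    chain_fun n (chain_diff C n x) = chain_diff D n (chain_fun n.+1 x)
}.

Definition chain_isomorphic (C D : chain_complex) : Prop :=
  exists f : chain_map C D, forall n, bijective (f n).

Section Homology.
Variable C : chain_complex.

Definition chain_cycle n : {pred C n} :=
  match n return {pred C n} with
  | 0 => predT
  | m.+1 => lin_ker (chain_diff C m)
  end.

Lemma cycle_subproof n : submod_closed (@chain_cycle n).
Proof. by case: n => [|n]; [split | apply: lin_ker_subproof]. Qed.
HB.instance Definition _ n :=
  GRing.isSubmodClosed.Build K (C n) (@chain_cycle n) (cycle_subproof n).

Definition homology n : lmodType K :=
  subquotient (@chain_cycle n) (lin_im (chain_diff C n)).

Lemma boundary_cycle n x : x \in lin_im (chain_diff C n) -> x \in @chain_cycle n.
Proof.
case: n x => [//|n] x /asboolP[y ->].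
by have /eqP := chain_diffK y.
Qed.

End Homology.

Section HomologyMap.
Variables (C D : chain_complex) (f : chain_map C D) (n : nat).

Lemma cycle_map x : x \in @chain_cycle C n -> f n x \in @chain_cycle D n.
Proof.
case: n x => [//|m] x /eqP x0.
by have /eqP := chain_funP f x; rewrite x0 linear0 eq_sym.
Qed.

Lemma boundary_map x :
  x \in lin_im (chain_diff C n) -> f n x \in lin_im (chain_diff D n).
Proof.
by move=> /asboolP[y ->]; apply/asboolP; exists (f n.+1 y); rewrite chain_funP.
Qed.

Definition homology_map : {linear homology C n -> homology D n} :=
  subquotient_map cycle_map boundary_map.

End HomologyMap.

Section TensorComplex.
Variables C D : chain_complex.

Definition tensor_chain n : lmodType K := graded_tensor C D n.

Lemma bidegree_succl n (p : bidegree 0 n) :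
  (0 + ((val p).1.+1, (val p).2).1 + ((val p).1.+1, (val p).2).2 == n.+1)%N.
Proof. by rewrite add0n addSn eqSS (valP p). Qed.

Lemma bidegree_succr n (p : bidegree 0 n) :
  (0 + ((val p).1, (val p).2.+1).1 + ((val p).1, (val p).2.+1).2 == n.+1)%N.
Proof. by rewrite add0n addnS eqSS (valP p). Qed.

Definition succl n (p : bidegree 0 n) : bidegree 0 n.+1 :=
  exist _ ((val p).1.+1, (val p).2) (bidegree_succl p).

Definition succr n (p : bidegree 0 n) : bidegree 0 n.+1 :=
  exist _ ((val p).1, (val p).2.+1) (bidegree_succr p).

(* d (x (x) y) = d x (x) y + (-1)^i x (x) d y for x in C i; the (i, j)
   component of d z only involves the components (i+1, j) and (i, j+1) of z. *)
Definition tensor_diff_fun n (z : tensor_chain n.+1) : tensor_chain n :=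
  fun p => tensor_map (chain_diff C (val p).1) idfun (z (succl p))
    + (-1) ^+ (val p).1 *:
        tensor_map idfun (chain_diff D (val p).2) (z (succr p)).

Lemma linear_comb_linear (V1 V2 W : lmodType K) (f : {linear V1 -> W})
    (g : {linear V2 -> W}) (s a : K) x1 y1 x2 y2 :
  f (a *: x1 + y1) + s *: g (a *: x2 + y2) =
  a *: (f x1 + s *: g x2) + (f y1 + s *: g y2).
Proof.
by rewrite !(linearP, scalerDr) /= addrACA.
Qed.

Lemma tensor_diff_linear n : linear (@tensor_diff_fun n).
Proof.
move=> a x y; apply: functional_extensionality_dep => p.
exact: linear_comb_linear.
Qed.

Definition tensor_diff n : {linear tensor_chain n.+1 -> tensor_chain n} :=
  mk_linear (@tensor_diff_linear n).

Lemma tensor_diffK n (x : tensor_chain n.+2) :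
  tensor_diff n (tensor_diff n.+1 x) = 0.
Proof.
apply: functional_extensionality_dep => p.
rewrite -[LHS]/(tensor_diff_fun (tensor_diff_fun x) p) /tensor_diff_fun.
case: p => -[i j] e.
have key x20 x11 x11' x02 : x11' = x11 ->
  tensor_map (chain_diff C i) idfun
    (tensor_map (chain_diff C i.+1) idfun x20 +
      (-1) ^+ i.+1 *: tensor_map idfun (chain_diff D j) x11) +
  (-1) ^+ i *: tensor_map idfun (chain_diff D j)
    (tensor_map (chain_diff C i) idfun x11' +
      (-1) ^+ i *: tensor_map idfun (chain_diff D j.+1) x02) = 0.
  move=> ->.
  have E1 : tensor_map (chain_diff C i) (idfun : {linear D j -> D j})
      (tensor_map (chain_diff C i.+1) idfun x20) = 0.
    by apply: tensor_map_comp0; left; apply: chain_diffK.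
  have E2 : tensor_map (idfun : {linear C i -> C i}) (chain_diff D j)
      (tensor_map idfun (chain_diff D j.+1) x02) = 0.
    by apply: tensor_map_comp0; right; apply: chain_diffK.
  have E3 : tensor_map (chain_diff C i) (idfun : {linear D j -> D j})
      (tensor_map idfun (chain_diff D j) x11) =
    tensor_map idfun (chain_diff D j)
      (tensor_map (chain_diff C i) idfun x11).
    by apply: tensor_map_square.
  rewrite !linearD !linearZ E1 E2 E3 /= !scaler0 addr0 add0r.
  by rewrite exprS mulN1r scaleNr addNr.
apply: key.
pose X (e' : (0 + i.+1 + j.+1 == n.+2)%N) : tensor (C i.+1) (D j.+1) :=
  x (exist _ (i.+1, j.+1) e').
have XE e1 e2 : X e1 = X e2 by rewrite (bool_irrelevance e1 e2).
exact: XE.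
Qed.

Definition tensor_complex : chain_complex := ChainComplex tensor_diffK.

End TensorComplex.
End ChainComplexes.

Record marked_group := MarkedGroup {
  mg_group :> groupType;
  mg_mark : set mg_group;
  mg_mark1 : mg_mark 1%g
}.
Arguments mg_mark : clear implicits.

Record marked_morphism (X Y : marked_group) := MarkedMorphism {
  mm_fun :> UMagmaMorphism.type X Y;
  mm_mark : forall x, mg_mark X x -> mg_mark Y (mm_fun x)
}.

Section Wedge.
Local Open Scope group_scope.

Definition wedge_mark (X Y : marked_group) : set (X * Y)%type :=
  (mg_mark X `*` [set 1]) `|` ([set 1] `*` mg_mark Y).

Arguments wedge_mark : clear implicits.

Lemma wedge_mark1 X Y : wedge_mark X Y 1.
Proof. by left; split; [apply: mg_mark1|]. Qed.

Definition wedge (X Y : marked_group) : marked_group :=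
  @MarkedGroup (X * Y)%type (wedge_mark X Y) (wedge_mark1 X Y).

Section Map.
Variables (X Y X' Y' : marked_group).
Variables (f : marked_morphism X X') (g : marked_morphism Y Y').

Definition wedge_fun (p : wedge X Y) : wedge X' Y' := (f p.1, g p.2).

Lemma wedge_fun_morphism : {morph wedge_fun : p q / p / q}.
Proof. by move=> p q; rewrite /wedge_fun /= !gmulfF. Qed.

Definition wedge_morphism : UMagmaMorphism.type (wedge X Y) (wedge X' Y') :=
  HB.pack wedge_fun
    (isGroupMorphism.Build (wedge X Y) (wedge X' Y') wedge_fun
       wedge_fun_morphism).

Lemma wedge_morphism_mark p :
  mg_mark (wedge X Y) p -> mg_mark (wedge X' Y') (wedge_morphism p).
Proof.
case: p => x y [[/= Mx ->]|[/= -> My]]; [left|right]; split => /=;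
  by [apply: mm_mark | rewrite gmulf1].
Qed.

Definition wedge_map : marked_morphism (wedge X Y) (wedge X' Y') :=
  MarkedMorphism wedge_morphism_mark.

End Map.
End Wedge.

Section Nerve.
Variable K : comNzRingType.

Section Face.
Variable G : groupType.
Local Open Scope group_scope.

(* The entries g_1, ..., g_n of t are stored at positions 0, ..., n-1: face 0
   deletes the first entry of t, face n the last one of t, and face i for
   0 < i < n replaces g_i, g_(i+1) by g_(i+1) g_i. *)
Definition face n (i : nat) (t : n.+1.-tuple G) : n.-tuple G :=
  [tuple if (k.+1 < i)%N then nth 1 t k
         else if k.+1 == i then nth 1 t k.+1 * nth 1 t k
         else nth 1 t k.+1 | k < n].

Lemma nth_face n i (t : n.+1.-tuple G) k : (k < n)%N ->
  nth 1 (face i t) k =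
    if (k.+1 < i)%N then nth 1 t k
    else if k.+1 == i then nth 1 t k.+1 * nth 1 t k
    else nth 1 t k.+1.
Proof. by move=> kn; rewrite (nth_mktuple _ _ (Ordinal kn)). Qed.

Lemma face_ext n (t u : n.-tuple G) :
  (forall k, (k < n)%N -> nth 1 t k = nth 1 u k) -> t = u.
Proof.
by move=> tu; apply: eq_from_tnth => k; rewrite !(tnth_nth 1) tu.
Qed.

Lemma face_face n i j (t : n.+2.-tuple G) : (i <= j)%N ->
  face i (face j.+1 t) = face j (face i t).
Proof.
move=> ij; apply: face_ext => k kn.
have kn1 : (k < n.+1)%N by exact: ltnW.
rewrite !(nth_face _ _ kn) !(nth_face _ _ kn1) !(nth_face _ _ (kn : (k.+1 < n.+1)%N)).
by repeat (case: ifP => ?); try (exfalso; lia); rewrite // mulgA.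
Qed.

Lemma face_degenerate n (t : n.+1.-tuple G) k : (k <= n)%N -> nth 1 t k = 1 ->
  face k t = face k.+1 t.
Proof.
move=> kn tk; apply: face_ext => l ln; rewrite !nth_face //.
repeat (case: ifP => ?) => //; try (exfalso; lia).
  have -> : l.+1 = k by lia. by rewrite tk mul1g.
have -> : l = k by lia. by rewrite tk mulg1.
Qed.

Lemma face_unit n i (t : n.+1.-tuple G) k : (k <= n)%N -> (i <= n.+1)%N ->
  nth 1 t k = 1 -> i != k -> i != k.+1 ->
  exists2 l, (l < n)%N & nth 1 (face i t) l = 1.
Proof.
move=> kn iN tk ik ik1; case: (ltnP i k) => ik2.
  exists k.-1; first by lia.
  rewrite nth_face; last by lia.
  have -> : k.-1.+1 = k by lia.
  by rewrite tk; repeat (case: ifP => ?); try (exfalso; lia).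
exists k; first by lia.
rewrite nth_face; last by lia.
by rewrite tk; repeat (case: ifP => ?); try (exfalso; lia).
Qed.

End Face.

Section Symbols.
Variable G : groupType.

Definition nondegenerate n := {t : n.-tuple G | all (fun g => g != 1%g) t}.

Definition nerve_chain n : lmodType K := {freeg (nondegenerate n) / K}.

Definition symbol n (t : n.-tuple G) : nerve_chain n :=
  oapp (fun s : nondegenerate n => << s >>) 0 (insub t).

Lemma symbol_val n (s : nondegenerate n) : symbol (val s) = << s >>.
Proof. by rewrite /symbol valK. Qed.

Lemma symbol_degenerate n (t : n.-tuple G) k :
  (k < n)%N -> nth 1%g t k = 1%g -> symbol t = 0.
Proof.
move=> kn tk; rewrite /symbol insubF //; apply/negbTE/allPn; exists 1%g.
  by rewrite -tk mem_nth // size_tuple.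
by rewrite eqxx.
Qed.

Definition symbol_diff n (t : n.+1.-tuple G) : nerve_chain n :=
  \sum_(i < n.+2) (-1) ^+ i *: symbol (face i t).

Definition nerve_diff n : {linear nerve_chain n.+1 -> nerve_chain n} :=
  free_lift (fun s : nondegenerate n.+1 => symbol_diff (val s)).

Lemma boundary_degenerate n (t : n.+1.-tuple G) k :
  (k <= n)%N -> nth 1%g t k = 1%g -> symbol_diff t = 0.
Proof.
move=> kn tk.
have k1 : (k < n.+2)%N by lia.
have k2 : (k.+1 < n.+2)%N by lia.
rewrite /symbol_diff (bigD1 (Ordinal k1)) //= (bigD1 (Ordinal k2)) /=; last first.
  by rewrite -val_eqE /= gtn_eqF.
rewrite big1 => [|i /andP[ik ik1]].
  by rewrite addr0 (face_degenerate kn tk) exprS mulN1r scaleNr subrr.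
have iN : (i <= n.+1)%N by rewrite -ltnS ltn_ord.
have [l ln El] := face_unit kn iN tk ik ik1.
by rewrite (symbol_degenerate ln El) scaler0.
Qed.

Lemma degenerateP n (t : n.-tuple G) :
  ~~ all (fun g => g != 1%g) t -> exists2 k, (k < n)%N & nth 1%g t k = 1%g.
Proof.
move=> /allPn[g gt]; rewrite negbK => /eqP g1; exists (index g t).
  by rewrite -[X in (_ < X)%N](size_tuple t) index_mem.
by rewrite nth_index.
Qed.

Lemma nerve_diff_symbol n (t : n.+1.-tuple G) :
  nerve_diff n (symbol t) = symbol_diff t.
Proof.
have [t1|/degenerateP[k kn tk]] := boolP (all (fun g => g != 1%g) t).
  by rewrite -[t]/(val (exist _ t t1 : nondegenerate n.+1)) symbol_val free_liftU.
by rewrite (symbol_degenerate kn tk) (boundary_degenerate _ tk) ?linear0.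
Qed.

Lemma alternating_sum (V : zmodType) (F : nat -> nat -> V) m :
  (forall i j, (i <= j)%N -> F i j.+1 = - F j i) ->
  \sum_(j < m.+1) \sum_(i < m) F i j = 0.
Proof.
move=> Falt.
transitivity (\sum_(j < m.+1) (\sum_(i < m | (i < j)%N) F i j +
                               \sum_(i < m | ~~ (i < j)%N) F i j)).
  by apply: eq_bigr => j _; rewrite (bigID (fun i : 'I_m => (i < j)%N)).
rewrite big_split /= big_ord_recl big1 // add0r.
rewrite [X in _ + X]big_ord_recr /= [X in _ + (_ + X)]big1 ?addr0; last first.
  by move=> i; rewrite ltn_ord.
rewrite [X in _ + X](exchange_big_dep xpredT) //=.
rewrite -big_split /= big1 // => j _.
apply/eqP; rewrite addrC addr_eq0 -sumrN; apply/eqP.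
apply: eq_big => i; first by rewrite -leqNgt /bump add1n ltnS.
by rewrite -leqNgt /bump add1n => ij; rewrite Falt ?opprK.
Qed.

Lemma nerve_diffK n x : nerve_diff n (nerve_diff n.+1 x) = 0.
Proof.
apply: (@free_ext _ _ _ (nerve_diff n \o nerve_diff n.+1) \0) => s.
transitivity (nerve_diff n (symbol_diff (val s))).
  by congr (nerve_diff n _); apply: free_liftU.
rewrite linear_sum -[RHS]/0.
pose F i j : nerve_chain n := (-1) ^+ (i + j) *: symbol (face i (face j (val s))).
rewrite -[RHS](@alternating_sum _ F n.+2) => [|i j ij].
  apply: eq_bigr => j _; rewrite linearZ_LR nerve_diff_symbol /symbol_diff scaler_sumr.
  by apply: eq_bigr => i _; rewrite /F scalerA -exprD addnC.
by rewrite /F face_face // addnS exprS mulN1r scaleNr addnC.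
Qed.

Definition nerve : chain_complex K := ChainComplex nerve_diffK.

End Symbols.

Section NerveMap.
Variables (G H : groupType) (f : UMagmaMorphism.type G H).

Definition nerve_map n : {linear nerve G n -> nerve H n} :=
  free_lift (fun s : nondegenerate G n => symbol (map_tuple f (val s))).

Lemma nerve_map_symbol n (t : n.-tuple G) :
  nerve_map n (symbol t) = symbol (map_tuple f t).
Proof.
have [t1|/degenerateP[k kn tk]] := boolP (all (fun g => g != 1%g) t).
  by rewrite -[t]/(val (exist _ t t1 : nondegenerate G n)) symbol_val free_liftU.
rewrite (symbol_degenerate kn tk) linear0 (symbol_degenerate kn) //.
by rewrite (nth_map 1%g) ?size_tuple // tk gmulf1.
Qed.

Lemma face_map n i (t : n.+1.-tuple G) :
  map_tuple f (face i t) = face i (map_tuple f t).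
Proof.
have E l : (l < n.+1)%N -> nth 1%g (map_tuple f t) l = f (nth 1%g t l).
  by move=> ln; rewrite (nth_map 1%g) ?size_tuple.
apply: face_ext => k kn; rewrite (nth_map 1%g) ?size_tuple // !nth_face //.
have kn1 : (k < n.+1)%N by exact: ltnW.
rewrite (E _ kn1) (E _ (kn : (k.+1 < n.+1)%N)).
by case: ifP => // _; case: ifP => // _; rewrite gmulfM.
Qed.

Lemma nerve_mapP n x :
  nerve_map n (nerve_diff G n x) = nerve_diff H n (nerve_map n.+1 x).
Proof.
apply: (@free_ext _ _ _ (nerve_map n \o nerve_diff G n)
                        (nerve_diff H n \o nerve_map n.+1)) => s.
transitivity (nerve_map n (symbol_diff (val s))).
  by congr (nerve_map n _); apply: free_liftU.
transitivity (nerve_diff H n (symbol (map_tuple f (val s)))); last first.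
  by congr (nerve_diff H n _); apply/esym/free_liftU.
rewrite nerve_diff_symbol /symbol_diff linear_sum; apply: eq_bigr => i _.
by rewrite linearZ nerve_map_symbol face_map.
Qed.

End NerveMap.

Section Omega.
Variable X : marked_group.

(* The graded submodule spanned by the symbols with all entries in the mark. *)
Definition nerve_mark n : {pred nerve X n} :=
  span [set x | exists2 t : n.-tuple X,
                  (forall g, g \in t -> mg_mark X g) & x = symbol t].

HB.instance Definition _ n := GRing.SubmodClosed.on (@nerve_mark n).

(* In degree 0 the condition on the boundary is void. *)
Definition omega_pred n : {pred nerve X n} :=
  match n return {pred nerve X n} with
  | 0 => @nerve_mark 0
  | m.+1 => fun x => (x \in @nerve_mark m.+1) &&
                     (nerve_diff X m x \in @nerve_mark m)
  end.

Lemma omega_subproof n : submod_closed (@omega_pred n).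
Proof.
case: n => [|n]; first exact: span_subproof.
have inE x : (x \in @omega_pred n.+1) =
  (x \in @nerve_mark n.+1) && (nerve_diff X n x \in @nerve_mark n) by [].
split; first by rewrite inE linear0 !rpred0.
move=> a x y; rewrite !inE linearP => /andP[Mx Mdx] /andP[My Mdy].
by rewrite !rpredD ?rpredZ.
Qed.
HB.instance Definition _ n :=
  GRing.isSubmodClosed.Build K (nerve X n) (@omega_pred n) (omega_subproof n).

Lemma omega_diff_subproof n x :
  x \in @omega_pred n.+1 -> nerve_diff X n x \in @omega_pred n.
Proof.
move=> /andP[_ Mdx]; case: n x Mdx => [//|n] x Mdx; apply/andP; split => //.
by rewrite nerve_diffK rpred0.
Qed.

Definition omega_diff n :
    {linear submodule (@omega_pred n.+1) -> submodule (@omega_pred n)} :=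
  submodule_map (@omega_diff_subproof n).

Lemma omega_diffK n x : omega_diff n (omega_diff n.+1 x) = 0.
Proof. by apply: val_inj; apply: nerve_diffK. Qed.

Definition omega : chain_complex K := ChainComplex omega_diffK.

Definition path_homology n : lmodType K := homology omega n.

End Omega.

Section OmegaMap.
Variables (X Y : marked_group) (f : marked_morphism X Y).

Lemma nerve_mark_map n x :
  x \in @nerve_mark X n -> nerve_map f n x \in @nerve_mark Y n.
Proof.
move=> /asboolP[s sM ->]; rewrite linear_sum big_seq.
apply: rpred_sum => c /sM[t tM ->]; rewrite linearZ nerve_map_symbol.
apply/rpredZ/sub_span; exists (map_tuple f t) => // g /mapP[h ht ->].
exact/mm_mark/tM.
Qed.

Lemma omega_map_subproof n x :
  x \in @omega_pred X n -> nerve_map f n x \in @omega_pred Y n.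
Proof.
case: n x => [|n] x; first exact: nerve_mark_map.
move=> /andP[Mx Mdx]; apply/andP; split; first exact: nerve_mark_map.
by rewrite -nerve_mapP; apply: nerve_mark_map.
Qed.

Definition omega_fun n : {linear omega X n -> omega Y n} :=
  submodule_map (@omega_map_subproof n).

Lemma omega_funP n x :
  omega_fun n (chain_diff (omega X) n x) =
  chain_diff (omega Y) n (omega_fun n.+1 x).
Proof. by apply: val_inj; apply: nerve_mapP. Qed.

Definition omega_map : chain_map (omega X) (omega Y) := ChainMap omega_funP.

Definition path_homology_map n :
    {linear path_homology X n -> path_homology Y n} :=
  homology_map omega_map n.

End OmegaMap.
End Nerve.

Definition short_exact (K : comNzRingType) (U V W : lmodType K)
    (f : {linear U -> V}) (g : {linear V -> W}) : Prop :=
  [/\ injective f,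
      forall y, g y = 0 <-> exists x, y = f x
    & forall z, exists y, z = g y].

(* Main.v *)
(** The letters (g, 1) and (1, h) commute in G x G', and their products lie off the wedge.
    Hence the boundary of a chain on words in M v M' stays on M v M' only if its coefficients
    are antisymmetric under exchanging adjacent letters of the two kinds, so the chain is the
    shuffle product of its part on sorted words, which is its Alexander-Whitney image. Since
    shuffling is a chain map, that part is annihilated by the functionals cutting out
    Omega(G, M) and Omega(G', M'). Over a principal ideal domain submodules of free modules are
    free, by a well-ordering of the basis and generators of the ideals of leading coefficients;
    thus the tensor product of Omega(G, M) and Omega(G', M') is the common kernel of these
    functionals, and the shuffle product is an isomorphism onto Omega(G x G', M v M'). The
    same freeness splits the cycles of both complexes off and gives the Kuenneth sequence; its
    map to Tor is defined with such a splitting, and is natural because two splittings differ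
    by a map that vanishes on cycles, and such a map does not contribute. *)

From HB Require Import structures.
From mathcomp Require Import all_boot all_algebra zify ring.
From mathcomp Require Import boolp classical_sets wochoice.
From mathcomp.multinomials Require Import freeg.
Require Import Defs.

Set Implicit Arguments.
Unset Strict Implicit.
Unset Printing Implicit Defensive.

Import GRing.Theory.
Local Open Scope ring_scope.

(** * Linear maps and tensor products *)

(** The shuffle product is built on the free module on lists of letters, units allowed and all
    lengths at once, and is pushed to normalized chains only afterwards. On lists the boundary
    splits into face 0 and the remaining faces, and each part obeys its own Leibniz rule; on
    normalized chains this splitting makes no sense, because a word beginning with 1 is zero there
    although deleting its first letter need not give zero. The Alexander-Whitney map serves only as
    a one-sided inverse: it undoes the shuffle product on all chains, while the other composite is
    the identity just on Omega of the largest wedge, where all of G x 1 and 1 x G' is marked. That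
    it respects boundaries on Omega of a wedge is then formal and needs no computation. Tor is
    defined by a canonical, very large free resolution, because that is functorial on the nose;
    computations use 0 -> B -> Z -> H -> 0 instead, and a null-homotopy argument makes the passage
    between the two surjective and natural. *)

Section LinearAlgebra.
Variable K : comNzRingType.
Implicit Types U V W : lmodType K.

Definition quot_lift V W (S : submodClosed V) (f : {linear V -> W})
  (fS : forall x, x \in S -> f x = 0) (q : quotient_module S) : W := f (repr q).

Lemma quot_lift_proj V W (S : submodClosed V) (f : {linear V -> W})
    (fS : forall x, x \in S -> f x = 0) x :
  quot_lift fS (quotient_proj S x) = f x.
Proof.
apply/eqP; rewrite -subr_eq0 /quot_lift -linearB fS //.
by rewrite -quotient_projP quotient_repr.
Qed.

Lemma quot_lift_linear V W (S : submodClosed V) (f : {linear V -> W})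
  (fS : forall x, x \in S -> f x = 0) : linear (quot_lift fS).
Proof.
move=> a p q; rewrite -[p]quotient_repr -[q]quotient_repr.
by rewrite -linearP !quot_lift_proj linearP.
Qed.

Definition quotient_lift V W (S : submodClosed V) (f : {linear V -> W})
    (fS : forall x, x \in S -> f x = 0) : {linear quotient_module S -> W} :=
  mk_linear (quot_lift_linear fS).

Lemma quotient_liftE V W (S : submodClosed V) (f : {linear V -> W})
    (fS : forall x, x \in S -> f x = 0) x :
  quotient_lift fS (quotient_proj S x) = f x.
Proof. exact: quot_lift_proj. Qed.

Lemma quotient_proj_eq0 V (S : submodClosed V) x :
  (quotient_proj S x == 0) = (x \in S).
Proof. by rewrite -(linear0 (quotient_proj S)) quotient_projP subr0. Qed.

Lemma quotient_ind V (S : submodClosed V) (P : quotient_module S -> Prop) :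
  (forall x, P (quotient_proj S x)) -> forall q, P q.
Proof. by move=> PS q; rewrite -[q]quotient_repr. Qed.

Lemma freegUZ (A : choiceType) (k : K) (a : A) :
  << k *g a >> = k *: << a >> :> {freeg A / K}.
Proof. by apply/eqP/freeg_eqP => y; rewrite coeffZ !coeffU mul1r. Qed.

Lemma freeg_expand (A : choiceType) (D : {freeg A / K}) (s : seq A) :
  uniq s -> {subset dom D <= s} -> D = \sum_(a <- s) coeff a D *: << a >>.
Proof.
move=> us sD; apply/eqP/freeg_eqP => y; rewrite raddf_sum /=.
have [ys|yNs] := boolP (y \in s).
  rewrite (bigD1_seq y) //= coeffZ coeffU mul1r eqxx mulr1 big1 ?addr0 // => a ay.
  by rewrite coeffZ coeffU mul1r (negbTE ay) mulr0.
rewrite coeff_outdom ?(contra (sD y)) // big_seq big1 // => a As.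
rewrite coeffZ coeffU mul1r; case: eqP => [E|_]; last by rewrite mulr0.
by rewrite -E As in yNs.
Qed.

Lemma coeff_linear (A : choiceType) (a : A) :
  linear (coeff a : {freeg A / K} -> K^o).
Proof. by move=> k x y; rewrite raddfD /= coeffZ. Qed.

Definition coeff_lin (A : choiceType) (a : A) : {linear {freeg A / K} -> K^o} :=
  mk_linear (@coeff_linear A a).

Definition comp_lin U V W (g : {linear V -> W}) (f : {linear U -> V}) :
  {linear U -> W} := g \o f.

Lemma comp_linE U V W (g : {linear V -> W}) (f : {linear U -> V}) x :
  comp_lin g f x = g (f x).
Proof. by []. Qed.

Lemma sub_linear U V (f g : {linear U -> V}) : linear (fun x => f x - g x).
Proof. by move=> a x y; rewrite (linearP f) (linearP g) scalerBr opprD addrACA. Qed.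

Definition sub_lin U V (f g : {linear U -> V}) : {linear U -> V} :=
  mk_linear (sub_linear f g).

Lemma sub_linE U V (f g : {linear U -> V}) x : sub_lin f g x = f x - g x.
Proof. by []. Qed.

Lemma scale_linear U V (a : K) (f : {linear U -> V}) : linear (fun x => a *: f x).
Proof. by move=> b x y; rewrite linearP scalerDr !scalerA mulrC. Qed.

Definition scale_lin U V (a : K) (f : {linear U -> V}) : {linear U -> V} :=
  mk_linear (scale_linear a f).

Lemma scale_linE U V (a : K) (f : {linear U -> V}) x : scale_lin a f x = a *: f x.
Proof. by []. Qed.

Lemma inj_linP U V (f : {linear U -> V}) :
  (forall x, f x = 0 -> x = 0) -> injective f.
Proof.
move=> f0 x y fxy; apply/eqP; rewrite -subr_eq0; apply/eqP/f0.
by rewrite linearB fxy subrr.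
Qed.

Lemma inj_lin0 U V (f : {linear U -> V}) x : injective f -> f x = 0 -> x = 0.
Proof. by move=> fI fx; apply: fI; rewrite fx linear0. Qed.

Lemma val_linear V (S : submodClosed V) : linear (val : submodule S -> V).
Proof. by move=> a x y; rewrite linearP. Qed.

Definition incl V (S : submodClosed V) : {linear submodule S -> V} :=
  mk_linear (@val_linear V S).

Lemma incl_inj V (S : submodClosed V) : injective (incl S).
Proof. exact: val_inj. Qed.

Section Corestriction.
Variables (U V : lmodType K) (f : {linear U -> V}) (S : submodClosed V).
Hypothesis fS : forall x, f x \in S.

Definition corestr_fun (x : U) : submodule S := Submodule (fS x).
Lemma corestr_linear : linear corestr_fun.
Proof. by move=> a x y; apply/val_inj; rewrite /= !linearP. Qed.
Definition corestr : {linear U -> submodule S} := mk_linear corestr_linear.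
End Corestriction.

Section InverseLinear.
Variables (U V : lmodType K) (f : {linear U -> V}) (g : V -> U).
Hypotheses (fK : cancel f g) (gK : cancel g f).
Lemma inv_linear : linear g.
Proof. by move=> a x y; apply: (can_inj fK); rewrite linearP !gK. Qed.
Definition inv_lin : {linear V -> U} := mk_linear inv_linear.
Lemma inv_linE x : inv_lin x = g x. Proof. by []. Qed.
End InverseLinear.

Section TensorLift.
Variables (U V W : lmodType K) (b : U -> V -> W).
Hypotheses (bl : forall v, linear (b^~ v)) (br : forall u, linear (b u)).

Lemma tensor_lift_subproof (r : {freeg (U * V)%type / K}) :
  r \in span (@tensor_rel K U V) -> free_lift (fun p => b p.1 p.2) r = 0.
Proof.
set F := free_lift _; move=> rR; apply/eqP.
have lD v u u' : b (u + u') v = b u v + b u' v.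
  by have := bl v 1 u u'; rewrite !scale1r.
have l0 v : b 0 v = 0 by have := lD v 0 0; rewrite addr0 => /eqP; rewrite addrC -subr_eq subrr
  => /eqP.
have lZ v a u : b (a *: u) v = a *: b u v.
  by have := bl v a u 0; rewrite l0 !addr0.
have rD u v v' : b u (v + v') = b u v + b u v'.
  by have := br u 1 v v'; rewrite !scale1r.
have r0 u : b u 0 = 0 by have := rD u 0 0; rewrite addr0 => /eqP; rewrite addrC -subr_eq subrr
  => /eqP.
have rZ u a v : b u (a *: v) = a *: b u v.
  by have := br u a v 0; rewrite r0 !addr0.
rewrite -[_ == 0]/(r \in lin_ker F); apply: (span_min _ rR) => {rR r}.
move=> r; rewrite /= unfold_in => -[[u [u' [v ->]]]|[u [v [v' ->]]]|[a [u [v ->]]]|[a [u [v ->]]]].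
- by rewrite !linearB /F !free_liftU /= lD -addrA -opprD subrr.
- by rewrite !linearB /F !free_liftU /= rD -addrA -opprD subrr.
- by rewrite linearB linearZ /F !free_liftU /= lZ subrr.
- by rewrite linearB linearZ /F !free_liftU /= rZ subrr.
Qed.

Definition tensor_lift : {linear tensor U V -> W} :=
  quotient_lift tensor_lift_subproof.

Lemma tensor_liftE u v : tensor_lift (pure_tensor u v) = b u v.
Proof. by rewrite /tensor_lift quotient_liftE free_liftU. Qed.

End TensorLift.

Lemma tensor_ind U V (P : tensor U V -> Prop) :
  (forall u v, P (pure_tensor u v)) -> (forall x y, P x -> P y -> P (x + y)) ->
  forall x, P x.
Proof.
move=> Pp PD; apply: quotient_ind; elim/freeg_ind_dom0 => [|k [u v] D _ _ IH].
  have -> : quotient_proj (span (@tensor_rel K U V)) 0 = pure_tensor 0 0.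
    by rewrite linear0 -[X in pure_tensor X _](scale0r (0 : U)) pure_tensorZl scale0r.
  exact: Pp.
rewrite linearD; apply: PD => //; rewrite freegUZ linearZ /=.
by rewrite -[quotient_proj _ _]/(pure_tensor u v) -pure_tensorZl.
Qed.

Lemma pure_linearl U V (v : V) : linear ((@pure_tensor K U V)^~ v).
Proof. by move=> a x y; rewrite pure_tensorDl pure_tensorZl. Qed.
Lemma pure_linearr U V (u : U) : linear (@pure_tensor K U V u).
Proof. by move=> a x y; rewrite pure_tensorDr pure_tensorZr. Qed.

Definition purel U V (v : V) : {linear U -> tensor U V} :=
  mk_linear (@pure_linearl U V v).
Definition purer U V (u : U) : {linear V -> tensor U V} :=
  mk_linear (@pure_linearr U V u).

Lemma pure0l U V (v : V) : pure_tensor (0 : U) v = 0.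
Proof. exact: (linear0 (purel U v)). Qed.
Lemma pure0r U V (u : U) : pure_tensor u (0 : V) = 0.
Proof. exact: (linear0 (purer V u)). Qed.

Lemma tensor_extf U V W (f g : {linear tensor U V -> W}) :
  (forall u v, f (pure_tensor u v) = g (pure_tensor u v)) -> forall x, f x = g x.
Proof. exact: tensor_ext. Qed.

Lemma tensor_map_comp U V U1 V1 U2 V2
    (f : {linear U -> U1}) (g : {linear V -> V1})
    (f' : {linear U1 -> U2}) (g' : {linear V1 -> V2})
    (h : {linear U -> U2}) (k : {linear V -> V2}) :
  (forall u, f' (f u) = h u) -> (forall v, g' (g v) = k v) ->
  forall x, tensor_map f' g' (tensor_map f g x) = tensor_map h k x.
Proof.
move=> ff gg; apply: (@tensor_extf _ _ _ (comp_lin (tensor_map f' g') (tensor_map f g))).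
move=> u v; rewrite comp_linE [tensor_map f g _]tensor_map_pure !tensor_map_pure.
by rewrite ff gg.
Qed.

Lemma tensor_map_id U V (f : {linear U -> U}) (g : {linear V -> V}) :
  (forall u, f u = u) -> (forall v, g v = v) -> forall x, tensor_map f g x = x.
Proof.
move=> fE gE; apply: (@tensor_extf _ _ _ (tensor_map f g) idfun) => u v.
by rewrite tensor_map_pure fE gE.
Qed.

Lemma eq_tensor_map U V U' V' (f f' : {linear U -> U'}) (g g' : {linear V -> V'}) :
  f =1 f' -> g =1 g' -> forall x, tensor_map f g x = tensor_map f' g' x.
Proof.
move=> ff gg; apply: (@tensor_extf _ _ _ (tensor_map f g) (tensor_map f' g')).
by move=> u v; rewrite !tensor_map_pure ff gg.
Qed.

Lemma tensor_mapBl U V U' V' (f f' h : {linear U -> U'}) (g : {linear V -> V'}) :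
  (forall u, h u = f u - f' u) ->
  forall x, tensor_map h g x = tensor_map f g x - tensor_map f' g x.
Proof.
move=> hE; apply: (@tensor_extf _ _ _ (tensor_map h g)
  (sub_lin (tensor_map f g) (tensor_map f' g))) => u v.
rewrite sub_linE !tensor_map_pure hE.
exact: (linearB (purel _ _)).
Qed.

Lemma tensor_mapBr U V U' V' (f : {linear U -> U'}) (g g' h : {linear V -> V'}) :
  (forall u, h u = g u - g' u) ->
  forall x, tensor_map f h x = tensor_map f g x - tensor_map f g' x.
Proof.
move=> hE; apply: (@tensor_extf _ _ _ (tensor_map f h)
  (sub_lin (tensor_map f g) (tensor_map f g'))) => u v.
rewrite sub_linE !tensor_map_pure hE.
exact: (linearB (purer _ _)).
Qed.

Lemma tensor_map0l U V U' V' (f : {linear U -> U'}) (g : {linear V -> V'}) :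
  (forall u, f u = 0) -> forall x, tensor_map f g x = 0.
Proof.
move=> f0; apply: (@tensor_extf _ _ _ (tensor_map f g) \0) => u v.
by rewrite tensor_map_pure f0 pure0l.
Qed.

Lemma tensor_map0r U V U' V' (f : {linear U -> U'}) (g : {linear V -> V'}) :
  (forall v, g v = 0) -> forall x, tensor_map f g x = 0.
Proof.
move=> g0; apply: (@tensor_extf _ _ _ (tensor_map f g) \0) => u v.
by rewrite tensor_map_pure g0 pure0r.
Qed.

Lemma tensor_map_surj U V U' V' (f : {linear U -> U'}) (g : {linear V -> V'}) :
  (forall y, exists x, f x = y) -> (forall y, exists x, g x = y) ->
  forall y, exists x, tensor_map f g x = y.
Proof.
move=> fs gs; apply: tensor_ind => [u v|x y [x' <-] [y' <-]].
  have [u' <-] := fs u; have [v' <-] := gs v.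
  by exists (pure_tensor u' v'); rewrite tensor_map_pure.
by exists (x' + y'); rewrite linearD.
Qed.

(** Right exactness as a factorization: the kernel of a tensor product of surjections is generated
    by pure tensors with one entry in a kernel. The factor is defined through arbitrary
    set-theoretic sections; another choice changes the argument of [h] only by such tensors. *)
Lemma tensor_right_exact U V U' V' W (f : {linear U -> U'}) (g : {linear V -> V'})
    (h : {linear tensor U V -> W}) :
  (forall y, exists x, f x = y) -> (forall y, exists x, g x = y) ->
  (forall u v, f u = 0 \/ g v = 0 -> h (pure_tensor u v) = 0) ->
  exists h' : {linear tensor U' V' -> W}, forall x, h' (tensor_map f g x) = h x.
Proof.
move=> fs gs h0.
pose s u' := projT1 (cid (fs u')); have sK u' : f (s u') = u' by exact: projT2 (cid (fs u')).
pose t v' := projT1 (cid (gs v')); have tK v' : g (t v') = v' by exact: projT2 (cid (gs v')).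
pose b u' v' := h (pure_tensor (s u') (t v')).
have bE u v : b (f u) (g v) = h (pure_tensor u v).
  apply/eqP; rewrite /b -subr_eq0.
  have -> : h (pure_tensor (s (f u)) (t (g v))) = h (pure_tensor u (t (g v))).
    apply/eqP; rewrite -subr_eq0 -linearB; apply/eqP.
    rewrite -[X in h X]/(purel U (t (g v)) _ - purel U (t (g v)) _) -linearB.
    by apply: h0; left; rewrite linearB sK subrr.
  rewrite -linearB; apply/eqP.
  rewrite -[X in h X]/(purer V u _ - purer V u _) -linearB.
  by apply: h0; right; rewrite linearB tK subrr.
have bl v : linear (b^~ v).
  move=> a x y; have [v' <-] := gs v; have [x' <-] := fs x; have [y' <-] := fs y.
  by rewrite -linearP !bE pure_tensorDl pure_tensorZl linearP.
have br u : linear (b u).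
  move=> a x y; have [u' <-] := fs u; have [x' <-] := gs x; have [y' <-] := gs y.
  by rewrite -linearP !bE pure_tensorDr pure_tensorZr linearP.
exists (tensor_lift bl br).
apply: (@tensor_extf _ _ _ (comp_lin (tensor_lift bl br) (tensor_map f g))) => u v.
by rewrite comp_linE tensor_map_pure tensor_liftE bE.
Qed.

(** The factorization above, applied to the projection onto the cokernel of [k] tensored with U,
    puts the kernel inside the image. *)
Lemma tensor_map_kerr U V V' V0 (g : {linear V -> V'}) (k : {linear V0 -> V}) :
  (forall y, exists x, g x = y) -> (forall v, g v = 0 -> exists w, k w = v) ->
  forall x : tensor U V, tensor_map idfun g x = 0 ->
  exists y : tensor U V0, tensor_map idfun k y = x.
Proof.
move=> gs kg x gx.
pose S := lin_im (tensor_map (idfun : {linear U -> U}) k).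
have [||h' h'E] := @tensor_right_exact _ _ _ _ _ (idfun : {linear U -> U}) g
  (quotient_proj S : {linear _ -> quotient_module S}) _ gs _.
- by move=> y; exists y.
- move=> u v [/= ->|/kg[w <-]]; apply/eqP; first by rewrite pure0l linear0.
  rewrite quotient_proj_eq0; apply/asboolP; exists (pure_tensor u w).
  by rewrite tensor_map_pure.
have : quotient_proj S x = 0 by rewrite -h'E gx linear0.
by move/eqP; rewrite quotient_proj_eq0 => /asboolP[y ->]; exists y.
Qed.

(** * Contractions of tensors and flatness of projective modules *)

Section Slices.
Variables U V : lmodType K.

Section Left.
Variable phi : {linear U -> K^o}.
Lemma slice_linearl v : linear (fun u : U => (phi u : K) *: (v : V)).
Proof. by move=> a x y; rewrite linearP scalerDl scalerA. Qed.
Lemma slice_linearr u : linear (fun v : V => (phi u : K) *: v).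
Proof. by move=> a x y; rewrite scalerDr !scalerA mulrC. Qed.
(** This is [phi] tensored with the identity, followed by K (x) V = V. When [phi] is a coordinate
    functional of a free module, it reads off a V-valued coefficient. *)
Definition slicel : {linear tensor U V -> V} :=
  tensor_lift slice_linearl slice_linearr.
Lemma slicel_pure u v : slicel (pure_tensor u v) = (phi u : K) *: v.
Proof. exact: tensor_liftE. Qed.
End Left.

Section Right.
Variable phi : {linear V -> K^o}.
Lemma slicer_linearl v : linear (fun u : U => (phi v : K) *: u).
Proof. by move=> a x y; rewrite scalerDr !scalerA mulrC. Qed.
Lemma slicer_linearr u : linear (fun v : V => (phi v : K) *: (u : U)).
Proof. by move=> a x y; rewrite linearP scalerDl scalerA. Qed.
Definition slicer : {linear tensor U V -> U} :=
  tensor_lift slicer_linearl slicer_linearr.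
Lemma slicer_pure u v : slicer (pure_tensor u v) = (phi v : K) *: u.
Proof. exact: tensor_liftE. Qed.
End Right.
End Slices.

Lemma slicel_map U V U' V' (phi : {linear U' -> K^o}) (f : {linear U -> U'})
    (g : {linear V -> V'}) (x : tensor U V) :
  slicel V' phi (tensor_map f g x) = g (slicel V (comp_lin phi f) x).
Proof.
move: x; apply: (@tensor_extf _ _ _ (comp_lin (slicel V' phi) (tensor_map f g))
  (comp_lin g (slicel V (comp_lin phi f)))) => u v.
by rewrite !comp_linE tensor_map_pure !slicel_pure linearZ.
Qed.

Lemma slicer_map U V U' V' (phi : {linear V' -> K^o}) (f : {linear U -> U'})
    (g : {linear V -> V'}) (x : tensor U V) :
  slicer U' phi (tensor_map f g x) = f (slicer U (comp_lin phi g) x).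
Proof.
move: x; apply: (@tensor_extf _ _ _ (comp_lin (slicer U' phi) (tensor_map f g))
  (comp_lin f (slicer U (comp_lin phi g)))) => u v.
by rewrite !comp_linE tensor_map_pure !slicer_pure linearZ.
Qed.

Lemma slice_comm U V (phi : {linear U -> K^o}) (psi : {linear V -> K^o})
    (x : tensor U V) : psi (slicel V phi x) = phi (slicer U psi x).
Proof.
move: x; apply: (@tensor_extf _ _ _ (comp_lin psi (slicel V phi))
  (comp_lin phi (slicer U psi))) => u v.
rewrite !comp_linE slicel_pure slicer_pure [LHS]linearZ_LR [RHS]linearZ_LR.
exact: mulrC.
Qed.

Lemma tensor_expandl (A : choiceType) V (x : tensor {freeg A / K} V) :
  exists2 s : seq A, uniq s &
  x = \sum_(a <- s) pure_tensor << a >> (slicel V (coeff_lin a) x).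
Proof.
(* Allowing all larger supports lets two expansions be added over the union of their supports. *)
suff [s us sP] : exists2 s : seq A, uniq s & forall s', uniq s' -> {subset s <= s'} ->
    x = \sum_(a <- s') pure_tensor << a >> (slicel V (coeff_lin a) x).
  by exists s => //; apply: sP.
move: x; apply: tensor_ind => [D v|x y [s us Es] [t ut Et]]; last first.
  exists (undup (s ++ t)); first exact: undup_uniq.
  move=> s' us' ss'; under eq_bigr do rewrite linearD pure_tensorDr.
  rewrite big_split /= -Es // -?Et // => a ha; apply: ss';
    by rewrite mem_undup mem_cat ha ?orbT.
exists (dom D); first exact: uniq_dom.
move=> s' us' ss'; rewrite {1}(freeg_expand us' ss').
rewrite -[LHS]/(purel _ v _) linear_sum; apply: eq_bigr => a _.
by rewrite linearZ slicel_pure pure_tensorZr.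
Qed.

Lemma tensor_expandr (A : choiceType) U (x : tensor U {freeg A / K}) :
  exists2 s : seq A, uniq s &
  x = \sum_(a <- s) pure_tensor (slicer U (coeff_lin a) x) << a >>.
Proof.
suff [s us sP] : exists2 s : seq A, uniq s & forall s', uniq s' -> {subset s <= s'} ->
    x = \sum_(a <- s') pure_tensor (slicer U (coeff_lin a) x) << a >>.
  by exists s => //; apply: sP.
move: x; apply: tensor_ind => [u D|x y [s us Es] [t ut Et]]; last first.
  exists (undup (s ++ t)); first exact: undup_uniq.
  move=> s' us' ss'; under eq_bigr do rewrite linearD pure_tensorDl.
  rewrite big_split /= -Es // -?Et // => a ha; apply: ss';
    by rewrite mem_undup mem_cat ha ?orbT.
exists (dom D); first exact: uniq_dom.
move=> s' us' ss'; rewrite {1}(freeg_expand us' ss').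
rewrite -[LHS]/(purer _ u _) linear_sum; apply: eq_bigr => a _.
by rewrite linearZ slicer_pure pure_tensorZl.
Qed.

(** Projectivity as being a retract of a free module: lifting along surjections and flatness both
    reduce to coordinates. *)
Definition projective V : Prop :=
  exists (A : choiceType) (i : {linear V -> {freeg A / K}})
         (p : {linear {freeg A / K} -> V}), cancel i p.

Lemma projective_free (A : choiceType) : projective {freeg A / K}.
Proof. by exists A, idfun, idfun. Qed.

Lemma projective_lift V U W (f : {linear V -> W}) (g : {linear U -> W}) :
  projective V -> (forall v, exists u, g u = f v) ->
  exists h : {linear V -> U}, forall v, g (h v) = f v.
Proof.
case=> A [i [p ip]] gf.
pose s (a : A) := projT1 (cid (gf (p << a >>))).
have sP a : g (s a) = f (p << a >>) by exact: projT2 (cid (gf (p << a >>))).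
exists (comp_lin (free_lift s) i) => v; rewrite comp_linE -[in RHS](ip v).
apply: (@free_ext _ _ _ (comp_lin g (free_lift s)) (comp_lin f p)) => a.
by rewrite !comp_linE free_liftU sP.
Qed.

(** Flatness of projectives. The retraction makes U (x) V a summand of a tensor product with a free
    module; a tensor there is zero once its V-valued coefficients are, and [g] acts on these
    coefficients one at a time. *)
Lemma tensor_map_injr U V V' (g : {linear V -> V'}) :
  projective U -> injective g -> injective (tensor_map (idfun : {linear U -> U}) g).
Proof.
move=> [A [i [p ip]]] gI; apply: inj_linP => x gx.
have xE : tensor_map p idfun (tensor_map i (idfun : {linear V -> V}) x) = x.
  rewrite (@tensor_map_comp _ _ _ _ _ _ i idfun p idfun idfun idfun) //.
  by apply: tensor_map_id.
rewrite -xE; suff -> : tensor_map i (idfun : {linear V -> V}) x = 0 by rewrite linear0.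
have [s _ ->] := tensor_expandl (tensor_map i idfun x).
rewrite big1 // => a _; rewrite slicel_map.
suff -> : slicel V (comp_lin (coeff_lin a) i) x = 0 by rewrite linear0 pure0r.
apply: (inj_lin0 gI).
transitivity (slicel V' (comp_lin (coeff_lin a) i) (tensor_map idfun g x)).
  by rewrite slicel_map.
by rewrite gx linear0.
Qed.

Lemma tensor_map_injl U U' V (f : {linear U -> U'}) :
  projective V -> injective f -> injective (tensor_map f (idfun : {linear V -> V})).
Proof.
move=> [A [i [p ip]]] fI; apply: inj_linP => x fx.
have xE : tensor_map idfun p (tensor_map (idfun : {linear U -> U}) i x) = x.
  rewrite (@tensor_map_comp _ _ _ _ _ _ idfun i idfun p idfun idfun) //.
  by apply: tensor_map_id.
rewrite -xE; suff -> : tensor_map (idfun : {linear U -> U}) i x = 0 by rewrite linear0.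
have [s _ ->] := tensor_expandr (tensor_map idfun i x).
rewrite big1 // => a _; rewrite slicer_map.
suff -> : slicer U (comp_lin (coeff_lin a) i) x = 0 by rewrite linear0 pure0l.
apply: (inj_lin0 fI).
transitivity (slicer U' (comp_lin (coeff_lin a) i) (tensor_map f idfun x)).
  by rewrite slicer_map.
by rewrite fx linear0.
Qed.

(** Taking coefficients over B commutes with the tests [phi], so these coefficients lie in S and x
    comes from S tensored with the free module on B. Expanding over a free module of which S is a
    retract then gives coefficients that the tests [psi] put into T; injectivity of the inclusion of
    S carries the vanishing of the slices from x to its preimage. *)
Lemma tensor_submodule (A B : choiceType) (I J : Type)
    (S : submodClosed {freeg A / K}) (T : submodClosed {freeg B / K})
    (phi : I -> {linear {freeg A / K} -> K^o})
    (psi : J -> {linear {freeg B / K} -> K^o}) :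
  projective (submodule S) ->
  (forall x, (forall i, phi i x = 0) -> x \in S) ->
  (forall x, (forall j, psi j x = 0) -> x \in T) ->
  forall x : tensor {freeg A / K} {freeg B / K},
  (forall i, slicel _ (phi i) x = 0) -> (forall j, slicer _ (psi j) x = 0) ->
  exists y, x = tensor_map (incl S) (incl T) y.
Proof.
move=> [C [i [p ip]]] phiS psiT x x1 x2.
have [v xv] : exists v, x = tensor_map (incl S) (idfun : {linear {freeg B / K} -> _}) v.
  have [s _ xE] := tensor_expandr x.
  have uS b : slicer _ (coeff_lin b) x \in S.
    by apply: phiS => k; rewrite -slice_comm x1 linear0.
  exists (\sum_(b <- s) pure_tensor (Submodule (uS b)) << b >>).
  by rewrite linear_sum {1}xE; apply: eq_bigr => b _; rewrite tensor_map_pure.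
have vE : tensor_map p idfun (tensor_map i (idfun : {linear {freeg B / K} -> _}) v) = v.
  rewrite (@tensor_map_comp _ _ _ _ _ _ i idfun p idfun idfun idfun) //.
  by apply: tensor_map_id.
have [s _ E] := tensor_expandl (tensor_map i idfun v).
have vT c : slicel _ (coeff_lin c) (tensor_map i (idfun : {linear {freeg B / K} -> _}) v) \in T.
  apply: psiT => j.
  transitivity (psi j (slicel _ (comp_lin (coeff_lin c) i) v)).
    by rewrite slicel_map.
  rewrite slice_comm comp_linE.
  suff -> : slicer _ (psi j) v = 0 by rewrite !linear0.
  apply: (inj_lin0 (@incl_inj _ S)).
  by have := x2 j; rewrite xv slicer_map.
exists (\sum_(c <- s) pure_tensor (p << c >>) (Submodule (vT c))).
rewrite [RHS]linear_sum xv -[in LHS]vE [in LHS]E !linear_sum; apply: eq_bigr => c _.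
by rewrite !tensor_map_pure.
Qed.

End LinearAlgebra.

(** * Submodules of free modules over a principal ideal domain *)

Section WellOrder.
Variables (T : eqType) (R : rel T).
Hypothesis Rwo : well_order R.

Lemma well_order_min (P : T -> Prop) : (exists x, P x) ->
  exists2 x, P x & forall y, P y -> R x y.
Proof.
move=> [x Px].
have [|z [[/asboolP Pz minz] _]] := Rwo (A := fun x => `[< P x >]).
  by exists x; apply/asboolP.
by exists z => // y Py; apply: minz; apply/asboolP.
Qed.

(** A well-order is given by unique minima of nonempty sets; the order laws follow by applying this
    to sets of at most three elements. *)
Lemma well_order_total x y : R x y \/ R y x.
Proof.
have [|z zP minz] := well_order_min (P := fun z => z = x \/ z = y).
  by exists x; left.
by case: zP => <-; [left|right]; apply: minz; [right|left].
Qed.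

Lemma well_order_refl x : R x x.
Proof. by case: (well_order_total x x). Qed.

Lemma well_order_anti x y : R x y -> R y x -> x = y.
Proof.
move=> xy yx; have [|z [_ U]] := Rwo (A := mem [:: x; y]).
  by exists x; apply: mem_head.
have zx : z = x.
  by apply: U; split=> [|w]; rewrite !inE ?eqxx // => /orP[]/eqP-> //; apply: well_order_refl.
have zy : z = y.
  by apply: U; split=> [|w]; rewrite !inE ?eqxx ?orbT // => /orP[]/eqP-> //; apply: well_order_refl.
by rewrite -zx.
Qed.

Lemma well_order_trans x y z : R x y -> R y z -> R x z.
Proof.
move=> xy yz.
have [|m mP minm] := well_order_min (P := fun w => [\/ w = x, w = y | w = z]).
  by exists x; apply: Or31.
have mx := minm x (Or31 _ _ erefl); have my := minm y (Or32 _ _ erefl).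
have mz := minm z (Or33 _ _ erefl).
case: mP => E; rewrite {}E in mx my mz => //.
  by rewrite (well_order_anti xy mx).
by rewrite -(well_order_anti yz my).
Qed.

Lemma well_order_ind (P : T -> Prop) :
  (forall x, (forall y, R y x -> y <> x -> P y) -> P x) -> forall x, P x.
Proof.
move=> IH x; apply: contrapT => nPx.
have [|m nPm minm] := well_order_min (P := fun x => ~ P x); first by exists x.
apply/nPm/IH => y ym neq; apply: contrapT => /minm my.
exact/neq/well_order_anti.
Qed.

Lemma well_order_max (s : seq T) : s != [::] ->
  exists2 m, m \in s & forall x, x \in s -> R x m.
Proof.
elim: s => [//|x [|y s] IH] _.
  by exists x; rewrite ?inE // => y; rewrite inE => /eqP->; apply: well_order_refl.
have [//|m ms mP] := IH.
have [xm|mx] := well_order_total x m.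
  exists m; first by rewrite inE ms orbT.
  by move=> z; rewrite inE => /orP[/eqP->//|/mP].
exists x; first exact: mem_head.
move=> z; rewrite inE => /orP[/eqP->|/mP zm]; first exact: well_order_refl.
exact: well_order_trans zm mx.
Qed.

End WellOrder.

Lemma projective_bij (K : comNzRingType) (A : choiceType) (V : lmodType K)
    (f : {linear {freeg A / K} -> V}) :
  injective f -> (forall y, exists x, f x = y) -> projective V.
Proof.
move=> fI fs; pose g y := projT1 (cid (fs y)).
have gK : cancel g f by move=> y; apply: projT2 (cid (fs y)).
have fK : cancel f g by move=> x; apply: fI; rewrite gK.
by exists A, (inv_lin fK gK), f => y; rewrite inv_linE gK.
Qed.

Lemma projective_iso (K : comNzRingType) (U V : lmodType K) (f : {linear U -> V}) :
  projective U -> bijective f -> projective V.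
Proof.
move=> [A [i [p ip]]] [g fK gK].
exists A, (comp_lin i (inv_lin fK gK)), (comp_lin f p) => v.
by rewrite !comp_linE ip inv_linE gK.
Qed.

Section FreeSubmodules.
Variables (K : idomainType) (A : choiceType) (S : submodClosed {freeg A / K}).
Hypothesis K_pid : principal_ideal_domain K.
Variable R : rel A.
Hypothesis Rwo : well_order R.

Definition supp_le (a : A) (x : {freeg A / K}) : Prop :=
  forall b, coeff b x != 0 -> R b a.

Lemma supp_le_max (x : {freeg A / K}) : x != 0 ->
  exists2 a, coeff a x != 0 & supp_le a x.
Proof.
rewrite -dom_eq0 => /(well_order_max Rwo)[a ax amax].
by exists a; rewrite -?mem_dom // => b; rewrite -mem_dom => /amax.
Qed.

Lemma supp_le_comb a c (x y : {freeg A / K}) :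
  supp_le a x -> supp_le a y -> supp_le a (x + c *: y).
Proof.
move=> xa ya b; rewrite coeffD coeffZ => nz.
have [bx|] := boolP (coeff b x == 0); last exact: xa.
apply: ya; apply: contraNneq nz => ->; by rewrite (eqP bx) mulr0 addr0.
Qed.

(** The coefficients at [a] of the elements of S supported at or below [a] form an ideal, and [n]
    realizes a generator of it. *)
Lemma leading_exists (a : A) : exists n : {freeg A / K},
  [/\ n \in S, supp_le a n & forall x, x \in S -> supp_le a x ->
      exists b, coeff a x = b * coeff a n].
Proof.
pose I : set K := fun c => exists x, [/\ x \in S, supp_le a x & c = coeff a x].
have I0 : I 0.
  exists 0; split; rewrite ?rpred0 ?coeff0 // => b; by rewrite coeff0 eqxx.
have ID x y : I x -> I y -> I (x + y).
  move=> [u [uS ua ->]] [v [vS va ->]]; exists (u + 1 *: v).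
  split; [by rewrite scale1r rpredD | exact: supp_le_comb | by rewrite scale1r coeffD].
have IZ b x : I x -> I (b * x).
  move=> [u [uS ua ->]]; exists (0 + b *: u); split.
  - by rewrite add0r rpredZ.
  - by apply: supp_le_comb => // c; rewrite coeff0 eqxx.
  - by rewrite add0r coeffZ.
have [d dP] := K_pid I0 ID IZ.
have [n [nS na dE]] : I d by apply/dP; exists 1; rewrite mul1r.
exists n; split => // x xS xa.
have /dP[b ->] : I (coeff a x) by exists x.
by exists b; rewrite dE.
Qed.

Definition leading (a : A) : {freeg A / K} := projT1 (cid (leading_exists a)).

Lemma leadingP a : [/\ leading a \in S, supp_le a (leading a) &
  forall x, x \in S -> supp_le a x -> exists b, coeff a x = b * coeff a (leading a)].
Proof. exact: projT2 (cid (leading_exists a)). Qed.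

(** Where the ideal of leading coefficients is zero, no basis vector is contributed. *)
Definition leading_index : choiceType := {a : A | coeff a (leading a) != 0}.

Lemma leading_mem a : leading a \in S. Proof. by case: (leadingP a). Qed.

Definition leading_basis : {linear {freeg leading_index / K} -> submodule S} :=
  free_lift (fun a : leading_index => Submodule (leading_mem (val a))).

(** Triangularity: at the largest index occurring in D, the other [leading] elements involved have
    coefficient 0, since each is supported at or below its own smaller index. *)
Lemma leading_basis_inj : injective leading_basis.
Proof.
apply: inj_linP => D D0; apply/eqP; apply: contraT => Dn0.
have Rwo' : well_order (relpre val R : rel leading_index).
  apply: antisymmetric_well_order => [x y /andP[xy yx]|B [x Bx]].
    exact/val_inj/(well_order_anti Rwo).
  have [|_ [b Bb <-] bmin] := well_order_min Rwo (P := fun a => exists2 b, b \in B & val b = a).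
    by exists (val x), x.
  by exists b; split => // y By; apply: bmin; exists y.
have [|a aD amax] := well_order_max Rwo' (s := dom D); first by rewrite dom_eq0.
have : coeff (val a) (val (leading_basis D)) = 0 by rewrite D0 coeff0.
rewrite (freeg_expand (uniq_dom D) (fun _ h => h)) linear_sum.
rewrite -[X in coeff _ X = _]/(incl S _) linear_sum raddf_sum /=.
have E b : coeff (val a) (incl S (leading_basis (coeff b D *: << b >>))) =
           coeff b D * coeff (val a) (leading (val b)).
  by rewrite !linearZ coeffZ; congr (_ * coeff _ _); rewrite free_liftU.
under eq_bigr do rewrite E.
rewrite (bigD1_seq a) ?uniq_dom //= big_seq_cond big1 => [|b /andP[bD ba]].
  move/eqP; rewrite addr0 mulf_eq0 (negbTE (valP a)) orbF => /eqP aD0.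
  by move: aD; rewrite mem_dom aD0 eqxx.
have [_ lb _] := leadingP (val b).
have [->|/lb Rab] := eqVneq (coeff (val a) (leading (val b))) 0; first by rewrite mulr0.
case/eqP: ba; apply: val_inj; apply: (well_order_anti Rwo) => //.
exact: amax.
Qed.

Lemma leading_basis_surj (y : submodule S) : exists x, leading_basis x = y.
Proof.
have [/val_inj->|] := eqVneq (val y) (val (0 : submodule S)).
  by exists 0; rewrite linear0.
move=> /supp_le_max[a _]; elim/(well_order_ind Rwo): a y => a IH y ya.
(* One division step: z has no coefficient at [a], so its largest index is strictly smaller and the
   induction hypothesis applies to it. *)
suff [z az [x xE]] : exists2 z : submodule S,
    supp_le a (val z) /\ coeff a (val z) = 0 & exists x, leading_basis x = y - z.
  case: az => az az0.
  have [/val_inj z0|/supp_le_max[b bz zb]] := eqVneq (val z) (val (0 : submodule S)).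
    by exists x; rewrite xE z0 subr0.
  have [|||w wE] := IH b _ _ z => //; first exact: az.
    by move=> ba; move: bz; rewrite ba az0 eqxx.
  by exists (x + w); rewrite linearD xE wE subrK.
have [lS la lP] := leadingP a.
have [c cE] := lP _ (valP y) ya.
have [l0|ln0] := eqVneq (coeff a (leading a)) 0.
  exists y; last by exists 0; rewrite linear0 subrr.
  by split => //; rewrite cE l0 mulr0.
exists (y + (- c) *: Submodule (leading_mem a)).
  split; first exact: supp_le_comb.
  by rewrite [val _]linearD linearZ /= coeffD coeffZ cE mulNr subrr.
exists (c *: << (exist _ a ln0 : leading_index) >>).
rewrite linearZ scaleNr opprB addrC subrK; congr (_ *: _).
by rewrite free_liftU; apply: val_inj.
Qed.

End FreeSubmodules.

(** Unlike [projective], this passes to submodules over any ring; over a principal ideal domain it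
    implies [projective]. *)
Definition free_embedded (K : comNzRingType) (V : lmodType K) : Prop :=
  exists (A : choiceType) (i : {linear V -> {freeg A / K}}), injective i.

Lemma submodule_projective (K : idomainType) (K_pid : principal_ideal_domain K)
    (A : choiceType) (S : submodClosed {freeg A / K}) : projective (submodule S).
Proof.
have [R Rwo] := well_ordering_principle A.
have bI := @leading_basis_inj _ _ S K_pid _ Rwo.
have bs := @leading_basis_surj _ _ S K_pid _ Rwo.
exact: projective_bij bI bs.
Qed.

Lemma free_embedded_projective (K : idomainType) (K_pid : principal_ideal_domain K)
  (V : lmodType K) : free_embedded V -> projective V.
Proof.
move=> [A [i iI]].
have iS v : i v \in lin_im i by apply/asboolP; exists v.
have fb : bijective (corestr iS).
  pose g (y : submodule (lin_im i)) := projT1 (cid (asboolP _ (valP y))).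
  have gP y : val y = i (g y) by exact: projT2 (cid (asboolP _ (valP y))).
  exists g => [v|y]; first by apply: iI; rewrite -gP.
  by apply: val_inj; rewrite /= -gP.
have [g fK gK] := fb.
apply: (projective_iso (f := inv_lin fK gK)); first exact: submodule_projective.
by exists (corestr iS).
Qed.

Lemma free_embedded_sub (K : comNzRingType) (V W : lmodType K)
    (f : {linear V -> W}) : injective f -> free_embedded W -> free_embedded V.
Proof.
move=> fI [A [i iI]]; exists A, (comp_lin i f) => x y /iI; exact: fI.
Qed.

(** * Tor and graded modules *)

Section Factor.
Variables (K : comNzRingType) (U V W : lmodType K).
Variables (q : {linear U -> V}) (f : {linear U -> W}).
Hypotheses (qs : forall y, exists x, q x = y) (qf : forall x, q x = 0 -> f x = 0).

Definition surj_factor_fun (y : V) : W := f (projT1 (cid (qs y))).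

Lemma surj_factor_funE x : surj_factor_fun (q x) = f x.
Proof.
apply/eqP; rewrite -subr_eq0 -linearB qf // linearB.
by rewrite (projT2 (cid (qs (q x)))) subrr.
Qed.

Lemma surj_factor_linear : linear surj_factor_fun.
Proof.
move=> a x y; have [[u <-] [v <-]] := (qs x, qs y).
by rewrite -linearP !surj_factor_funE linearP.
Qed.

Definition surj_factor : {linear V -> W} := mk_linear surj_factor_linear.

Lemma surj_factorE x : surj_factor (q x) = f x.
Proof. exact: surj_factor_funE. Qed.
End Factor.

Section ResolutionLift.
Variables (K : comNzRingType) (A N P1 P0 : lmodType K) (iota : {linear P1 -> P0}).
Variables (lam : {linear P1 -> {freeg (submodule (lin_ker (resolution_aug A))) / K}}).
Variables (s : {linear P0 -> {freeg A / K}}).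
Hypotheses (P1p : projective P1) (P0p : projective P0).
Hypothesis lams : forall x, resolution_d1 A (lam x) = s (iota x).
Hypothesis augs : forall x, resolution_aug A (s x) = 0.

(* (lam, s) lifts the zero map to the canonical resolution, hence is null-homotopic. *)
Lemma resolution_lift0 (w : tensor P1 N) :
  tensor_map iota (idfun : {linear N -> N}) w = 0 ->
  tensor_map lam (idfun : {linear N -> N}) w
    \in lin_im (tensor_map (resolution_d2 A) (idfun : {linear N -> N})).
Proof.
move=> w0.
have [h0 h0P] : exists h0 : {linear P0 -> _}, forall x, resolution_d1 A (h0 x) = s x.
  apply: projective_lift => // x.
  have xk : s x \in lin_ker (resolution_aug A) by rewrite unfold_in augs.
  by exists << Submodule xk >>; apply: free_liftU.
pose mu := sub_lin lam (comp_lin h0 iota).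
have [h1 h1P] : exists h1 : {linear P1 -> _}, forall x, resolution_d2 A (h1 x) = mu x.
  apply: projective_lift => // x.
  have xk : mu x \in lin_ker (resolution_d1 A).
    by rewrite unfold_in /mu sub_linE linearB lams comp_linE h0P subrr.
  by exists << Submodule xk >>; apply: free_liftU.
apply/asboolP; exists (tensor_map h1 idfun w).
rewrite (@tensor_map_comp _ _ _ _ _ _ _ h1 idfun (resolution_d2 A) idfun mu idfun) //.
rewrite (@tensor_mapBl _ _ _ _ _ lam (comp_lin h0 iota) mu) //.
rewrite -(@tensor_map_comp _ _ _ _ _ _ _ iota idfun h0 idfun (comp_lin h0 iota) idfun) //.
by rewrite w0 linear0 subr0.
Qed.

End ResolutionLift.

Section TorClasses.
Variable K : comNzRingType.
Local Notation id_ B := (idfun : {linear B -> B}).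

Definition Tor_cycles (A B : lmodType K) : lmodType K :=
  submodule (lin_ker (tensor_map (resolution_d1 A) (id_ B))).

Definition Tor_incl (A B : lmodType K) : {linear Tor_cycles A B -> tensor _ B} :=
  incl (lin_ker (tensor_map (resolution_d1 A) (id_ B))).

Lemma Tor_incl_ker (A B : lmodType K) (u : Tor_cycles A B) :
  Tor_incl A B u \in lin_ker (tensor_map (resolution_d1 A) (id_ B)).
Proof. exact: (valP u). Qed.

Definition Tor_cycles_map (A A' B B' : lmodType K) (a : {linear A -> A'})
    (b : {linear B -> B'}) : {linear Tor_cycles A B -> Tor_cycles A' B'} :=
  submodule_map (Tor1_map_ker a b).

(** All that is needed of the construction of [Tor1]: cycles surject onto it, the kernel of that
    surjection, and the action of induced maps on classes. *)
Record Tor_presentation := TorPresentation {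
  Tor_class (A B : lmodType K) : {linear Tor_cycles A B -> Tor1 A B};
  Tor_class_surj (A B : lmodType K) t : exists u, Tor_class A B u = t;
  Tor_class_eq0 (A B : lmodType K) u : (Tor_class A B u == 0) =
    (Tor_incl A B u \in lin_im (tensor_map (resolution_d2 A) (id_ B)));
  Tor_class_map (A A' B B' : lmodType K) (a : {linear A -> A'}) (b : {linear B -> B'}) u :
    Tor1_map a b (Tor_class A B u) = Tor_class A' B' (Tor_cycles_map a b u)
}.

(* Kept opaque: unification would otherwise unfold Tor1 down to its nested quotients. *)
Lemma Tor1_presentation : Tor_presentation.
Proof.
exists (fun A B => (quotient_proj _ : {linear _ -> quotient_module _})).
- by move=> A B t; exists (repr t); apply: quotient_repr.
- by move=> A B u; apply: quotient_proj_eq0.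
- move=> A A' B B' a b u; apply: quotient_fun_proj => x.
  exact: Tor1_map_im.
Qed.

Definition Tor_cls (A B : lmodType K) := Tor_class Tor1_presentation A B.

Lemma Tor_cls_surj (A B : lmodType K) (t : Tor1 A B) : exists u, Tor_cls A B u = t.
Proof. exact: Tor_class_surj. Qed.

Lemma Tor_cls_eq0 (A B : lmodType K) u :
  (Tor_cls A B u == 0) = (Tor_incl A B u \in lin_im (tensor_map (resolution_d2 A) (id_ B))).
Proof. exact: Tor_class_eq0. Qed.

Lemma Tor1_map_cls (A A' B B' : lmodType K) (a : {linear A -> A'})
    (b : {linear B -> B'}) u :
  Tor1_map a b (Tor_cls A B u) = Tor_cls A' B' (Tor_cycles_map a b u).
Proof. exact: Tor_class_map. Qed.

End TorClasses.

Section BidegreeComponents.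
Variables (K : comNzRingType) (k n : nat) (F : nat -> nat -> lmodType K).
Local Notation DS := (direct_sum (fun p : bidegree k n => F (val p).1 (val p).2)).

(** Extension by 0 to all pairs (i, j), so that formulas for components can be stated and rewritten
    without carrying a proof that the degrees add up. *)
Definition dcomp (u : DS) i j : F i j :=
  match @idP (k + i + j == n)%N with
  | ReflectT e => u (exist _ (i, j) e)
  | ReflectF _ => 0
  end.

Definition of_dcomp (f : forall i j, F i j) : DS := fun p => f (val p).1 (val p).2.

Lemma dcomp_of f i j : (k + i + j = n)%N -> dcomp (of_dcomp f) i j = f i j.
Proof. by move=> ij; rewrite /dcomp; case: {-}_ / idP => //; rewrite ij eqxx. Qed.

Lemma dcomp_out u i j : (k + i + j != n)%N -> dcomp u i j = 0.
Proof. by rewrite /dcomp; case: {-}_ / idP => // e; rewrite e. Qed.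

Lemma dcomp_linear i j : linear (fun u => dcomp u i j).
Proof.
by move=> a u v; rewrite /dcomp; case: {-}_ / idP => // _; rewrite scaler0 addr0.
Qed.

Definition dcomp_lm i j : {linear DS -> F i j} := mk_linear (dcomp_linear i j).

Lemma dcompE u (p : bidegree k n) : dcomp u (val p).1 (val p).2 = u p.
Proof.
rewrite /dcomp; case: p => -[i j] e /=; case: {-}_ / idP => [e'|//].
by rewrite (bool_irrelevance e' e).
Qed.

Lemma dcomp_ext (u v : DS) :
  (forall i j, (k + i + j = n)%N -> dcomp u i j = dcomp v i j) -> u = v.
Proof.
move=> uv; apply: functional_extensionality_dep => p; rewrite -!dcompE uv //.
exact/eqP/(valP p).
Qed.

End BidegreeComponents.

Lemma dcomp_map (K : comNzRingType) k n (F F' : nat -> nat -> lmodType K)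
    (f : forall i j, {linear F i j -> F' i j}) u i j :
  dcomp (direct_sum_map (fun p : bidegree k n => f (val p).1 (val p).2) u) i j =
  f i j (@dcomp K k n F u i j).
Proof. by rewrite /dcomp; case: {-}_ / idP => [//|_]; rewrite linear0. Qed.

Section TensorComponents.
Variables (K : comNzRingType) (A B : nat -> lmodType K) (n : nat).

Definition comp (u : graded_tensor A B n) i j : tensor (A i) (B j) :=
  @dcomp K 0 n (fun i j => tensor (A i) (B j)) u i j.

Lemma comp_out (u : graded_tensor A B n) i j : (i + j != n)%N -> comp u i j = 0.
Proof. exact: (@dcomp_out K 0 n (fun i j => tensor (A i) (B j))). Qed.

Definition comp_lm i j : {linear graded_tensor A B n -> tensor (A i) (B j)} :=
  @dcomp_lm K 0 n (fun i j => tensor (A i) (B j)) i j.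

Lemma comp0 i j : comp (0 : graded_tensor A B n) i j = 0.
Proof. exact: (linear0 (comp_lm i j)). Qed.

Definition of_comp (f : forall i j, tensor (A i) (B j)) : graded_tensor A B n :=
  @of_dcomp K 0 n (fun i j => tensor (A i) (B j)) f.

Lemma comp_of f i j : (i + j = n)%N -> comp (of_comp f) i j = f i j.
Proof. exact: (@dcomp_of K 0 n (fun i j => tensor (A i) (B j))). Qed.

Lemma comp_ext (u v : graded_tensor A B n) :
  (forall i j, (i + j = n)%N -> comp u i j = comp v i j) -> u = v.
Proof. exact: (@dcomp_ext K 0 n (fun i j => tensor (A i) (B j))). Qed.

End TensorComponents.

Lemma comp_map (K : comNzRingType) (A B A' B' : nat -> lmodType K) n
    (f : forall i, {linear A i -> A' i}) (g : forall i, {linear B i -> B' i})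
    (u : graded_tensor A B n) i j :
  comp (graded_tensor_map f g n u) i j = tensor_map (f i) (g j) (comp u i j).
Proof. exact: (@dcomp_map K 0 n _ _ (fun i j => tensor_map (f i) (g j))). Qed.

Section TorComponents.
Variables (K : comNzRingType) (A B : nat -> lmodType K) (n : nat).

Definition tcomp (u : graded_Tor1 A B n) i j : Tor1 (A i) (B j) :=
  @dcomp K 1 n (fun i j => Tor1 (A i) (B j)) u i j.

Lemma tcomp0 i j : tcomp (0 : graded_Tor1 A B n) i j = 0.
Proof. exact: (linear0 (@dcomp_lm K 1 n (fun i j => Tor1 (A i) (B j)) i j)). Qed.

Lemma tcomp_ext (u v : graded_Tor1 A B n) :
  (forall i j, (i.+1 + j = n)%N -> tcomp u i j = tcomp v i j) -> u = v.
Proof. exact: (@dcomp_ext K 1 n (fun i j => Tor1 (A i) (B j))). Qed.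

Variables (V : lmodType K) (f : forall i j, {linear V -> Tor1 (A i) (B j)}).

Definition of_tcomp (x : V) : graded_Tor1 A B n :=
  @of_dcomp K 1 n (fun i j => Tor1 (A i) (B j)) (fun i j => f i j x).

Lemma of_tcomp_linear : linear of_tcomp.
Proof.
by move=> a x y; apply: functional_extensionality_dep => p; apply: linearP.
Qed.

Definition of_tcomp_lin : {linear V -> graded_Tor1 A B n} := mk_linear of_tcomp_linear.

Lemma tcomp_of x i j : (i.+1 + j = n)%N -> tcomp (of_tcomp_lin x) i j = f i j x.
Proof. by move=> ij; apply: (@dcomp_of K 1 n (fun i j => Tor1 (A i) (B j))). Qed.

End TorComponents.

Lemma tcomp_map (K : comNzRingType) (A B A' B' : nat -> lmodType K) n
    (f : forall i, {linear A i -> A' i}) (g : forall i, {linear B i -> B' i})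
    (u : graded_Tor1 A B n) i j :
  tcomp (graded_Tor1_map f g n u) i j = Tor1_map (f i) (g j) (tcomp u i j).
Proof. exact: (@dcomp_map K 1 n _ _ (fun i j => Tor1_map (f i) (g j))). Qed.

(** * The Kuenneth theorem *)

Section FreeComplex.
Variables (K : idomainType) (K_pid : principal_ideal_domain K).
Variables (C : chain_complex K) (HC : forall n, free_embedded (C n)).

Definition cycles n : lmodType K := submodule (@chain_cycle K C n).
Definition boundaries n : lmodType K := submodule (lin_im (chain_diff C n)).

Lemma chain_diff_im n x : chain_diff C n x \in lin_im (chain_diff C n).
Proof. by apply/asboolP; exists x. Qed.

Definition bd n : {linear C n.+1 -> boundaries n} := corestr (@chain_diff_im n).
Definition incZ n : {linear cycles n -> C n} := incl _.

Lemma boundaries_cycle n (b : boundaries n) : incl _ b \in @chain_cycle K C n.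
Proof. exact/boundary_cycle/valP. Qed.

Definition incB n : {linear boundaries n -> cycles n} := corestr (@boundaries_cycle n).

Definition hcls n : {linear cycles n -> homology C n} :=
  (quotient_proj _ : {linear _ -> quotient_module _}).

Lemma hcls_surj n (h : homology C n) : exists z, hcls n z = h.
Proof. by exists (repr h); apply: quotient_repr. Qed.

Lemma hcls_eq0 n (z : cycles n) : hcls n z = 0 <-> exists b, incB n b = z.
Proof.
have E : (hcls n z == 0) = (val z \in lin_im (chain_diff C n)).
  exact: quotient_proj_eq0.
split=> [/eqP|[b bz]]; last by apply/eqP; rewrite E -bz; exact: (valP b).
by rewrite E => zB; exists (Submodule zB); apply: val_inj.
Qed.

Lemma bd_surj n (b : boundaries n) : exists x, bd n x = b.
Proof. by have /asboolP[x xE] := valP b; exists x; apply: val_inj. Qed.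

Lemma val_incB_bd n x : incZ n (incB n (bd n x)) = chain_diff C n x.
Proof. by []. Qed.

Lemma bd_cycle n (z : cycles n.+1) : bd n (incZ n.+1 z) = 0.
Proof. by apply: val_inj; have /eqP : chain_diff C n (val z) == 0 := valP z. Qed.

Lemma bd_diff n x : bd n (chain_diff C n.+1 x) = 0.
Proof. by apply: val_inj; apply: chain_diffK. Qed.

Lemma diff_cycle n (z : cycles n.+1) : chain_diff C n (incZ n.+1 z) = 0.
Proof. by rewrite -val_incB_bd bd_cycle !linear0. Qed.

Lemma incZ_inj n : injective (incZ n). Proof. exact: val_inj. Qed.

Lemma chain_projective n : projective (C n).
Proof. exact: free_embedded_projective. Qed.
Lemma cycles_projective n : projective (cycles n).
Proof. by apply: free_embedded_projective => //; apply: free_embedded_sub (@incZ_inj n) _. Qed.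
Lemma boundaries_projective n : projective (boundaries n).
Proof. by apply: free_embedded_projective => //; apply: free_embedded_sub (@incl_inj _ _ _) _. Qed.

Lemma sec_exists n : exists s : {linear boundaries n -> C n.+1},
  forall b, bd n (s b) = b.
Proof.
by apply: (projective_lift (f := idfun)); [exact: boundaries_projective | exact: bd_surj].
Qed.

Definition sec n := projT1 (cid (sec_exists n)).
Lemma secK n b : bd n (sec n b) = b. Proof. exact: (projT2 (cid (sec_exists n))). Qed.

(** In degree 0 every chain is a cycle; above, subtracting the section of the boundary projects onto
    the cycles. *)
Definition ret_pre n : {linear C n -> C n} :=
  match n return {linear C n -> C n} with
  | 0 => idfun
  | m.+1 => sub_lin idfun (comp_lin (sec m) (bd m))
  end.

Lemma ret_cycle n x : ret_pre n x \in @chain_cycle K C n.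
Proof.
case: n x => [//|n] x; rewrite unfold_in -val_incB_bd.
by rewrite sub_linE linearB comp_linE secK subrr !linear0.
Qed.

Definition ret n : {linear C n -> cycles n} := corestr (@ret_cycle n).

Lemma incZ_retS n x : incZ n.+1 (ret n.+1 x) = x - sec n (bd n x).
Proof. by []. Qed.

Lemma retK n z : ret n (incZ n z) = z.
Proof.
apply: incZ_inj; case: n z => [//|n] z.
by rewrite incZ_retS bd_cycle linear0 subr0.
Qed.

Lemma ret_diff n x : ret n (chain_diff C n x) = incB n (bd n x).
Proof. by rewrite -val_incB_bd retK. Qed.

(** Extends the class map from cycles to all chains and kills boundaries, so tensor products of such
    maps detect homology classes at chain level. *)
Definition hret n : {linear C n -> homology C n} := comp_lin (hcls n) (ret n).

Lemma hret_diff n x : hret n (chain_diff C n x) = 0.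
Proof. by rewrite comp_linE ret_diff; apply/hcls_eq0; exists (bd n x). Qed.

Lemma hret_cycle n z : hret n (incZ n z) = hcls n z.
Proof. by rewrite comp_linE retK. Qed.

Lemma vanish_cycles n (N : lmodType K) (delta : {linear C n.+1 -> N}) :
  (forall z, delta (incZ n.+1 z) = 0) -> forall x, delta x = delta (sec n (bd n x)).
Proof.
by move=> d0 x; apply/eqP; rewrite -subr_eq0 -linearB -incZ_retS d0.
Qed.

Lemma res0_exists n : exists s : {linear cycles n -> {freeg (homology C n) / K}},
  forall z, resolution_aug (homology C n) (s z) = hcls n z.
Proof.
apply: projective_lift => [|z]; first exact: cycles_projective.
by exists << hcls n z >>; apply: free_liftU.
Qed.
Definition res0 n := projT1 (cid (res0_exists n)).
Lemma res0P n z : resolution_aug _ (res0 n z) = hcls n z.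
Proof. exact: (projT2 (cid (res0_exists n))). Qed.

Lemma res1_exists n :
  exists s : {linear boundaries n ->
                {freeg (submodule (lin_ker (resolution_aug (homology C n)))) / K}},
  forall b, resolution_d1 _ (s b) = comp_lin (res0 n) (incB n) b.
Proof.
apply: projective_lift => [|b]; first exact: boundaries_projective.
have bk : res0 n (incB n b) \in lin_ker (resolution_aug (homology C n)).
  by rewrite unfold_in res0P; apply/eqP/hcls_eq0; exists b.
by exists << Submodule bk >>; apply: free_liftU.
Qed.
Definition res1 n := projT1 (cid (res1_exists n)).
Lemma res1P n b : resolution_d1 _ (res1 n b) = res0 n (incB n b).
Proof. exact: (projT2 (cid (res1_exists n))). Qed.

Definition unres0 n : {linear {freeg (homology C n) / K} -> cycles n} :=
  free_lift (fun h : homology C n => repr h : cycles n).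

Lemma unres0P n x : hcls n (unres0 n x) = resolution_aug _ x.
Proof.
apply: (@free_ext _ _ _ (comp_lin (hcls n) (unres0 n)) (resolution_aug _)) => h.
rewrite comp_linE [unres0 n _]free_liftU [RHS]free_liftU.
exact: quotient_repr.
Qed.

Lemma unres1_im n x :
  comp_lin (incZ n) (comp_lin (unres0 n) (resolution_d1 (homology C n))) x
    \in lin_im (chain_diff C n).
Proof.
rewrite !comp_linE.
have : hcls n (unres0 n (resolution_d1 _ x)) = 0.
  rewrite unres0P.
  apply: (@free_ext _ _ _ (comp_lin (resolution_aug _) (resolution_d1 _)) \0) => k.
  by rewrite comp_linE [resolution_d1 _ _]free_liftU; apply/eqP/(valP k).
by move=> /hcls_eq0[b <-]; apply: valP b.
Qed.

Definition unres1 n : {linear {freeg (submodule (lin_ker (resolution_aug (homology C n)))) / K}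
   -> boundaries n} := corestr (@unres1_im n).

Lemma unres1P n x : incB n (unres1 n x) = unres0 n (resolution_d1 _ x).
Proof. exact: val_inj. Qed.

Lemma incB_inj n : injective (incB n).
Proof. by move=> x y /(congr1 val) /= xy; apply: val_inj. Qed.

Lemma d1_d2 (A : lmodType K) x : resolution_d1 A (resolution_d2 A x) = 0.
Proof.
apply: (@free_ext _ _ _ (comp_lin (resolution_d1 _) (resolution_d2 _)) \0) => k.
by rewrite comp_linE [resolution_d2 _ _]free_liftU; apply/eqP/(valP k).
Qed.

(* As 0 -> B_n -> Z_n -> H_n -> 0 is a projective resolution, Tor_1(H_n, N) is the kernel of
   B_n (x) N -> Z_n (x) N; res and unres compare it with the canonical resolution. *)
Section Tor.
Variables (N : lmodType K) (n : nat).
Local Notation id_N := (idfun : {linear N -> N}).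

Lemma Tor_res_ker w : tensor_map (incB n) id_N w = 0 ->
  tensor_map (res1 n) id_N w
    \in lin_ker (tensor_map (resolution_d1 (homology C n)) id_N).
Proof.
move=> w0; rewrite unfold_in.
rewrite (@tensor_map_comp _ _ _ _ _ _ _ (res1 n) id_N (resolution_d1 _) id_N (comp_lin (res0 n)
  (incB n)) id_N) //.
  rewrite -(@tensor_map_comp _ _ _ _ _ _ _ (incB n) id_N (res0 n) id_N (comp_lin (res0 n) (incB
    n)) id_N) //.
  by rewrite w0 linear0.
exact: res1P.
Qed.

(** The round trip on cycles induces the identity on homology, so it differs from the identity by a
    map [h] into boundaries, and on boundaries the round trip is 1 plus [h] composed with the
    inclusion. On [w] the inclusion vanishes, so the round trip returns [w]; but it also factors
    through the image of [resolution_d2], which [unres1] kills. *)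
Lemma Tor_res_inj w : tensor_map (incB n) id_N w = 0 ->
  tensor_map (res1 n) id_N w
    \in lin_im (tensor_map (resolution_d2 (homology C n)) id_N) -> w = 0.
Proof.
move=> w0 /asboolP[y yE].
have hP z : incl _ (sub_lin (comp_lin (unres0 n) (res0 n)) idfun z) \in lin_im (chain_diff C n).
  have : hcls n (sub_lin (comp_lin (unres0 n) (res0 n)) idfun z) = 0.
    by rewrite sub_linE linearB comp_linE unres0P res0P subrr.
  by move=> /hcls_eq0[b <-]; apply: valP b.
pose h : {linear cycles n -> boundaries n} :=
  corestr (f := comp_lin (incl _) (sub_lin (comp_lin (unres0 n) (res0 n)) idfun)) hP.
have hE b : comp_lin h (incB n) b = comp_lin (unres1 n) (res1 n) b - b.
  apply: incB_inj; rewrite linearB !comp_linE unres1P res1P.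
  exact: val_inj.
have E1 : tensor_map (comp_lin h (incB n)) id_N w = 0.
  rewrite -(@tensor_map_comp _ _ _ _ _ _ _ (incB n) id_N h id_N _ id_N) //.
  by rewrite w0 linear0.
have E2 : tensor_map (comp_lin (unres1 n) (res1 n)) id_N w = 0.
  rewrite -(@tensor_map_comp _ _ _ _ _ _ _ (res1 n) id_N (unres1 n) id_N _ id_N) //.
  rewrite yE (@tensor_map_comp _ _ _ _ _ _ _ (resolution_d2 _) id_N (unres1 n) id_N \0 id_N) //.
    exact: tensor_map0l.
  by move=> u; apply: incB_inj; rewrite unres1P d1_d2 !linear0.
move: E1; rewrite (@tensor_mapBl _ _ _ _ _ (comp_lin (unres1 n) (res1 n)) idfun) //.
by rewrite E2 sub0r tensor_map_id // => /eqP; rewrite oppr_eq0 => /eqP.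
Qed.

(** The witness is the image of [u] under [unres1]. The opposite round trip minus the identity lifts
    the zero map of the canonical resolution, hence is null-homotopic. *)
Lemma Tor_res_surj u :
  u \in lin_ker (tensor_map (resolution_d1 (homology C n)) id_N) ->
  exists2 w, tensor_map (incB n) id_N w = 0 &
    tensor_map (res1 n) id_N w - u
    \in lin_im (tensor_map (resolution_d2 (homology C n)) id_N).
Proof.
rewrite unfold_in => /eqP u0; exists (tensor_map (unres1 n) id_N u).
  rewrite (@tensor_map_comp _ _ _ _ _ _ _ (unres1 n) id_N (incB n) id_N (comp_lin (unres0 n)
    (resolution_d1 _)) id_N) //; last exact: unres1P.
  rewrite -(@tensor_map_comp _ _ _ _ _ _ _ (resolution_d1 _) id_N (unres0 n) id_N _ id_N) //.
  by rewrite u0 linear0.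
have := @resolution_lift0 _ _ N _ _ (resolution_d1 (homology C n))
  (sub_lin (comp_lin (res1 n) (unres1 n)) idfun)
  (sub_lin (comp_lin (res0 n) (unres0 n)) idfun)
  (projective_free _ _) (projective_free _ _) _ _ u u0.
rewrite (@tensor_mapBl _ _ _ _ _ (comp_lin (res1 n) (unres1 n)) idfun) //.
rewrite -(@tensor_map_comp _ _ _ _ _ _ _ (unres1 n) id_N (res1 n) id_N _ id_N) //.
rewrite (@tensor_map_id _ _ _ idfun id_N) //; apply=> x.
  by rewrite !sub_linE linearB !comp_linE res1P unres1P.
by rewrite sub_linE linearB comp_linE res0P unres0P subrr.
Qed.

End Tor.
End FreeComplex.

Lemma tensor_map_compE (K : comNzRingType) (U V U1 V1 U2 V2 : lmodType K)
    (f : {linear U -> U1}) (g : {linear V -> V1})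
    (f' : {linear U1 -> U2}) (g' : {linear V1 -> V2}) x :
  tensor_map f' g' (tensor_map f g x) = tensor_map (comp_lin f' f) (comp_lin g' g) x.
Proof. exact: tensor_map_comp. Qed.

Lemma add_pair_linear (K : comNzRingType) (U V W : lmodType K)
    (f : {linear U -> W}) (g : {linear V -> W}) :
  linear (fun p : (U * V)%type => f p.1 + g p.2).
Proof.
by move=> a x y /=; rewrite (linearP f) (linearP g) scalerDr addrACA.
Qed.

Definition add_pair (K : comNzRingType) (U V W : lmodType K)
    (f : {linear U -> W}) (g : {linear V -> W}) : {linear (U * V)%type -> W} :=
  mk_linear (add_pair_linear f g).

Lemma add_pairE (K : comNzRingType) (U V W : lmodType K)
    (f : {linear U -> W}) (g : {linear V -> W}) x y :
  add_pair f g (x, y) = f x + g y.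
Proof. by []. Qed.

Lemma comp_diff (K : comNzRingType) (C D : chain_complex K) n
    (z : tensor_complex C D n.+1) i j :
  comp (chain_diff (tensor_complex C D) n z) i j =
  tensor_map (chain_diff C i) idfun (comp z i.+1 j)
  + (-1) ^+ i *: tensor_map idfun (chain_diff D j) (comp z i j.+1).
Proof.
have [ij|nij] := eqVneq (i + j)%N n; last first.
  have n1 : (i.+1 + j != n.+1)%N by rewrite addSn eqSS.
  have n2 : (i + j.+1 != n.+1)%N by rewrite addnS eqSS.
  by rewrite !comp_out // !linear0 addr0.
rewrite /comp /dcomp; case: {-}_ / idP => [e|]; last by case; rewrite add0n ij eqxx.
case: {-}_ / idP => [e1|]; last by case; rewrite add0n ?addSn ?addnS ij eqxx.
rewrite -[LHS]/(tensor_map (chain_diff C i) idfun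
    (z (exist _ (i.+1, j) (bidegree_succl (exist _ (i, j) e)))) +
  (-1) ^+ i *: tensor_map idfun (chain_diff D j)
    (z (exist _ (i, j.+1) (bidegree_succr (exist _ (i, j) e))))).
have El e2 : z (exist _ (i.+1, j) e2) = z (exist _ (i.+1, j) e).
  by rewrite (bool_irrelevance e2 e).
have Er e2 : z (exist _ (i, j.+1) e2) = z (exist _ (i, j.+1) e1).
  by rewrite (bool_irrelevance e2 e1).
by rewrite El Er.
Qed.

Section TensorComplexComponents.
Variables (K : idomainType) (C D : chain_complex K).
Local Notation T := (tensor_complex C D).

Lemma cycle_rel n (z : cycles T n) i j :
  tensor_map (chain_diff C i) idfun (comp (val z) i.+1 j) =
  - ((-1) ^+ i *: tensor_map idfun (chain_diff D j) (comp (val z) i j.+1)).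
Proof.
apply/eqP; rewrite -addr_eq0; apply/eqP.
case: n z => [|n] z; first by rewrite !comp_out ?addnS // !linear0 ?oppr0 ?addr0.
by rewrite -comp_diff [chain_diff _ _ _](diff_cycle z) comp0.
Qed.

(** [a] is indexed by the bidegree with the first degree lowered by one, [b] by the one with the
    second degree lowered; the matches put 0 where there is no predecessor. *)
Definition build (a : forall i j, tensor (C i.+1) (D j))
    (b : forall i j, tensor (C i) (D j.+1)) i j : tensor (C i) (D j) :=
  (match i return tensor (C i) (D j) with 0 => 0 | k.+1 => a k j end) +
  (match j return tensor (C i) (D j) with 0 => 0 | k.+1 => b i k end).

Lemma build_l a b i j :
  (forall i j, tensor_map (chain_diff C i) (idfun : {linear D j.+1 -> D j.+1}) (b i.+1 j) = 0) ->
  tensor_map (chain_diff C i) (idfun : {linear D j -> D j}) (build a b i.+1 j) =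
  tensor_map (chain_diff C i) idfun (a i j).
Proof.
by move=> b0; rewrite /build linearD; case: j => [|j]; rewrite ?b0 ?linear0 addr0.
Qed.

Lemma build_r a b i j :
  (forall i j, tensor_map (idfun : {linear C i.+1 -> C i.+1}) (chain_diff D j) (a i j.+1) = 0) ->
  tensor_map (idfun : {linear C i -> C i}) (chain_diff D j) (build a b i j.+1) =
  tensor_map idfun (chain_diff D j) (b i j).
Proof.
by move=> a0; rewrite /build linearD; case: i => [|i]; rewrite ?a0 ?linear0 add0r.
Qed.

End TensorComplexComponents.

Section Kunneth.
Variables (K : idomainType) (K_pid : principal_ideal_domain K).
Variables (C D : chain_complex K).
Hypotheses (HC : forall n, free_embedded (C n)) (HD : forall n, free_embedded (D n)).
Local Notation T := (tensor_complex C D).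
Local Notation secC := (sec K_pid HC).
Local Notation secD := (sec K_pid HD).
Local Notation retC := (ret K_pid HC).
Local Notation retD := (ret K_pid HD).
Local Notation hretC := (hret K_pid HC).
Local Notation hretD := (hret K_pid HD).
Local Notation res1C := (res1 K_pid HC).
Local Notation id_ X := (idfun : {linear X -> X}).

(* delta factors through the boundary of D, and the boundary applied to both sides of
   z vanishes because it squares to 0 on D. *)
Lemma mixed0 n (z : cycles T n) i j (N : lmodType K) (delta : {linear D j -> N}) :
  (forall y, delta (incZ D j y) = 0) ->
  tensor_map (bd C i) delta (comp (val z) i.+1 j) = 0.
Proof.
case: j delta => [|j] delta d0.
  apply: tensor_map0r => x.
  by rewrite -[x]/(incZ D 0 (Submodule (isT : x \in @chain_cycle K D 0))) d0.
have bb0 : tensor_map (bd C i) (bd D j) (comp (val z) i.+1 j.+1) = 0.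
  apply: (inj_lin0 (tensor_map_injl (boundaries_projective K_pid HD j)
                      (@incl_inj _ _ (lin_im (chain_diff C i))))).
  rewrite tensor_map_compE.
  transitivity (tensor_map (id_ (C i)) (bd D j)
     (tensor_map (chain_diff C i) (id_ (D j.+1)) (comp (val z) i.+1 j.+1))).
    by rewrite tensor_map_compE; apply: eq_tensor_map.
  rewrite cycle_rel linearN linearZ_LR tensor_map_compE.
  by rewrite tensor_map0r ?scaler0 ?oppr0 // => x; apply: bd_diff.
transitivity (tensor_map (id_ (boundaries C i)) (comp_lin delta (secD j))
    (tensor_map (bd C i) (bd D j) (comp (val z) i.+1 j.+1))).
  by rewrite tensor_map_compE; apply: eq_tensor_map => // x; apply: vanish_cycles.
by rewrite bb0 linear0.
Qed.

(* The map to Tor sends the class of z to the class of (d (x) 1) z, after D_j is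
   retracted onto its cycles; the retraction is not natural, but the class is. *)
Definition beta_w n i j : {linear T n -> tensor (boundaries C i) (homology D j)} :=
  comp_lin (tensor_map (bd C i) (hretD j)) (comp_lm (C : nat -> lmodType K) (D : nat ->
    lmodType K) n i.+1 j).

(** The cycle relation trades the boundary on the first factor for one on the second, which [hretD]
    kills. *)
Lemma beta_w_ker n (z : cycles T n) i j :
  tensor_map (incB C i) (id_ (homology D j)) (beta_w n i j (val z)) = 0.
Proof.
rewrite /beta_w comp_linE tensor_map_compE.
transitivity (tensor_map (retC i) (hretD j)
   (tensor_map (chain_diff C i) (id_ (D j)) (comp (val z) i.+1 j))).
  by rewrite tensor_map_compE; apply: eq_tensor_map => // x; rewrite !comp_linE ret_diff.
rewrite cycle_rel linearN linearZ_LR tensor_map_compE.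
by rewrite tensor_map0r ?scaler0 ?oppr0 // => x; apply: hret_diff.
Qed.

Lemma beta_w_bd n (y : T n.+1) i j : beta_w n i j (chain_diff T n y) = 0.
Proof.
rewrite /beta_w comp_linE.
rewrite -[X in tensor_map _ _ X]/(comp (chain_diff T n y) i.+1 j) comp_diff.
rewrite linearD linearZ_LR !tensor_map_compE tensor_map0l; last by move=> x; apply: bd_diff.
by rewrite tensor_map0r ?scaler0 ?addr0 // => x; apply: hret_diff.
Qed.

Definition beta_pre n i j :=
  comp_lin (tensor_map (res1C i) (id_ (homology D j))) (beta_w n i j).

Lemma beta_pre_ker n i j (z : cycles T n) :
  comp_lin (beta_pre n i j) (incZ T n) z
    \in lin_ker (tensor_map (resolution_d1 (homology C i)) (id_ (homology D j))).
Proof. exact/Tor_res_ker/beta_w_ker. Qed.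

Definition beta_cyc n i j :
    {linear cycles T n -> Tor_cycles (homology C i) (homology D j)} :=
  corestr (@beta_pre_ker n i j).

Lemma beta_cyc_eq0 n i j (z : cycles T n) : hcls T n z = 0 ->
  comp_lin (Tor_cls (homology C i) (homology D j)) (beta_cyc n i j) z = 0.
Proof.
move=> /hcls_eq0[b <-]; have [y <-] := bd_surj b; apply/eqP.
rewrite comp_linE Tor_cls_eq0 -[Tor_incl _ _ _]/(beta_pre n i j (incZ T n (incB T n (bd T n y)))).
rewrite val_incB_bd.
by rewrite /beta_pre comp_linE beta_w_bd linear0 rpred0.
Qed.

Definition kunneth_beta n :
    {linear homology T n -> graded_Tor1 (homology C) (homology D) n} :=
  of_tcomp_lin n (fun i j => surj_factor (@hcls_surj _ T n) (@beta_cyc_eq0 n i j)).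

Lemma kunneth_betaE n (z : cycles T n) i j : (i.+1 + j = n)%N ->
  tcomp (kunneth_beta n (hcls T n z)) i j = Tor_cls _ _ (beta_cyc n i j z).
Proof. by move=> ij; rewrite tcomp_of // surj_factorE. Qed.

Lemma kunneth_beta_eq0 n (z : cycles T n) i j : (i.+1 + j = n)%N ->
  tcomp (kunneth_beta n (hcls T n z)) i j = 0 <->
  beta_pre n i j (incZ T n z)
    \in lin_im (tensor_map (resolution_d2 (homology C i)) (id_ (homology D j))).
Proof.
move=> ij; rewrite kunneth_betaE //; split=> [/eqP|im].
  by rewrite Tor_cls_eq0.
by apply/eqP; rewrite Tor_cls_eq0.
Qed.

Definition cyc_tensor n := graded_tensor (cycles C) (cycles D) n.

Lemma cyc_tensor_cycle n (u : cyc_tensor n) :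
  graded_tensor_map (incZ C) (incZ D) n u \in @chain_cycle K T n.
Proof.
case: n u => [//|n] u; rewrite unfold_in; apply/eqP/comp_ext => i j _.
rewrite comp0 comp_diff !comp_map !tensor_map_compE.
rewrite tensor_map0l; last by move=> x; apply: diff_cycle.
by rewrite tensor_map0r ?scaler0 ?addr0 // => x; apply: diff_cycle.
Qed.

Definition cyc_incl n : {linear cyc_tensor n -> cycles T n} :=
  corestr (@cyc_tensor_cycle n).

Definition hcls2 n : {linear cyc_tensor n -> graded_tensor (homology C) (homology D) n} :=
  graded_tensor_map (hcls C) (hcls D) n.

Lemma hcls2_surj n h : exists u, hcls2 n u = h.
Proof.
have hs (p : bidegree 0 n) :=
  tensor_map_surj (@hcls_surj _ C (val p).1) (@hcls_surj _ D (val p).2) (h p).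
exists (fun p => projT1 (cid (hs p))); apply: functional_extensionality_dep => p.
exact: projT2 (cid (hs p)).
Qed.

(** Modulo the two kinds of boundaries a pure tensor of cycles dies as soon as one entry is a
    boundary, so right exactness applies. *)
Lemma hcls_tensor_ker i j (x : tensor (cycles C i) (cycles D j)) :
  tensor_map (hcls C i) (hcls D j) x = 0 ->
  exists ab : tensor (C i.+1) (cycles D j) * tensor (cycles C i) (D j.+1),
    tensor_map (incZ C i) (incZ D j) x =
    tensor_map (chain_diff C i) (incZ D j) ab.1 +
    tensor_map (incZ C i) (chain_diff D j) ab.2.
Proof.
move=> x0.
pose P := add_pair (tensor_map (chain_diff C i) (incZ D j))
                   (tensor_map (incZ C i) (chain_diff D j)).
pose S := lin_im P.
have [||h hE] := @tensor_right_exact _ _ _ _ _ _ (hcls C i) (hcls D j)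
  (comp_lin (quotient_proj S : {linear _ -> quotient_module S})
            (tensor_map (incZ C i) (incZ D j))) _ (@hcls_surj _ D j) _.
- exact: hcls_surj.
- move=> u v uv0; rewrite comp_linE tensor_map_pure; apply/eqP.
  rewrite quotient_proj_eq0; apply/asboolP.
  case: uv0 => /hcls_eq0[b <-]; have [c <-] := bd_surj b.
    exists (pure_tensor c v, 0).
    by rewrite /P add_pairE linear0 addr0 tensor_map_pure.
  exists (0, pure_tensor u c).
  by rewrite /P add_pairE linear0 add0r tensor_map_pure.
have : quotient_proj S (tensor_map (incZ C i) (incZ D j) x) = 0.
  by rewrite -[LHS]/(comp_lin (quotient_proj S) (tensor_map (incZ C i) (incZ D j)) x) -hE x0
    linear0.
by move/eqP; rewrite quotient_proj_eq0 => /asboolP[ab ->]; exists ab.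
Qed.

Lemma signK (V : lmodType K) i (x : V) : (-1) ^+ i *: ((-1) ^+ i *: x) = x.
Proof. by rewrite scalerA -expr2 sqrr_sign scale1r. Qed.

Lemma alpha_ker n (u : cyc_tensor n) : hcls2 n u = 0 ->
  comp_lin (hcls T n) (cyc_incl n) u = 0.
Proof.
move=> u0; have ab i j := cid (@hcls_tensor_ker i j (comp u i j)
  (etrans (esym (comp_map (hcls C) (hcls D) u i j))
     (etrans (congr1 (fun v => comp v i j) u0) (comp0 _ _ _ i j)))).
pose a i j := tensor_map (id_ (C i.+1)) (incZ D j) (projT1 (ab i j)).1.
(* The sign cancels the one in the second half of the tensor differential. *)
pose b i j := (-1) ^+ i *: tensor_map (incZ C i) (id_ (D j.+1)) (projT1 (ab i j)).2.
pose y : T n.+1 := of_comp (build a b).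
apply/hcls_eq0; exists (bd T n y); apply: incZ_inj; rewrite val_incB_bd.
apply: comp_ext => i j ij; rewrite comp_diff.
rewrite [comp y _ _]comp_of ?addSn ?ij // [comp y _ _]comp_of ?addnS ?ij //.
rewrite build_l; last first.
  move=> k l; rewrite /b linearZ_LR tensor_map_compE.
  by rewrite tensor_map0l ?scaler0 // => x; apply: diff_cycle.
rewrite build_r; last first.
  move=> k l; rewrite /a tensor_map_compE.
  by rewrite tensor_map0r // => x; apply: diff_cycle.
rewrite /b linearZ_LR signK !tensor_map_compE.
rewrite -[X in _ = comp X i j]/(graded_tensor_map (incZ C) (incZ D) n u) comp_map.
by rewrite [RHS](projT2 (ab i j)); congr (_ + _); apply: eq_tensor_map.
Qed.

Definition kunneth_alpha n :
    {linear graded_tensor (homology C) (homology D) n -> homology T n} :=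
  surj_factor (@hcls2_surj n) (@alpha_ker n).

Lemma kunneth_alphaE n u :
  kunneth_alpha n (hcls2 n u) = hcls T n (cyc_incl n u).
Proof. exact: surj_factorE. Qed.

(** [hretC] tensored with [hretD] is a left inverse at chain level: it restricts to the class map on
    tensors of cycles and vanishes on boundaries. *)
Lemma kunneth_alpha_inj n : injective (kunneth_alpha n).
Proof.
apply: inj_linP => t; have [u <-] := hcls2_surj t.
rewrite kunneth_alphaE => /hcls_eq0[b]; have [y <-] := bd_surj b.
move=> /(congr1 (incZ T n)); rewrite val_incB_bd => E.
transitivity (graded_tensor_map hretC hretD n (chain_diff T n y)).
  rewrite E; apply: comp_ext => i j _.
  rewrite -[X in graded_tensor_map hretC hretD n X]/(graded_tensor_map (incZ C) (incZ D) n u).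
  rewrite !comp_map tensor_map_compE.
  by apply: eq_tensor_map => x; rewrite comp_linE hret_cycle.
apply: comp_ext => i j _; rewrite comp_map comp_diff comp0.
rewrite linearD linearZ_LR !tensor_map_compE tensor_map0l; last by move=> x; apply: hret_diff.
by rewrite tensor_map0r ?scaler0 ?addr0 // => x; apply: hret_diff.
Qed.

Lemma kunneth_beta_alpha n t : kunneth_beta n (kunneth_alpha n t) = 0.
Proof.
have [u <-] := hcls2_surj t; rewrite kunneth_alphaE.
apply: tcomp_ext => i j ij; rewrite tcomp0; apply/kunneth_beta_eq0 => //.
suff -> : beta_pre n i j (incZ T n (cyc_incl n u)) = 0 by exact: rpred0.
rewrite /beta_pre /beta_w !comp_linE.
rewrite -[X in tensor_map (bd _ _) _ X]/(comp (graded_tensor_map (incZ C) (incZ D) n u) _ _).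
rewrite comp_map !tensor_map_compE tensor_map0l ?linear0 // => x.
by rewrite !comp_linE bd_cycle ?linear0.
Qed.

(** Injectivity of the comparison of resolutions removes Tor from the hypothesis and leaves an
    equation in boundaries (x) homology. *)
Lemma beta_w_eq0 n (z : cycles T n) : kunneth_beta n (hcls T n z) = 0 ->
  forall i j, beta_w n i j (val z) = 0.
Proof.
move=> bz i j; have [ij|nij] := eqVneq (i.+1 + j)%N n; last first.
  by rewrite /beta_w comp_linE [comp_lm _ _ _ _ _ _]comp_out ?linear0.
have : tcomp (kunneth_beta n (hcls T n z)) i j = 0 by rewrite bz tcomp0.
move=> /(kunneth_beta_eq0 z ij) bim.
by apply: Tor_res_inj (beta_w_ker z i j) _; exact: bim.
Qed.

(** Correcting z by a boundary brings its first factors into the cycles of C; the cycle relation and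
    flatness then do the same for its second factors. *)
Lemma kunneth_beta_ker n (z : cycles T n) : kunneth_beta n (hcls T n z) = 0 ->
  exists t, hcls T n z = kunneth_alpha n t.
Proof.
move=> /beta_w_eq0 w0.
(* By [w0] the image of z in B_i (x) Z_j dies in B_i (x) H_j, hence is hit by the differential of
   the second factor. *)
have v_ex i j : exists v : tensor (boundaries C i) (D j.+1),
    tensor_map idfun (comp_lin (incB D j) (bd D j)) v =
    tensor_map (bd C i) (retD j) (comp (val z) i.+1 j).
  apply: (tensor_map_kerr (g := hcls D j)); first exact: hcls_surj.
    by move=> y /hcls_eq0[b <-]; have [c <-] := bd_surj b; exists c.
  by rewrite tensor_map_compE -[RHS](w0 i j); apply: eq_tensor_map.
pose v i j := projT1 (cid (v_ex i j)).
have vP i j := projT2 (cid (v_ex i j)) : tensor_map _ _ (v i j) = _.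
(* With this sign, applying [bd] and [retD] to the boundary of y gives back exactly their value on
   z. *)
pose Y i j : tensor (C i) (D j) :=
  match i, j return tensor (C i) (D j) with
  | k.+1, l.+1 => (-1) ^+ k.+1 *: tensor_map (secC k) (id_ (D l.+1)) (v k l)
  | _, _ => 0
  end.
have YE k l : Y k.+1 l.+1 = (-1) ^+ k.+1 *: tensor_map (secC k) (id_ (D l.+1)) (v k l) by [].
pose y : T n.+1 := of_comp Y.
pose z' : cycles T n := z - incB T n (bd T n y).
(* z' is homologous to z, and comes from cycles (x) cycles. *)
have z'E i j : (i.+1 + j = n)%N -> comp (val z') i.+1 j = comp (val z) i.+1 j -
    (tensor_map (chain_diff C i.+1) idfun (Y i.+2 j) +
     (-1) ^+ i.+1 *: tensor_map idfun (chain_diff D j) (Y i.+1 j.+1)).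
  move=> ij; rewrite [LHS](linearB (comp_lm _ _ _ i.+1 j)).
  rewrite -[X in _ - X]/(comp (chain_diff T n y) i.+1 j) comp_diff.
  by rewrite [comp y _ _]comp_of ?[comp y _ _]comp_of -?ij ?addSn ?addnS.
have br0 i j : tensor_map (bd C i) (retD j) (comp (val z') i.+1 j) = 0.
  have [ij|nij] := eqVneq (i.+1 + j)%N n; last by rewrite comp_out ?linear0.
  rewrite z'E // linearB linearD linearZ_LR !tensor_map_compE tensor_map0l; last first.
    by move=> x; apply: bd_diff.
  rewrite add0r YE [tensor_map _ _ (_ *: _)]linearZ_LR signK !tensor_map_compE -vP; apply/eqP;
    rewrite subr_eq0.
  apply/eqP; apply: eq_tensor_map => x; rewrite !comp_linE ?secK ?ret_diff //.
(* Replacing [retD] by the identity changes nothing: the difference vanishes on cycles, so [mixed0]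
   applies. *)
have b0 i j : tensor_map (bd C i) (id_ (D j)) (comp (val z') i.+1 j) = 0.
  pose dl := sub_lin (id_ (D j)) (comp_lin (incZ D j) (retD j)).
  have := @mixed0 n z' i j _ dl; rewrite (tensor_mapBr _ (g := id_ (D j)) (g' := comp_lin (incZ
    D j) (retD j))) //.
  move=> E; apply/eqP; rewrite -[eqbLHS]subr0; rewrite -[X in _ - X == 0](_ : tensor_map (bd C
    i) (comp_lin (incZ D j) (retD j)) (comp (val z') i.+1 j) = 0).
    by apply/eqP/E => w; rewrite sub_linE comp_linE retK subrr.
  transitivity (tensor_map idfun (incZ D j) (tensor_map (bd C i) (retD j) (comp (val z') i.+1 j))).
    by rewrite tensor_map_compE; apply: eq_tensor_map.
  by rewrite br0 linear0.
have zl i j : tensor_map (comp_lin (incZ C i) (retC i)) (id_ (D j)) (comp (val z') i j) = comp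
  (val z') i j.
  case: i => [|i]; first by apply: tensor_map_id.
  rewrite (tensor_mapBl (f := idfun) (f' := comp_lin (secC i) (bd C i))) //.
  rewrite tensor_map_id // -[RHS]subr0; congr (_ - _).
  transitivity (tensor_map (secC i) (id_ (D j)) (tensor_map (bd C i) (id_ (D j)) (comp (val z')
    i.+1 j))).
    by rewrite tensor_map_compE; apply: eq_tensor_map.
  by rewrite b0 linear0.
(* Up to sign the cycle relation turns this into the first differential, already zero; C_i is flat,
   so the vanishing may be tested in D_j instead of its boundaries. *)
have d0 i j : tensor_map (id_ (C i)) (bd D j) (comp (val z') i j.+1) = 0.
  apply: (inj_lin0 (tensor_map_injr (chain_projective K_pid HC i)
                      (@incl_inj _ _ (lin_im (chain_diff D j))))).
  transitivity (tensor_map (id_ (C i)) (chain_diff D j) (comp (val z') i j.+1)).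
    by rewrite tensor_map_compE; apply: eq_tensor_map.
  rewrite -[LHS](signK i) -[X in _ *: X]opprK -cycle_rel.
  suff -> : tensor_map (chain_diff C i) (id_ (D j)) (comp (val z') i.+1 j) = 0.
    by rewrite oppr0 scaler0.
  transitivity (tensor_map (incl (lin_im (chain_diff C i))) (id_ (D j))
      (tensor_map (bd C i) (id_ (D j)) (comp (val z') i.+1 j))).
    by rewrite tensor_map_compE; apply: eq_tensor_map.
  by rewrite b0 linear0.
have zr i j : tensor_map (id_ (C i)) (comp_lin (incZ D j) (retD j)) (comp (val z') i j) = comp
  (val z') i j.
  case: j => [|j]; first by apply: tensor_map_id.
  rewrite (tensor_mapBr _ (g := idfun) (g' := comp_lin (secD j) (bd D j))) //.
  rewrite tensor_map_id // -[RHS]subr0; congr (_ - _).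
  transitivity (tensor_map (id_ (C i)) (secD j) (tensor_map (id_ (C i)) (bd D j) (comp (val z')
    i j.+1))).
    by rewrite tensor_map_compE; apply: eq_tensor_map.
  by rewrite d0 linear0.
pose u : cyc_tensor n := graded_tensor_map retC retD n (val z').
exists (hcls2 n u); rewrite kunneth_alphaE.
have -> : cyc_incl n u = z'.
  apply: val_inj; apply: comp_ext => i j _; rewrite [comp _ _ _]comp_map comp_map.
  rewrite tensor_map_compE -[RHS]zl -[in RHS]zr tensor_map_compE.
  exact: eq_tensor_map.
rewrite /z' linearB; apply/esym/eqP; rewrite subr_eq addrC -subr_eq subrr eq_sym.
by apply/eqP/hcls_eq0; exists (bd T n y).
Qed.

End Kunneth.

Section KunnethExact.
Variables (K : idomainType) (K_pid : principal_ideal_domain K).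
Variables (C D : chain_complex K).
Hypotheses (HC : forall n, free_embedded (C n)) (HD : forall n, free_embedded (D n)).
Local Notation T := (tensor_complex C D).
Local Notation secC := (sec K_pid HC).
Local Notation id_ X := (idfun : {linear X -> X}).
Local Notation alpha := (kunneth_alpha C D).
Local Notation beta := (kunneth_beta K_pid HC HD).

(** The only link to Tor in the proof of surjectivity: once such a [w] is fixed, the preimage is
    built from chains alone. *)
Definition Tor_lift n (t : graded_Tor1 (homology C) (homology D) n) i j
    (w : tensor (boundaries C i) (cycles D j)) : Prop :=
  forall z : cycles T n, (i.+1 + j = n)%N ->
    beta_w K_pid C HD n i j (incZ T n z) = tensor_map (id_ (boundaries C i)) (hcls D j) w ->
    tcomp (beta n (hcls T n z)) i j = tcomp t i j.

Lemma Tor_lift_exists n (t : graded_Tor1 (homology C) (homology D) n) i j :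
  exists w : tensor (boundaries C i) (cycles D j),
    tensor_map (incB C i) (hcls D j) w = 0 /\ Tor_lift t w.
Proof.
have [u uE] := Tor_cls_surj (tcomp t i j).
have [w w0 wu] := Tor_res_surj K_pid HC (Tor_incl_ker u).
have [w' w'E] := tensor_map_surj (fun y => ex_intro (fun x => id_ (boundaries C i) x = y) y erefl)
                   (@hcls_surj _ D j) w.
exists w'; split.
  by rewrite -w0 -w'E tensor_map_compE; apply: eq_tensor_map.
move=> z ij zE; rewrite kunneth_betaE // -uE; apply/eqP.
rewrite -subr_eq0 -linearB Tor_cls_eq0 linearB.
by rewrite -[Tor_incl _ _ (beta_cyc _ _ _ _ _ _ _)]/(beta_pre K_pid HC HD n i j (incZ T n z))
  /beta_pre comp_linE zE w'E.
Qed.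

(** A zigzag: [secC] lifts the first factor of [w] to chains; the boundary of the result lies in Z_i
    (x) Z_j and dies in Z_i (x) H_j, so it is the second differential of some [v], and subtracting
    [v] with the right sign closes the chain to a cycle. *)
Lemma kunneth_beta_surj n t : exists h, beta n h = t.
Proof.
have [w wP] : exists w : forall i j, tensor (boundaries C i) (cycles D j),
    forall i j, tensor_map (incB C i) (hcls D j) (w i j) = 0 /\ Tor_lift t (w i j).
  exists (fun i j => projT1 (cid (Tor_lift_exists t i j))) => i j.
  exact: projT2 (cid (Tor_lift_exists t i j)).
have v_ex i j : exists v : tensor (cycles C i) (D j.+1),
    tensor_map idfun (comp_lin (incB D j) (bd D j)) v =
    tensor_map (incB C i) (id_ (cycles D j)) (w i j).
  apply: (tensor_map_kerr (g := hcls D j)); first exact: hcls_surj.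
    by move=> y /hcls_eq0[b <-]; have [c <-] := bd_surj b; exists c.
  have [w0 _] := wP i j.
  by rewrite tensor_map_compE -[RHS]w0; apply: eq_tensor_map.
pose v i j := projT1 (cid (v_ex i j)).
have vP i j := projT2 (cid (v_ex i j)) : tensor_map _ _ (v i j) = _.
pose a i j := tensor_map (secC i) (incZ D j) (w i j).
pose b i j := - ((-1) ^+ i *: tensor_map (incZ C i) (id_ (D j.+1)) (v i j)).
pose z : T n := of_comp (build a b).
have a0 i j : tensor_map (id_ (C i.+1)) (chain_diff D j) (a i j.+1) = 0.
  by rewrite /a tensor_map_compE tensor_map0r // => x; apply: diff_cycle.
have b0 (N : lmodType K) i j (f : {linear C i.+1 -> N}) (N' : lmodType K)
    (g : {linear D j.+1 -> N'}) :
    (forall x, f (incZ C i.+1 x) = 0) -> tensor_map f g (b i.+1 j) = 0.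
  move=> f0; rewrite /b linearN linearZ_LR tensor_map_compE.
  by rewrite tensor_map0l ?scaler0 ?oppr0 // => x; apply: f0.
have zZ : z \in @chain_cycle K T n.
  rewrite {}/z; case: n t w wP v_ex @v vP @a @b a0 b0 => [//|m] t w wP v_ex v vP a b a0 b0.
  rewrite unfold_in; apply/eqP/comp_ext => i j ij.
  rewrite comp_diff comp0 !comp_of ?addSn ?addnS ?ij //.
  rewrite build_l; last by move=> k l; apply: b0 => x; apply: diff_cycle.
  rewrite build_r // /b linearN linearZ_LR scalerN signK !tensor_map_compE.
  apply/eqP; rewrite subr_eq0; apply/eqP.
  transitivity (tensor_map (incZ C i) (incZ D j) (tensor_map (incB C i) (id_ (cycles D j)) (w i
    j))).
    rewrite tensor_map_compE; apply: eq_tensor_map => x //.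
    by rewrite !comp_linE -val_incB_bd secK.
  by rewrite -vP tensor_map_compE; apply: eq_tensor_map.
exists (hcls T n (Submodule zZ)); apply: tcomp_ext => i j ij.
have [_ wE] := wP i j; apply: wE => //.
rewrite /beta_w comp_linE.
rewrite [comp_lm _ _ _ _ _ _]comp_of // /build [tensor_map (bd C i) _ _]linearD.
(* The pieces coming from [b] have a cycle as first factor and do not contribute. *)
have -> : tensor_map (bd C i) (hret K_pid HD j)
    match j return tensor (C i.+1) (D j) with 0 => 0 | k.+1 => b i.+1 k end = 0.
  case: j {ij} => [|j]; first exact: linear0.
  by apply: b0 => x; apply: bd_cycle.
rewrite addr0 /a !tensor_map_compE; apply: eq_tensor_map => x.
  by rewrite comp_linE secK.
by rewrite !comp_linE retK.
Qed.

Theorem kunneth_exact n : short_exact (alpha n) (beta n).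
Proof.
split; first exact: kunneth_alpha_inj.
  move=> h; split=> [|[t ->]]; last exact: kunneth_beta_alpha.
  have [z <-] := hcls_surj h; exact: kunneth_beta_ker.
by move=> t; have [h <-] := kunneth_beta_surj t; exists h.
Qed.

End KunnethExact.

(** * Naturality of the Kuenneth sequence *)

Section KunnethNatural.
Variables (K : idomainType) (K_pid : principal_ideal_domain K).
Variables (C D C' D' : chain_complex K).
Hypotheses (HC : forall n, free_embedded (C n)) (HD : forall n, free_embedded (D n)).
Hypotheses (HC' : forall n, free_embedded (C' n)) (HD' : forall n, free_embedded (D' n)).
Variables (f : chain_map C C') (g : chain_map D D').
Local Notation id_ X := (idfun : {linear X -> X}).
Local Notation T := (tensor_complex C D).
Local Notation T' := (tensor_complex C' D').

Lemma tensor_chain_mapP n (z : T n.+1) :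
  graded_tensor_map f g n (chain_diff T n z) =
  chain_diff T' n (graded_tensor_map f g n.+1 z).
Proof.
apply: comp_ext => i j _; rewrite comp_map !comp_diff !comp_map linearD linearZ_LR.
by rewrite !tensor_map_compE; congr (_ + _ *: _); apply: eq_tensor_map => x //;
  apply: chain_funP.
Qed.

Definition tensor_chain_map : chain_map T T' :=
  @ChainMap K T T' (fun n => graded_tensor_map f g n) tensor_chain_mapP.

Definition cyc_map (C0 C1 : chain_complex K) (h : chain_map C0 C1) n :
  {linear cycles C0 n -> cycles C1 n} := submodule_map (@cycle_map K C0 C1 h n).
Definition bd_map (C0 C1 : chain_complex K) (h : chain_map C0 C1) n :
  {linear boundaries C0 n -> boundaries C1 n} := submodule_map (@boundary_map K C0 C1 h n).

Lemma homology_map_cls (C0 C1 : chain_complex K) (h : chain_map C0 C1) n z :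
  homology_map h n (hcls C0 n z) = hcls C1 n (cyc_map h n z).
Proof. by rewrite mk_linearE [LHS]quotient_fun_proj // => x; apply: boundary_map. Qed.

Lemma bd_map_bd (C0 C1 : chain_complex K) (h : chain_map C0 C1) n x :
  bd_map h n (bd C0 n x) = bd C1 n (h n.+1 x).
Proof. by apply: val_inj; apply: chain_funP. Qed.

Lemma kunneth_alpha_natural n t :
  kunneth_alpha C' D' n (graded_tensor_map (homology_map f) (homology_map g) n t) =
  homology_map tensor_chain_map n (kunneth_alpha C D n t).
Proof.
have [u <-] := hcls2_surj t.
have -> : graded_tensor_map (homology_map f) (homology_map g) n (hcls2 C D n u) =
          hcls2 C' D' n (graded_tensor_map (cyc_map f) (cyc_map g) n u).
  apply: comp_ext => i j _; rewrite !comp_map !tensor_map_compE.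
  by apply: eq_tensor_map => x; apply: homology_map_cls.
rewrite !kunneth_alphaE homology_map_cls; congr (hcls _ _ _).
apply: incZ_inj; apply: comp_ext => i j _.
rewrite -[LHS]/(comp (graded_tensor_map (incZ C') (incZ D') n (graded_tensor_map (cyc_map f)
  (cyc_map g) n u)) i j).
rewrite -[RHS]/(comp (graded_tensor_map f g n (graded_tensor_map (incZ C) (incZ D) n u)) i j).
by rewrite !comp_map !tensor_map_compE; apply: eq_tensor_map.
Qed.

(** Besides the retraction on D, handled by [mixed0], the lift [res1] to the canonical resolution is
    a choice. The two ways around the square lift the same map on homology, so their difference
    lifts zero; it is null-homotopic, and [w] is killed by the inclusion of boundaries in cycles. *)
Lemma kunneth_beta_natural n h :
  kunneth_beta K_pid HC' HD' n (homology_map tensor_chain_map n h) =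
  graded_Tor1_map (homology_map f) (homology_map g) n (kunneth_beta K_pid HC HD n h).
Proof.
have [z <-] := hcls_surj h; rewrite homology_map_cls.
apply: tcomp_ext => i j ij; rewrite tcomp_map !kunneth_betaE // Tor1_map_cls.
apply/eqP; rewrite -subr_eq0 -linearB Tor_cls_eq0.
rewrite -[Tor_incl _ _ _]/(beta_pre K_pid HC' HD' n i j (graded_tensor_map f g n (val z))
  - tensor_map (resolution_map1 (homology_map f i)) (homology_map g j)
      (beta_pre K_pid HC HD n i j (val z))).
set w := tensor_map (id_ (boundaries C i)) (homology_map g j)
   (beta_w K_pid C HD n i j (val z)).
have w0 : tensor_map (incB C i) (id_ (homology D' j)) w = 0.
  rewrite tensor_map_compE.
  transitivity (tensor_map (id_ (cycles C i)) (homology_map g j)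
    (tensor_map (incB C i) (id_ (homology D j)) (beta_w K_pid C HD n i j (val z)))).
    by rewrite tensor_map_compE; apply: eq_tensor_map.
  by rewrite (beta_w_ker K_pid HC) linear0.
pose R1 := resolution_map1 (homology_map f i).
have E1 : tensor_map R1 (homology_map g j) (beta_pre K_pid HC HD n i j (val z)) =
    tensor_map (comp_lin R1 (res1 K_pid HC i)) (id_ (homology D' j)) w.
  by rewrite /beta_pre comp_linE !tensor_map_compE; apply: eq_tensor_map.
have E2 : beta_pre K_pid HC' HD' n i j (graded_tensor_map f g n (val z)) =
    tensor_map (comp_lin (res1 K_pid HC' i) (bd_map f i)) (id_ (homology D' j)) w.
  pose dl := sub_lin (comp_lin (hret K_pid HD' j) (g j))
                     (comp_lin (homology_map g j) (hret K_pid HD j)).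
  have dl0 y : dl (incZ D j y) = 0.
    rewrite sub_linE !comp_linE retK homology_map_cls.
    by rewrite -[g j _]/(incZ D' j (cyc_map g j y)) retK subrr.
  have := mixed0 K_pid HD z i dl0.
  rewrite (tensor_mapBr _ (g := comp_lin (hret K_pid HD' j) (g j))
    (g' := comp_lin (homology_map g j) (hret K_pid HD j))) //.
  move/eqP; rewrite subr_eq0 => /eqP E.
  rewrite /beta_pre /w /beta_w !comp_linE [comp_lm _ _ _ _ _ _]comp_map !tensor_map_compE.
  transitivity (tensor_map (comp_lin (res1 K_pid HC' i) (bd_map f i)) (id_ (homology D' j))
    (tensor_map (bd C i) (comp_lin (hret K_pid HD' j) (g j)) (comp (val z) i.+1 j))).
    by rewrite tensor_map_compE; apply: eq_tensor_map => // x; rewrite !comp_linE bd_map_bd.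
  by rewrite E tensor_map_compE; apply: eq_tensor_map.
rewrite -/R1 E1 E2 -(tensor_mapBl (h := sub_lin (comp_lin (res1 K_pid HC' i) (bd_map f i))
   (comp_lin R1 (res1 K_pid HC i)))) //.
apply: (resolution_lift0 (iota := incB C i)
  (s := sub_lin (comp_lin (res0 K_pid HC' i) (cyc_map f i))
                (comp_lin (free_map K (homology_map f i)) (res0 K_pid HC i)))) => //.
- exact: boundaries_projective.
- exact: cycles_projective.
- move=> x; rewrite !sub_linE linearB !comp_linE res1P.
  rewrite [resolution_d1 _ (R1 _)](syzygy_mapP (resolution_augP (homology_map f i))).
  rewrite [syzygy _ _]res1P; congr (res0 _ _ _ _ - _).
  exact: val_inj.
- move=> x; rewrite sub_linE linearB !comp_linE resolution_augP !res0P.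
  by rewrite homology_map_cls subrr.
Qed.

End KunnethNatural.

(** * Words and shuffles *)

Section BilinearExtension.
Variables (K : comNzRingType) (A B : choiceType) (V : lmodType K) (h : A -> B -> V).

Lemma bilift_linearl (y : {freeg B / K}) :
  linear (fun x : {freeg A / K} => free_lift (fun a => free_lift (h a) y) x).
Proof. by move=> a u v; rewrite linearP. Qed.

Lemma bilift_linearr (x : {freeg A / K}) :
  linear (fun y : {freeg B / K} => free_lift (fun a => free_lift (h a) y) x).
Proof.
move=> c u v.
pose F := free_lift (fun a => free_lift (h a) (c *: u + v)).
pose F1 := free_lift (fun a => free_lift (h a) u).
pose F2 := free_lift (fun a => free_lift (h a) v).
pose F12 := sub_lin (scale_lin c F1) (scale_lin (-1) F2).
have E : F x = F12 x.
  apply: (@free_ext _ _ _ F F12) => a.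
  by rewrite sub_linE !scale_linE /F /F1 /F2 !free_liftU linearP scaleN1r opprK.
by rewrite -/(F x) E sub_linE !scale_linE scaleN1r opprK.
Qed.

Definition bilift : {linear tensor {freeg A / K} {freeg B / K} -> V} :=
  tensor_lift bilift_linearl bilift_linearr.

Lemma biliftU a b : bilift (pure_tensor << a >> << b >>) = h a b.
Proof. by rewrite /bilift tensor_liftE !free_liftU. Qed.
End BilinearExtension.

Lemma tensor_free_ext (K : comNzRingType) (A B : choiceType) (V : lmodType K)
    (f g : {linear tensor {freeg A / K} {freeg B / K} -> V}) :
  (forall a b, f (pure_tensor << a >> << b >>) = g (pure_tensor << a >> << b >>)) ->
  forall x, f x = g x.
Proof.
move=> fg; apply: tensor_extf => u v.
apply: (@free_ext _ _ _ (comp_lin f (purel _ v)) (comp_lin g (purel _ v))) => a.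
rewrite !comp_linE; apply: (@free_ext _ _ _ (comp_lin f (purer _ << a >>))
  (comp_lin g (purer _ << a >>))) => b.
exact: fg.
Qed.

Section Words.
Variables (K : comNzRingType) (G : groupType).
Local Open Scope group_scope.

Definition words : lmodType K := {freeg (seq G) / K}.

Definition word (w : seq G) : words := << w >>.

Definition word_sym n (w : seq G) : nerve_chain K G n :=
  oapp (@symbol K G n) 0%R (insub w).

Lemma word_sym_tuple n (t : n.-tuple G) : word_sym n t = symbol K t.
Proof. by rewrite /word_sym valK. Qed.

Lemma word_sym_size n w : size w != n -> word_sym n w = 0%R.
Proof. by move=> wn; rewrite /word_sym insubF //; apply/negbTE. Qed.

Lemma word_sym_unit n w : 1 \in w -> word_sym n w = 0%R.
Proof.
rewrite /word_sym; case: insubP => [t _ <- /= t1|//].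
apply: (symbol_degenerate K (k := index 1 t)); last by rewrite nth_index.
by rewrite -[X in (_ < X)%N](size_tuple t) index_mem.
Qed.

Lemma word_sym_nondegenerate n w : size w = n -> 1 \notin w ->
  exists2 v : nondegenerate G n, word_sym n w = << v >> & val (val v) = w.
Proof.
move=> wn w1; have wa : all (fun g => g != 1) (Tuple (introT eqP wn)).
  by apply/allP => g gw; apply: contraNneq w1 => <-.
pose v : nondegenerate G n :=
  exist (fun t : n.-tuple G => all (fun g => g != 1) t) (Tuple (introT eqP wn)) wa.
by exists v => //; rewrite -(symbol_val K v) -word_sym_tuple.
Qed.

Definition word_chain n : {linear words -> nerve_chain K G n} := free_lift (word_sym n).
Lemma word_chainU n w : word_chain n (word w) = word_sym n w. Proof. exact: free_liftU. Qed.

Definition prew (a : G) : {linear words -> words} := free_map K (cons a).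
Lemma prewU a w : prew a (word w) = word (a :: w). Proof. exact: free_liftU. Qed.

(** The order of the product is that of the nerve differential. The empty case is meaningful: it
    makes the last face, which deletes the last letter, a merge of that letter into nothing. *)
Definition merge (a : G) (w : seq G) : seq G := if w is b :: w' then (b * a) :: w' else [::].
Definition mergew (a : G) : {linear words -> words} := free_map K (merge a).
Lemma mergewU a w : mergew a (word w) = word (merge a w). Proof. exact: free_liftU. Qed.
Lemma mergew_pre a b x : mergew a (prew b x) = prew (b * a) x.
Proof.
apply: (@free_ext _ _ _ (comp_lin (mergew a) (prew b)) (prew (b * a))) => w.
by rewrite comp_linE [prew b _]prewU [RHS]prewU [LHS]mergewU.
Qed.

Definition firstw : {linear words -> words} :=
  free_lift (fun w => if w is _ :: w' then word w' else 0%R).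
Lemma firstwU w : firstw (word w) = if w is _ :: w' then word w' else 0%R.
Proof. exact: free_liftU. Qed.
Lemma firstw_pre a x : firstw (prew a x) = x.
Proof.
apply: (@free_ext _ _ _ (comp_lin firstw (prew a)) idfun) => w.
by rewrite comp_linE [prew a _]prewU [LHS]firstwU.
Qed.

(* The boundary without its face 0, which alone is not defined on normalized chains. *)
Fixpoint rest (w : seq G) : words :=
  if w is a :: w' then (- word (merge a w') - prew a (rest w'))%R else 0%R.
Definition restw : {linear words -> words} := free_lift rest.
Lemma restwU w : restw (word w) = rest w. Proof. exact: free_liftU. Qed.
Lemma restw_pre a x : (restw (prew a x) = - mergew a x - prew a (restw x))%R.
Proof.
pose F := sub_lin (scale_lin (-1)%R (mergew a)) (comp_lin (prew a) restw).
have -> : (- mergew a x - prew a (restw x) = F x)%R.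
  by rewrite sub_linE scale_linE scaleN1r.
apply: (@free_ext _ _ _ (comp_lin restw (prew a)) F) => w.
rewrite /F sub_linE scale_linE !comp_linE [prew a << _ >>]prewU [LHS]restwU.
by rewrite [restw << w >>]restwU [mergew a _]mergewU scaleN1r.
Qed.

Fixpoint wface (w : seq G) (i : nat) : seq G :=
  match w, i with
  | [::], _ => [::]
  | _ :: w', 0 => w'
  | a :: w', 1 => merge a w'
  | a :: w', i'.+1 => a :: wface w' i'
  end.

Lemma size_merge a w : size (merge a w) = size w.
Proof. by case: w. Qed.

Lemma size_wface w i : (i <= size w)%N -> size (wface w i) = (size w).-1.
Proof.
elim: w i => [|a w IH] [|[|i]] //=; first by rewrite size_merge.
by move=> iw; rewrite IH //; case: (w) iw.
Qed.

Lemma nth_wface w i k : (k.+1 < size w)%N ->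
  nth 1 (wface w i) k =
    if (k.+1 < i)%N then nth 1 w k
    else if k.+1 == i then nth 1 w k.+1 * nth 1 w k
    else nth 1 w k.+1.
Proof.
elim: w i k => [//|a w IH] [|[|i]] [|k] //=; try by case: (w).
by move=> kw; rewrite IH.
Qed.

Lemma face_wface n i (t : n.+1.-tuple G) : (i <= n.+1)%N ->
  val (face i t) = wface t i.
Proof.
move=> iN; apply: (@eq_from_nth _ 1).
  by rewrite size_tuple size_wface size_tuple.
move=> k; rewrite size_tuple => kn.
by rewrite (nth_face i t kn) nth_wface // size_tuple.
Qed.

Lemma rest_sum w :
  rest w = (\sum_(i < size w) (-1) ^+ i.+1 *: word (wface w i.+1))%R.
Proof.
elim: w => [|a w IH]; first by rewrite big_ord0.
rewrite -[LHS]/(- word (merge a w) - prew a (rest w))%R.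
rewrite -[size _]/(size w).+1 big_ord_recl expr1 scaleN1r; congr (_ + _)%R.
rewrite IH linear_sum -sumrN; apply: eq_bigr => i _.
by rewrite linearZ_LR prewU [in RHS]exprS mulN1r scaleNr.
Qed.

Definition diffw : {linear words -> words} := sub_lin firstw (scale_lin (-1)%R restw).
Lemma diffwE x : diffw x = (firstw x + restw x)%R.
Proof. by rewrite sub_linE scale_linE scaleN1r opprK. Qed.

Lemma diffw_nil : diffw (word [::]) = 0%R.
Proof. by rewrite diffwE firstwU restwU addr0. Qed.

Lemma diffw_sum w : w != [::] ->
  diffw (word w) = (\sum_(i < (size w).+1) (-1) ^+ i *: word (wface w i))%R.
Proof.
case: w => [//|a w] _; rewrite diffwE firstwU restwU rest_sum [RHS]big_ord_recl.
by congr (_ + _)%R; apply/esym/scale1r.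
Qed.

Lemma word_chain_diffw n x : nerve_diff K G n (word_chain n.+1 x) = word_chain n (diffw x).
Proof.
apply: (@free_ext _ _ _ (comp_lin (nerve_diff K G n) (word_chain n.+1))
  (comp_lin (word_chain n) diffw)) => w; rewrite !comp_linE [word_chain n.+1 _]word_chainU.
have [wn|wn] := eqVneq (size w) n.+1; last first.
  (* The empty word is separate: its boundary is 0 and not an alternating sum of faces. *)
  rewrite word_sym_size // linear0; case: w wn => [_|a w wn].
    by rewrite [diffw _]diffwE [firstw _]firstwU [restw _]restwU addr0 linear0.
  rewrite [diffw _]diffw_sum // linear_sum big1 // => i _.
  rewrite linearZ_LR word_chainU word_sym_size ?linear0 ?scaler0 //.
  by rewrite size_wface // -ltnS.
have -> : w = val (Tuple (introT eqP wn)) by [].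
move: (Tuple _) => t {w wn}; rewrite word_sym_tuple nerve_diff_symbol.
rewrite [diffw _]diffw_sum; last by rewrite -size_eq0 size_tuple.
rewrite linear_sum /symbol_diff size_tuple; apply: eq_bigr => i _.
by rewrite linearZ_LR word_chainU -face_wface ?word_sym_tuple // -ltnS.
Qed.

End Words.

(** Aligns the bidegrees of total degree n+1 with those of total degree n, the differential lowering
    one of the two degrees. *)
Lemma sum_shift (V : zmodType) n (A : nat -> nat -> V) :
  (forall j, A 0 j = 0) -> (forall i, A i.+1 n.+1 = 0) ->
  \sum_(i < n.+2) \sum_(j < n.+2) A i j = \sum_(i < n.+1) \sum_(j < n.+1) A i.+1 j.
Proof.
move=> A0 An; rewrite big_ord_recl big1 ?add0r => [|j _]; last exact: A0.
by apply: eq_bigr => i _; rewrite [LHS]big_ord_recr /= An addr0.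
Qed.

Section Shuffle.
Variables (K : comNzRingType) (G H : groupType).
Local Open Scope group_scope.
Local Notation GH := (G * H)%type.
Local Notation wordG := (@word K G).
Local Notation wordH := (@word K H).
Local Notation wordP := (@word K GH).

Definition inl_ (a : G) : GH := (a, 1).
Definition inr_ (b : H) : GH := (1, b).

(** The signed sum over all shuffles; the sign counts the letters of the first word that [b] passes.
    The inner fixpoint is there because a call shortens only one of the two words. *)
Fixpoint shuffle (s : seq G) : seq H -> words K GH :=
  match s with
  | [::] => fun t => wordP (map inr_ t)
  | a :: s' =>
    fix shuffle_a (t : seq H) : words K GH :=
      match t with
      | [::] => wordP (map inl_ (a :: s'))
      | b :: t' => (prew _ (inl_ a) (shuffle s' t) +
                    (-1) ^+ (size s').+1 *: prew _ (inr_ b) (shuffle_a t'))%R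
      end
  end.

Lemma shuffle0s t : shuffle [::] t = wordP (map inr_ t). Proof. by []. Qed.
Lemma shuffles0 s : shuffle s [::] = wordP (map inl_ s). Proof. by case: s. Qed.
Lemma shuffle_cons a s b t : shuffle (a :: s) (b :: t) =
  (prew _ (inl_ a) (shuffle s (b :: t)) +
   (-1) ^+ (size s).+1 *: prew _ (inr_ b) (shuffle (a :: s) t))%R.
Proof. by []. Qed.

(** Only rearrangements of the letters occur in a shuffle product, which is enough to control
    degeneracy, length and marks. *)
Lemma shuffle_supp (V : lmodType K) (S : submodClosed V) s t (F : {linear words K GH -> V}) :
  (forall w, perm_eq w (map inl_ s ++ map inr_ t) -> F (wordP w) \in S) ->
  F (shuffle s t) \in S.
Proof.
elim: s t F => [|a s IH] t F FS; first by rewrite shuffle0s FS.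
elim: t F FS => [|b t IHt] F FS; first by rewrite shuffles0 FS // cats0.
rewrite shuffle_cons linearD linearZ_LR; apply: rpredD.
  apply: (IH (b :: t) (comp_lin F (prew K (inl_ a)))) => w wP; rewrite comp_linE prewU.
  by apply: FS; rewrite /= perm_cons.
apply: rpredZ; apply: (IHt (comp_lin F (prew K (inr_ b)))) => w wP; rewrite comp_linE prewU.
by apply: FS; rewrite -cat1s perm_sym [_ ++ _](_ : _ = map inl_ (a :: s) ++ [:: inr_ b] ++ map
  inr_ t) // perm_catCA /= perm_cons perm_sym.
Qed.

Definition shufflew (x : words K G) (y : words K H) : words K GH :=
  bilift shuffle (pure_tensor x y).

Lemma shufflewU s t : shufflew (wordG s) (wordH t) = shuffle s t.
Proof. exact: biliftU. Qed.

Lemma shufflewl_linear y : linear (shufflew^~ y).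
Proof. by move=> a u v; rewrite /shufflew pure_tensorDl pure_tensorZl linearP. Qed.
Lemma shufflewr_linear x : linear (shufflew x).
Proof. by move=> a u v; rewrite /shufflew pure_tensorDr pure_tensorZr linearP. Qed.
Definition shufflel y : {linear words K G -> words K GH} := mk_linear (shufflewl_linear y).
Definition shuffler x : {linear words K H -> words K GH} := mk_linear (shufflewr_linear x).
Lemma shufflelE x y : shufflew x y = shufflel y x. Proof. by []. Qed.
Lemma shufflerE x y : shufflew x y = shuffler x y. Proof. by []. Qed.

Lemma shuffle_pre_r a s b y :
  shufflew (wordG (a :: s)) (prew K b y) =
  (prew K (inl_ a) (shufflew (wordG s) (prew K b y)) +
   (-1) ^+ (size s).+1 *: prew K (inr_ b) (shufflew (wordG (a :: s)) y))%R.
Proof.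
pose F := comp_lin (prew K (inl_ a)) (comp_lin (shuffler (wordG s)) (prew K b)).
pose F' := scale_lin (- (-1) ^+ (size s).+1)%R
  (comp_lin (prew K (inr_ b)) (shuffler (wordG (a :: s)))).
have -> : (prew K (inl_ a) (shufflew (wordG s) (prew K b y)) +
   (-1) ^+ (size s).+1 *: prew K (inr_ b) (shufflew (wordG (a :: s)) y) = sub_lin F F' y)%R.
  by rewrite sub_linE scale_linE scaleNr opprK.
apply: (@free_ext _ _ _ (comp_lin (shuffler (wordG (a :: s))) (prew K b)) (sub_lin F F')) => t.
rewrite sub_linE scale_linE scaleNr opprK !comp_linE [prew _ _ << _ >>]prewU -!shufflerE.
by rewrite !shufflewU.
Qed.

(** The exponent is [size s] and not one more, because a face of [s] has lost a letter. *)
Lemma shuffle_pre_rest a s b t :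
  shufflew (prew K a (rest K s)) (wordH (b :: t)) =
  (prew K (inl_ a) (shufflew (rest K s) (wordH (b :: t))) +
   (-1) ^+ (size s) *: prew K (inr_ b) (shufflew (prew K a (rest K s)) (wordH t)))%R.
Proof.
rewrite !shufflelE rest_sum (linear_sum (prew K a)) !(linear_sum (shufflel _)).
rewrite !(linear_sum (prew K _)) scaler_sumr -big_split; apply: eq_bigr => i _.
rewrite -[RHS]/(_ + _ *: _)%R !(linearZ_LR (prew K a)) !(linearZ_LR (shufflel _)).
rewrite !(linearZ_LR (prew K _)) !prewU -!shufflelE !shufflewU shuffle_cons.
rewrite size_wface // (ltn_predK (ltn_ord i)) scalerDr !scalerA; congr (_ + _ *: _)%R.
exact: mulrC.
Qed.

(** The head of the shuffle is the head of [s], which merges inside G, or [b], which yields the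
    mixed letter (a, b); the last term corrects the expansion of the shuffle on the right. *)
Lemma merge_shuffle_l a s b t :
  mergew K (inl_ a) (shuffle s (b :: t)) =
  (shuffle (merge a s) (b :: t) + (-1) ^+ (size s) *:
     (prew K (a, b) (shuffle s t) - prew K (inr_ b) (shuffle (merge a s) t)))%R.
Proof.
case: s => [|a' s].
  rewrite -[merge a [::]]/[::] -[size [::]]/0%N !shuffle0s mergewU !prewU expr0 scale1r.
  rewrite [RHS]addrCA subrr addr0.
  by congr (word _ (_ :: _)); congr pair; rewrite (mul1g, mulg1).
rewrite shuffle_cons linearD linearZ_LR !mergew_pre shuffle_cons scalerBr.
have -> : inr_ b * inl_ a = (a, b) by congr pair; rewrite (mul1g, mulg1).
have -> : inl_ a' * inl_ a = inl_ (a' * a) by congr pair; rewrite mulg1.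
by rewrite [RHS]addrACA subrr addr0.
Qed.

Lemma merge_shuffle_r a s b t :
  mergew K (inr_ b) (shuffle (a :: s) t) =
  (shuffle (a :: s) (merge b t) + prew K (a, b) (shuffle s t)
   - prew K (inl_ a) (shuffle s (merge b t)))%R.
Proof.
have ab : inl_ a * inr_ b = (a, b) by congr pair; rewrite (mul1g, mulg1).
case: t => [|b' t].
  rewrite -[merge b [::]]/[::] !shuffles0 mergewU !prewU addrAC subrr add0r.
  by congr (word _ (_ :: _)).
rewrite !shuffle_cons linearD linearZ_LR !mergew_pre ab.
have -> : inr_ b' * inr_ b = inr_ (b' * b) by congr pair; rewrite mulg1.
by rewrite addrAC [(prew K (inl_ a) _ + _)%R]addrC addrK addrC.
Qed.

Lemma shuffle0l y : shufflew (wordG [::]) y = free_map K (map inr_) y.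
Proof.
apply: (@free_ext _ _ _ (shuffler (wordG [::])) (free_map K (map inr_))) => t.
by rewrite -shufflerE [LHS]shufflewU [RHS]free_liftU.
Qed.

Lemma shuffle0r x : shufflew x (wordH [::]) = free_map K (map inl_) x.
Proof.
apply: (@free_ext _ _ _ (shufflel (wordH [::])) (free_map K (map inl_))) => s.
by rewrite -shufflelE [LHS]shufflewU shuffles0 [RHS]free_liftU.
Qed.

Lemma rest_map (G1 G2 : groupType) (f : G1 -> G2) : {morph f : x y / x * y} ->
  forall w, rest K (map f w) = free_map K (map f) (rest K w).
Proof.
move=> fM; elim=> [|a w IH]; first by rewrite linear0.
rewrite -[LHS]/(- word _ (merge (f a) (map f w)) - prew _ (f a) (rest K (map f w)))%R.
rewrite -[rest K (a :: w)]/(- word _ (merge a w) - prew _ a (rest K w))%R.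
rewrite linearB linearN [free_map K _ (word _ _)]free_liftU IH; congr (- word _ _ - _)%R.
  by case: (w) => [//|b w'] /=; rewrite fM.
apply: (@free_ext _ _ _ (comp_lin (prew K (f a)) (free_map K (map f)))
  (comp_lin (free_map K (map f)) (prew K a))) => v.
by rewrite !comp_linE [free_map _ _ << v >>]free_liftU ![prew _ _ << _ >>]prewU
  [RHS]free_liftU.
Qed.

Lemma inl_morph : {morph inl_ : x y / x * y}.
Proof. by move=> x y; congr pair; rewrite mulg1. Qed.
Lemma inr_morph : {morph inr_ : x y / x * y}.
Proof. by move=> x y; congr pair; rewrite mulg1. Qed.

(** Leibniz rule for all faces but face 0. A front letter merges with one of its own kind or of the
    other; the mixed letter (a, b) arises once from each order with opposite signs, as the two
    letters commute, and cancels. *)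
Lemma rest_shuffle s t : restw K GH (shuffle s t) =
  (shufflew (rest K s) (wordH t) + (-1) ^+ (size s) *: shufflew (wordG s) (rest K t))%R.
Proof.
elim: s t => [|a s IH] t.
  rewrite shuffle0s restwU (rest_map inr_morph) shuffle0l expr0 scale1r.
  by rewrite shufflelE linear0 add0r.
elim: t => [|b t IHt].
  rewrite shuffles0 restwU (rest_map inl_morph) shuffle0r.
  by rewrite [X in _ *: X]shufflerE !linear0 addr0.
rewrite shuffle_cons linearD linearZ_LR !restw_pre merge_shuffle_l merge_shuffle_r IH IHt.
rewrite -[rest K (a :: s)]/(- word _ (merge a s) - prew _ a (rest K s))%R.
rewrite -[rest K (b :: t)]/(- word _ (merge b t) - prew _ b (rest K t))%R.
have El y : shufflew (- wordG (merge a s) - prew K a (rest K s))%R y =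
    (- shufflew (wordG (merge a s)) y - shufflew (prew K a (rest K s)) y)%R.
  by rewrite !shufflelE linearB linearN.
have Er x : shufflew x (- wordH (merge b t) - prew K b (rest K t))%R =
    (- shufflew x (wordH (merge b t)) - shufflew x (prew K b (rest K t)))%R.
  by rewrite !shufflerE linearB linearN.
rewrite !El !Er shuffle_pre_rest shuffle_pre_r !shufflewU.
rewrite !(linearB (prew K _), linearD (prew K _), linearN (prew K _), linearZ_LR (prew K _)) !exprS.
move: ((-1) ^+ size s)%R => e.
(* What remains is linear in the shuffle terms; comparing coefficients turns it into an identity in
   K. *)
apply/eqP/freeg_eqP => w; rewrite !(coeffD, coeffN, coeffZ).
ring.
Qed.

Lemma first_shuffle s t : firstw K GH (shuffle s t) =
  (shufflew (firstw K G (wordG s)) (wordH t) +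
   (-1) ^+ (size s) *: shufflew (wordG s) (firstw K H (wordH t)))%R.
Proof.
case: s => [|a s].
  rewrite shuffle0s !firstwU shufflelE linear0 add0r scale1r.
  by case: t => [|b t]; rewrite ?shufflewU ?shuffle0s // shufflerE linear0.
case: t => [|b t].
  by rewrite shuffles0 !firstwU shufflewU shuffles0 [X in _ *: X]shufflerE !linear0 addr0.
by rewrite shuffle_cons linearD linearZ_LR !firstw_pre !firstwU !shufflewU.
Qed.

Lemma diff_shuffle s t : diffw K GH (shuffle s t) =
  (shufflew (diffw K G (wordG s)) (wordH t) +
   (-1) ^+ (size s) *: shufflew (wordG s) (diffw K H (wordH t)))%R.
Proof.
rewrite diffwE first_shuffle rest_shuffle addrACA -scalerDr !diffwE !restwU.
congr (_ + _ *: _)%R; first by rewrite !shufflelE linearD.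
by rewrite !shufflerE linearD.
Qed.

Lemma shuffle_unit n s t : 1 \in s \/ 1 \in t -> word_chain K GH n (shuffle s t) = 0%R.
Proof.
move=> st1; apply/eqP; rewrite -[_ == _]/(word_chain K GH n (shuffle s t) \in lin_ker idfun).
apply: shuffle_supp => w wP; rewrite word_chainU word_sym_unit ?rpred0 // (perm_mem wP) mem_cat.
by case: st1 => h; apply/orP; [left|right]; apply: (map_f _ h).
Qed.

(** Keeping n independent of i + j avoids transport along equalities of degrees; for other n the
    value is 0, the words having the wrong length. *)
Definition cross n i j :
    {linear tensor (nerve_chain K G i) (nerve_chain K H j) -> nerve_chain K GH n} :=
  bilift (fun (s : nondegenerate G i) (t : nondegenerate H j) =>
    word_chain K GH n (shuffle (val (val s)) (val (val t)))).

Lemma cross_sym n i j s t : size s = i -> size t = j ->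
  cross n i j (pure_tensor (word_sym K i s) (word_sym K j t)) = word_chain K GH n (shuffle s t).
Proof.
move=> si tj.
have [s1|s1] := boolP (1 \in s).
  by rewrite word_sym_unit // pure0l linear0 shuffle_unit //; left.
have [t1|t1] := boolP (1 \in t).
  by rewrite [word_sym K j t]word_sym_unit // pure0r linear0 shuffle_unit //; right.
have [u -> us] := word_sym_nondegenerate K si s1; have [v -> vt] := word_sym_nondegenerate K tj t1.
by rewrite [LHS]biliftU us vt.
Qed.

Lemma cross_diffl n i j s t : size s = i.+1 -> size t = j ->
  cross n i j (pure_tensor (word_chain K G i (diffw K G (wordG s))) (word_sym K j t)) =
  word_chain K GH n (shufflew (diffw K G (wordG s)) (wordH t)).
Proof.
move=> si tj.
pose F := comp_lin (cross n i j) (comp_lin (purel _ (word_sym K j t)) (word_chain K G i)).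
pose F' := comp_lin (word_chain K GH n) (shufflel (wordH t)).
rewrite -[LHS]/(F _) -[RHS]/(F' _) diffw_sum -?size_eq0 ?si // !linear_sum.
apply: eq_bigr => k _; rewrite (linearZ_LR F) (linearZ_LR F'); congr (_ *: _)%R.
rewrite /F !comp_linE word_chainU; apply: etrans (cross_sym _ _ tj) _.
  by rewrite size_wface si // -ltnS.
by rewrite -shufflelE shufflewU.
Qed.

Lemma cross_diffr n i j s t : size s = i -> size t = j.+1 ->
  cross n i j (pure_tensor (word_sym K i s) (word_chain K H j (diffw K H (wordH t)))) =
  word_chain K GH n (shufflew (wordG s) (diffw K H (wordH t))).
Proof.
move=> si tj.
pose F := comp_lin (cross n i j) (comp_lin (purer _ (word_sym K i s)) (word_chain K H j)).
pose F' := comp_lin (word_chain K GH n) (shuffler (wordG s)).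
rewrite -[LHS]/(F _) -[RHS]/(F' _) diffw_sum -?size_eq0 ?tj // !linear_sum.
apply: eq_bigr => k _; rewrite (linearZ_LR F) (linearZ_LR F'); congr (_ *: _)%R.
rewrite /F !comp_linE word_chainU; apply: etrans (cross_sym _ si _) _.
  by rewrite size_wface tj // -ltnS.
by rewrite -shufflerE shufflewU.
Qed.

Definition cross_dl n i j :
    {linear tensor (nerve_chain K G i) (nerve_chain K H j) -> nerve_chain K GH n} :=
  match i with
  | 0 => \0
  | i'.+1 => comp_lin (cross n i' j) (tensor_map (nerve_diff K G i') idfun)
  end%R.

Definition cross_dr n i j :
    {linear tensor (nerve_chain K G i) (nerve_chain K H j) -> nerve_chain K GH n} :=
  match j with
  | 0 => \0
  | j'.+1 => comp_lin (cross n i j') (tensor_map idfun (nerve_diff K H j'))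
  end%R.

Lemma cross_diff n i j z : nerve_diff K GH n (cross n.+1 i j z) =
  (cross_dl n i j z + (-1) ^+ i *: cross_dr n i j z)%R.
Proof.
pose F := sub_lin (cross_dl n i j) (scale_lin (- (-1) ^+ i)%R (cross_dr n i j)).
have FE x : (F x = cross_dl n i j x + (-1) ^+ i *: cross_dr n i j x)%R.
  by rewrite sub_linE scale_linE scaleNr opprK.
rewrite -FE; move: z; apply: (@tensor_free_ext _ _ _ _ (comp_lin (nerve_diff K GH n) (cross
  n.+1 i j)) F) => s t.
rewrite comp_linE [cross _ _ _ _]biliftU word_chain_diffw diff_shuffle size_tuple.
rewrite FE linearD (linearZ_LR (word_chain _ _ _)).
have sE (G0 : groupType) k (v : nondegenerate G0 k) : << v >> = word_sym K k (val (val v)).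
  by rewrite word_sym_tuple symbol_val.
congr (_ + _ *: _)%R.
  case: i s {F FE} => [|i] s.
    have -> : val (val s) = [::] :> seq G by apply/size0nil/size_tuple.
    by rewrite diffw_nil shufflelE !linear0.
  rewrite /cross_dl comp_linE tensor_map_pure !sE -word_chainU word_chain_diffw.
  by rewrite cross_diffl ?size_tuple.
case: j t {F FE} => [|j] t.
  have -> : val (val t) = [::] :> seq H by apply/size0nil/size_tuple.
  by rewrite diffw_nil shufflerE !linear0.
rewrite /cross_dr comp_linE tensor_map_pure !sE -[word_sym K j.+1 _]word_chainU word_chain_diffw.
by rewrite cross_diffr ?size_tuple.
Qed.

Definition EZ_fun n (u : tensor_complex (nerve K G) (nerve K H) n) : nerve K GH n :=
  (\sum_(i < n.+1) \sum_(j < n.+1) cross n i j (comp u i j))%R.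

Lemma EZ_linear n : linear (@EZ_fun n).
Proof.
move=> a u v; rewrite /EZ_fun scaler_sumr -big_split; apply: eq_bigr => i _.
rewrite scaler_sumr -[RHS]/(_ + _)%R -big_split; apply: eq_bigr => j _.
by rewrite -[comp _ i j]/(comp_lm _ _ n i j (a *: u + v)%R) !linearP.
Qed.

Definition EZ n : {linear tensor_complex (nerve K G) (nerve K H) n -> nerve K GH n} :=
  mk_linear (@EZ_linear n).

Lemma EZ_diff n u :
  EZ n (chain_diff (tensor_complex (nerve K G) (nerve K H)) n u) =
  chain_diff (nerve K GH) n (EZ n.+1 u).
Proof.
pose A i j := cross_dl n i j (comp u i j).
pose B i j := ((-1) ^+ i *: cross_dr n i j (comp u i j))%R.
have -> : chain_diff (nerve K GH) n (EZ n.+1 u) =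
    (\sum_(i < n.+2) \sum_(j < n.+2) A i j + \sum_(j < n.+2) \sum_(i < n.+2) B i j)%R.
  rewrite -[EZ _ _]/(EZ_fun _) /EZ_fun linear_sum [X in (_ + X)%R]exchange_big -big_split.
  apply: eq_bigr => i _; rewrite linear_sum -[RHS]/(_ + _)%R -big_split.
  by apply: eq_bigr => j _; apply: cross_diff.
rewrite (sum_shift (A := A)) => [|j|i]; first last.
- by rewrite /A comp_out ?linear0 // gtn_eqF // addSn ltnS leq_addl.
- by [].
rewrite (sum_shift (A := fun j i => B i j)) => [|i|j]; first last.
- by rewrite /B comp_out ?linear0 ?scaler0 // gtn_eqF // addnS ltnS leq_addr.
- by rewrite /B /cross_dr /= scaler0.
rewrite [X in (_ + X)%R]exchange_big -big_split; apply: eq_bigr => i _.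
rewrite -[RHS]/(_ + _)%R -big_split; apply: eq_bigr => j _.
rewrite -[RHS]/(_ + _)%R -[comp _ i j]/(comp (chain_diff (tensor_complex (nerve K G) (nerve K
  H)) n u) i j).
by rewrite comp_diff linearD (linearZ_LR (cross _ _ _)).
Qed.
End Shuffle.

(** * The Alexander-Whitney map *)

Section AlexanderWhitney.
Variables (K : comNzRingType) (G H : groupType).
Local Open Scope group_scope.
Local Notation GH := (G * H)%type.
Local Notation inl_ := (@inl_ G H).
Local Notation inr_ := (@inr_ G H).
Local Notation sh := (shuffle K).

(** Front letters are projected to G and back letters to H; [word_sym] makes the tensor 0 unless w
    has length i + j. *)
Definition AW_words i j : {linear words K GH -> tensor (nerve_chain K G i) (nerve_chain K H j)} :=
  free_lift (fun w : seq GH =>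
    pure_tensor (word_sym K i (take i (map fst w))) (word_sym K j (drop i (map snd w)))).

Lemma AW_wordsU i j w : AW_words i j (word K w) =
  pure_tensor (word_sym K i (take i (map fst w))) (word_sym K j (drop i (map snd w))).
Proof. exact: free_liftU. Qed.

Definition AW n i j :
    {linear nerve_chain K GH n -> tensor (nerve_chain K G i) (nerve_chain K H j)} :=
  free_lift (fun s : nondegenerate GH n => AW_words i j (word K (val (val s)))).

(** Compatibility with normalization: a unit letter of w remains a unit in the front or in the
    back. *)
Lemma AW_sym n i j w : size w = n -> AW n i j (word_sym K n w) = AW_words i j (word K w).
Proof.
move=> wn; have [w1|w1] := boolP (1 \in w); last first.
  by have [v -> <-] := word_sym_nondegenerate K wn w1; apply: free_liftU.
rewrite word_sym_unit // linear0 AW_wordsU.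
have : (1, 1) \in take i w ++ drop i w by rewrite cat_take_drop.
rewrite mem_cat => /orP[] h.
  by rewrite [word_sym K i _]word_sym_unit ?pure0l // -map_take; apply: (map_f fst h).
by rewrite [word_sym K j _]word_sym_unit ?pure0r // -map_drop; apply: (map_f snd h).
Qed.

Lemma AW_word_chain_shuffle n i j s t : (size s + size t)%N = n ->
  AW n i j (word_chain K GH n (sh s t)) = AW_words i j (sh s t).
Proof.
move=> st; apply/eqP; rewrite -subr_eq0.
pose F := sub_lin (comp_lin (AW n i j) (word_chain K GH n)) (AW_words i j).
rewrite -[_ == _]/(F (sh s t) \in lin_ker idfun); apply: shuffle_supp => w wP.
rewrite /F sub_linE comp_linE word_chainU AW_sym ?subrr ?rpred0 //.
by rewrite (perm_size wP) size_cat !size_map.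
Qed.

Lemma AW_words_inr i j b x : AW_words i.+1 j (prew K (inr_ b) x) = 0%R.
Proof.
apply: (@free_ext _ _ _ (comp_lin (AW_words i.+1 j) (prew K (inr_ b))) \0%R) => w.
by rewrite comp_linE [prew _ _ _]prewU [LHS]AW_wordsU word_sym_unit ?pure0l //= mem_head.
Qed.

Definition presym i (a : G) : {linear nerve_chain K G i -> nerve_chain K G i.+1} :=
  free_lift (fun s : nondegenerate G i => word_sym K i.+1 (a :: val (val s))).

Lemma presymE i a w : presym i a (word_sym K i w) = word_sym K i.+1 (a :: w).
Proof.
have [wi|wi] := eqVneq (size w) i; last by rewrite !word_sym_size ?linear0.
have [w1|w1] := boolP (1 \in w); last first.
  by have [v -> <-] := word_sym_nondegenerate K wi w1; apply: free_liftU.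
by rewrite !word_sym_unit ?linear0 // inE w1 orbT.
Qed.

Lemma AW_words_inl i j a x :
  AW_words i.+1 j (prew K (inl_ a) x) = tensor_map (presym i a) idfun (AW_words i j x).
Proof.
apply: (@free_ext _ _ _ (comp_lin (AW_words i.+1 j) (prew K (inl_ a)))
  (comp_lin (tensor_map (presym i a) idfun) (AW_words i j))) => w.
rewrite !comp_linE [prew _ _ _]prewU [LHS]AW_wordsU [AW_words i j _]AW_wordsU tensor_map_pure
  presymE.
by [].
Qed.

(** While the front is not exhausted, a letter from H projects to a unit there, so only the branch
    taking a letter of [s] survives; in the end just the sorted word is left. *)
Lemma AW_words_shuffle i j s t : size s = i ->
  AW_words i j (sh s t) = pure_tensor (word_sym K i s) (word_sym K j t).
Proof.
elim: s t i => [|a s IH] t i <-.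
  by rewrite -[size [::]]/0%N shuffle0s AW_wordsU take0 drop0 -map_comp map_id.
rewrite -[size (a :: s)]/(size s).+1; case: t => [|b t].
  rewrite shuffles0 AW_wordsU -!map_comp map_id take_oversize ?drop_oversize //=.
  by rewrite size_map.
rewrite shuffle_cons linearD (linearZ_LR (AW_words _ _)) AW_words_inl AW_words_inr scaler0 addr0.
by rewrite IH // tensor_map_pure presymE.
Qed.

(** A count: a nonzero term needs i nontrivial first coordinates and j nontrivial second ones, at
    most [size s] and [size t] are available, and the totals agree. *)
Lemma AW_words_shuffle0 i j s t : (size s + size t = i + j)%N -> size s != i ->
  AW_words i j (sh s t) = 0%R.
Proof.
move=> st si; apply/eqP; rewrite -[_ == _]/(AW_words i j (sh s t) \in lin_ker idfun).
apply: shuffle_supp => w wP; rewrite AW_wordsU.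
have sw : size w = (i + j)%N by rewrite (perm_size wP) size_cat !size_map.
have c1 : (count (predC1 1%g) (map fst w) <= size s)%N.
  rewrite (permP (perm_map fst wP)) map_cat count_cat -!map_comp.
  rewrite [X in (_ + X)%N](_ : _ = 0)%N ?addn0; last first.
    by elim: (t) => //= b t' ->; rewrite eqxx.
  by rewrite (leq_trans (count_size _ _)) // size_map.
have c2 : (count (predC1 1%g) (map snd w) <= size t)%N.
  rewrite (permP (perm_map snd wP)) map_cat count_cat -!map_comp.
  rewrite [X in (X + _)%N](_ : _ = 0)%N ?add0n; last first.
    by elim: (s) => //= b t' ->; rewrite eqxx.
  by rewrite (leq_trans (count_size _ _)) // size_map.
have cnt (G0 : groupType) (v : seq G0) : 1 \notin v -> count (predC1 1) v = size v.
  move=> v1; apply/eqP; rewrite -all_count; apply/allP => g gv /=.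
  by apply: contraNneq v1 => <-.
have [h|h] := boolP (1 \in take i (map fst w)).
  by rewrite word_sym_unit // pure0l rpred0.
have [h'|h'] := boolP (1 \in drop i (map snd w)).
  by rewrite [word_sym K j _]word_sym_unit // pure0r rpred0.
have := cnt _ _ h; have := cnt _ _ h'.
rewrite size_drop size_takel !size_map sw ?leq_addr // => e2 e1.
move: c1 c2; rewrite -[map fst w](cat_take_drop i) -[map snd w](cat_take_drop i).
rewrite !count_cat e1 e2 => c1 c2; exfalso.
move/eqP: si; lia.
Qed.

Lemma AW_cross n i j z : (i + j)%N = n -> AW n i j (cross K G H n i j z) = z.
Proof.
move=> ij; move: z; apply: (@tensor_free_ext _ _ _ _ (comp_lin (AW n i j) (cross K G H n i j))
  idfun) => s t.
rewrite comp_linE [cross _ _ _ _ _ _ _]biliftU AW_word_chain_shuffle ?size_tuple //.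
by rewrite AW_words_shuffle ?size_tuple // !word_sym_tuple !symbol_val.
Qed.

Lemma AW_cross0 n i j i' j' z : (i + j)%N = n -> (i' + j')%N = n -> i' != i ->
  AW n i j (cross K G H n i' j' z) = 0%R.
Proof.
move=> ij ij' ii; move: z; apply: (@tensor_free_ext _ _ _ _ (comp_lin (AW n i j) (cross K G H n
  i' j')) \0%R) => s t.
rewrite comp_linE [cross _ _ _ _ _ _ _]biliftU AW_word_chain_shuffle ?size_tuple //.
by rewrite AW_words_shuffle0 ?size_tuple // ij ij'.
Qed.

Lemma AW_EZ n u i j : (i + j)%N = n -> AW n i j (EZ K G H n u) = comp u i j.
Proof.
move=> ij; rewrite -[EZ _ _ _ _ _]/(EZ_fun _) /EZ_fun linear_sum.
have iP : (i < n.+1)%N by rewrite -ij ltnS leq_addr.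
have jP : (j < n.+1)%N by rewrite -ij ltnS leq_addl.
rewrite (bigD1 (Ordinal iP)) // -[LHS]/(_ + _)%R [X in (_ + X)%R]big1 ?addr0 => [|k ki].
  rewrite linear_sum (bigD1 (Ordinal jP)) // -[LHS]/(_ + _)%R AW_cross // big1 ?addr0 // => l lj.
  rewrite comp_out ?linear0 //; apply: contraNneq lj => E; apply/eqP/val_inj => /=.
  by move: E => /=; rewrite -[in RHS]ij => /addnI.
rewrite linear_sum big1 // => l _.
have [kl|kl] := eqVneq (k + l)%N n; last by rewrite comp_out ?linear0.
by rewrite AW_cross0.
Qed.

End AlexanderWhitney.

(** * Coefficients of words and chains on the axes *)

Section WordCoefficients.
Variables (K : comNzRingType) (G : groupType).
Local Open Scope group_scope.

Definition word_coeff n (w : seq G) : {linear nerve_chain K G n -> K^o} :=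
  free_lift (fun s : nondegenerate G n => ((val (val s) == w)%:R)%R : K^o).

Lemma word_coeff_sym n w v : 1 \notin w -> size v = n ->
  word_coeff n w (word_sym K n v) = ((v == w)%:R)%R.
Proof.
move=> w1 vn; have [v1|v1] := boolP (1 \in v).
  rewrite word_sym_unit // linear0; case: eqP => [E|//].
  by rewrite -E v1 in w1.
by have [s -> <-] := word_sym_nondegenerate K vn v1; apply: free_liftU.
Qed.

Lemma word_coeff_coeff n (s : nondegenerate G n) x : coeff s x = word_coeff n (val (val s)) x.
Proof.
have E : @coeff_lin K _ s =1 word_coeff n (val (val s)).
  apply: free_ext => t; rewrite [RHS]free_liftU mk_linearE coeffU mul1r.
  by rewrite -!val_eqE.
exact: E.
Qed.

Lemma nondegenerate_unit n (s : nondegenerate G n) : 1 \notin val (val s).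
Proof. by apply/negP => h; have := allP (valP s) _ h; rewrite eqxx. Qed.

Lemma chain_eq0 n (x : nerve_chain K G n) :
  (forall w, size w = n -> 1 \notin w -> word_coeff n w x = 0%R) -> x = 0%R.
Proof.
move=> x0; apply/eqP/freeg_eqP => s; rewrite word_coeff_coeff coeff0 x0 ?size_tuple //.
exact: nondegenerate_unit.
Qed.
End WordCoefficients.

Section Marks.
Variables (K : comNzRingType) (X : marked_group).
Local Open Scope group_scope.
Definition marked (w : seq X) : Prop := forall g, g \in w -> mg_mark X g.

Lemma nerve_mark_sub (V : lmodType K) (S : submodClosed V) n
    (F : {linear nerve_chain K X n -> V}) x :
  (forall w, marked w -> size w = n -> F (word_sym K n w) \in S) ->
  x \in @nerve_mark K X n -> F x \in S.
Proof.
move=> FS /asboolP[s sM ->]; rewrite linear_sum big_seq; apply: rpred_sum => c /sM[t tM ->].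
by rewrite (linearZ_LR F) -word_sym_tuple; apply/rpredZ/FS; rewrite ?size_tuple.
Qed.

Lemma nerve_mark_eq0 (V : lmodType K) n (F : {linear nerve_chain K X n -> V}) x :
  (forall w, marked w -> size w = n -> F (word_sym K n w) = 0%R) ->
  x \in @nerve_mark K X n -> F x = 0%R.
Proof.
move=> F0 xM; apply/eqP; rewrite -[_ == _]/(F x \in lin_ker idfun).
by apply: nerve_mark_sub xM => w wM wn; rewrite F0 ?rpred0.
Qed.

Lemma word_sym_mark n w : marked w -> word_sym K n w \in @nerve_mark K X n.
Proof.
move=> wM; have [wn|wn] := eqVneq (size w) n; last by rewrite word_sym_size ?rpred0.
have E : w = val (Tuple (introT eqP wn)) by [].
by apply: sub_span; exists (Tuple (introT eqP wn)); rewrite -?word_sym_tuple.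
Qed.

Lemma word_coeff_mark n w x : 1 \notin w -> ~ marked w -> x \in @nerve_mark K X n ->
  word_coeff K n w x = 0%R.
Proof.
move=> w1 wM; apply: nerve_mark_eq0 => v vM vn; rewrite word_coeff_sym //.
by case: eqP => // E; case: wM; rewrite -E.
Qed.

Lemma nerve_markP n x : (forall w, 1 \notin w -> ~ marked w -> word_coeff K n w x = 0%R) ->
  x \in @nerve_mark K X n.
Proof.
move=> x0; rewrite (freeg_expand (uniq_dom x) (fun _ h => h)); apply: rpred_sum => s _.
have [sM|sM] := pselect (marked (val (val s))).
  by apply: rpredZ; rewrite -(symbol_val K s) -word_sym_tuple; apply: word_sym_mark.
by rewrite word_coeff_coeff x0 ?scale0r ?rpred0 //; apply: nondegenerate_unit.
Qed.
End Marks.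

Section Axial.
Variables (K : idomainType) (G H : groupType).
Local Open Scope group_scope.
Local Notation GH := (G * H)%type.
Local Notation inl_ := (@inl_ G H).
Local Notation inr_ := (@inr_ G H).

(** With everything marked, the wedge of two such groups contains the wedge of any markings on
    them. *)
Definition full (G0 : groupType) : marked_group := @MarkedGroup G0 setT I.

Definition axes := wedge (full G) (full H).

Definition axial (w : seq GH) : bool := all (fun p => (p.1 == 1) || (p.2 == 1)) w.

Lemma marked_axial (w : seq GH) : @marked axes w <-> axial w.
Proof.
split=> [wM|/allP wa p /wa /orP[]/eqP p1].
- by apply/allP => p /wM [[_ /= ->]|[/= -> _]]; rewrite eqxx ?orbT.
- by right.
- by left.
Qed.

Lemma wface_cat2 (p q : seq GH) a b :
  wface (p ++ a :: b :: q) (size p).+1 = p ++ (b * a) :: q.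
Proof.
elim: p => [//|c p IH].
by rewrite -[LHS]/(c :: wface (p ++ a :: b :: q) (size p).+1) IH.
Qed.

(** Being off the axes, (g, h) is no letter of v, so an inner face created it as a product; on the
    axes it has just two factorizations, one for each order. *)
Lemma wface_eq (p q v : seq GH) (g : G) (h : H) i :
  axial v -> g != 1 -> h != 1 -> (i <= size v)%N ->
  size v = (size p + size q).+2 ->
  (wface v i == p ++ (g, h) :: q) =
  (i == (size p).+1) && ((v == p ++ inl_ g :: inr_ h :: q) || (v == p ++ inr_ h :: inl_ g :: q)).
Proof.
move=> va g1 h1 iv sv; apply/eqP/idP; last first.
  move=> /andP[/eqP-> /orP[]/eqP->]; rewrite wface_cat2; congr (_ ++ _ :: _);
    by congr pair; rewrite (mul1g, mulg1).
move=> E.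
have axk k : (k < size v)%N -> nth 1 v k <> (g, h).
  move=> kv Ek; have := allP va _ (mem_nth 1 kv).
  by rewrite Ek /= (negbTE g1) (negbTE h1).
have spv : ((size p).+1 < size v)%N by rewrite sv; lia.
have ip : i = (size p).+1.
  have := nth_wface i spv; rewrite E nth_cat ltnn subnn /=.
  case: ifP => [_ /esym/axk[]|_]; first by lia.
  by case: eqP => [->//|_ /esym/axk[]].
rewrite {i iv}ip in E *; rewrite eqxx /=.
have vE : v = take (size p) v ++ nth 1 v (size p) :: nth 1 v (size p).+1 :: drop (size p).+2 v.
  by rewrite -(drop_nth 1 spv) -(drop_nth 1 (ltnW spv)) cat_take_drop.
have sp : size (take (size p) v) = size p by rewrite size_takel //; lia.
have := allP va _ (mem_nth 1 spv); have := allP va _ (mem_nth 1 (ltnW spv)).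
move: vE sp E; move: (take _ _) (drop _ _) (nth 1 v _.+1) (nth 1 v _) => p' q' [b1 b2] [a1 a2].
move=> -> {va sv axk spv} sp; rewrite -sp wface_cat2 => /eqP; rewrite eqseq_cat ?sp // =>
  /andP[/eqP-> /eqP[]].
move=> gE hE -> /= /orP[]/eqP E1 /orP[]/eqP E2; move: gE hE g1 h1; rewrite E1 E2 ?mul1g ?mulg1.
- by move=> <- _; rewrite eqxx.
- by move=> <- <- _ _; rewrite eqxx orbT.
- by move=> <- <- _ _; rewrite eqxx.
- by move=> _ <- _; rewrite eqxx.
Qed.

Lemma word_coeff_diff_axial n (p q : seq GH) (g : G) (h : H) (y : nerve_chain K GH n.+1) :
  g != 1 -> h != 1 -> 1 \notin p ++ q -> (size p + size q).+1 = n ->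
  y \in @nerve_mark K axes n.+1 ->
  word_coeff K n (p ++ (g, h) :: q) (nerve_diff K GH n y) =
  ((-1) ^+ (size p).+1 * (word_coeff K n.+1 (p ++ inl_ g :: inr_ h :: q) y +
     word_coeff K n.+1 (p ++ inr_ h :: inl_ g :: q) y))%R.
Proof.
move=> g1 h1 pq1 pqn.
have unit3 : [/\ 1 \notin p ++ (g, h) :: q, 1 \notin p ++ inl_ g :: inr_ h :: q
  & 1 \notin p ++ inr_ h :: inl_ g :: q].
  have e1 : (1 == (g, h) :> GH) = false by apply/eqP => -[e _]; rewrite e eqxx in g1.
  have e2 : (1 == inl_ g :> GH) = false by apply/eqP => -[e]; rewrite e eqxx in g1.
  have e3 : (1 == inr_ h :> GH) = false by apply/eqP => -[e]; rewrite e eqxx in h1.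
  by move: pq1; rewrite !mem_cat !inE e1 e2 e3.
case: unit3 => u1 u2 u3.
pose sg : K := ((-1) ^+ (size p).+1)%R.
pose L := sub_lin (comp_lin (word_coeff K n (p ++ (g, h) :: q)) (nerve_diff K GH n))
  (sub_lin (scale_lin sg (word_coeff K n.+1 (p ++ inl_ g :: inr_ h :: q)))
     (scale_lin (- sg)%R (word_coeff K n.+1 (p ++ inr_ h :: inl_ g :: q)))).
have LE x : L x = (word_coeff K n (p ++ (g, h) :: q) (nerve_diff K GH n x) -
   sg * (word_coeff K n.+1 (p ++ inl_ g :: inr_ h :: q) x +
         word_coeff K n.+1 (p ++ inr_ h :: inl_ g :: q) x))%R.
  by rewrite !sub_linE !scale_linE scaleNr opprK mulrDr.
move=> yM; apply/eqP; rewrite -subr_eq0 -LE; apply/eqP.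
apply: nerve_mark_eq0 yM => v vM vn.
have va : axial v by apply/marked_axial.
rewrite LE !word_coeff_sym // -word_chainU word_chain_diffw diffw_sum -?size_eq0 ?vn //.
rewrite linear_sum (linear_sum (word_coeff _ _ _)).
have svn : size v = (size p + size q).+2 by rewrite vn -pqn.
rewrite (eq_bigr (fun i : 'I_n.+2 => (-1) ^+ i * ((i == (size p).+1 :> nat) &&
  ((v == p ++ inl_ g :: inr_ h :: q) || (v == p ++ inr_ h :: inl_ g :: q)))%:R)%R); last first.
  move=> i _; have iv : (i <= size v)%N by rewrite vn -ltnS.
  rewrite (linearZ_LR (word_chain _ _ _)) (linearZ_LR (word_coeff _ _ _)) word_chainU
    word_coeff_sym //.
    by rewrite (wface_eq va).
  by rewrite size_wface // vn.
have kP : ((size p).+1 < n.+2)%N by rewrite -pqn; lia.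
rewrite (bigD1 (Ordinal kP)) // -[X in (X - _)%R]/(_ + _)%R big1 ?addr0 => [|i ik]; last first.
  rewrite [_ == _](_ : _ = false) ?mulr0 //; apply/eqP => E.
  by case/eqP: ik; apply: val_inj.
rewrite eqxx -[nat_of_ord _]/(size p).+1 -mulrBr.
case: (eqVneq v _) => [->|_]; last by rewrite add0r subrr mulr0.
(* The two words are distinct because g is not 1. *)
rewrite (_ : (_ == _) = false) ?addr0 ?subrr ?mulr0 //.
apply/eqP => /eqP; rewrite eqseq_cat // eqxx /= => /eqP[g_1 _].
by rewrite g_1 eqxx in g1.
Qed.

Lemma axial_cons a (w : seq GH) : 1 \notin a :: w -> axial (a :: w) ->
  (exists2 g, g != 1 & a = inl_ g) \/ (exists2 h, h != 1 & a = inr_ h).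
Proof.
rewrite inE negb_or => /andP[a1 _] /= /andP[/orP[]/eqP E _]; [right; exists a.2|left; exists a.1].
- by apply: contraNneq a1 => E2; rewrite [a]surjective_pairing E E2.
- by rewrite [a]surjective_pairing E.
- by apply: contraNneq a1 => E1; rewrite [a]surjective_pairing E E1.
- by rewrite [a]surjective_pairing E.
Qed.

Lemma notin_map_inr (t : seq H) : (1 \notin map inr_ t) = (1 \notin t).
Proof. by congr (~~ _); rewrite -[1 in LHS]/(inr_ 1) mem_map // => x y []. Qed.
Lemma notin_map_inl (t : seq G) : (1 \notin map inl_ t) = (1 \notin t).
Proof. by congr (~~ _); rewrite -[1 in LHS]/(inl_ 1) mem_map // => x y []. Qed.

(** Nontrivial first coordinates in front and second ones behind determine axial letters, so among
    axial words [AW] sees only the sorted one. *)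
Lemma take_drop_axial (v : seq GH) (s : seq G) (t : seq H) :
  axial v -> size v = (size s + size t)%N -> 1 \notin s -> 1 \notin t ->
  (take (size s) (map fst v) == s) && (drop (size s) (map snd v) == t) =
  (v == map inl_ s ++ map inr_ t).
Proof.
move=> va sv s1 t1; apply/andP/eqP => [[/eqP sE /eqP tE]|->]; last first.
  rewrite !map_cat -!map_comp take_size_cat ?size_map // drop_size_cat ?size_map //.
  by rewrite !map_id.
apply: (@eq_from_nth _ 1); first by rewrite size_cat !size_map.
move=> k kv; have := allP va _ (mem_nth 1 kv).
rewrite nth_cat size_map; case: ltnP => ks.
  have Ek : (nth 1 v k).1 = nth 1 s k.
    by rewrite -[in RHS]sE nth_take // (nth_map 1).
  rewrite (nth_map 1) // Ek => /orP[/eqP E|/eqP E].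
    by move: s1; rewrite -E mem_nth.
  by rewrite [LHS]surjective_pairing Ek E.
have kt : (k - size s < size t)%N by rewrite ltn_subLR // -sv.
have Ek : (nth 1 v k).2 = nth 1 t (k - size s).
  by rewrite -[in RHS]tE nth_drop subnKC // (nth_map 1).
rewrite (nth_map 1) // Ek => /orP[/eqP E|/eqP E].
  by rewrite [LHS]surjective_pairing Ek E.
by move: t1; rewrite -E mem_nth.
Qed.

Lemma word_coeff_sorted n (s : seq G) (t : seq H) (y : nerve_chain K GH n) :
  (size s + size t)%N = n -> 1 \notin s -> 1 \notin t ->
  y \in @nerve_mark K axes n ->
  word_coeff K n (map inl_ s ++ map inr_ t) y =
  word_coeff K (size t) t (slicel _ (word_coeff K (size s) s) (AW K G H n (size s) (size t) y)).
Proof.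
move=> st s1 t1 yM.
pose A := comp_lin (word_coeff K (size t) t) (comp_lin (slicel _ (word_coeff K (size s) s))
  (AW K G H n (size s) (size t))).
pose L := sub_lin (word_coeff K n (map inl_ s ++ map inr_ t)) A.
apply/eqP; rewrite -subr_eq0 -[_ - _]/(L y); apply/eqP.
apply: nerve_mark_eq0 yM => v vM vn; have va : axial v by apply/marked_axial.
rewrite sub_linE word_coeff_sym //; last first.
  by rewrite mem_cat negb_or notin_map_inl notin_map_inr s1.
rewrite !comp_linE AW_sym // AW_wordsU slicel_pure (linearZ_LR (word_coeff _ _ _))
  !word_coeff_sym //.
- rewrite -take_drop_axial ?vn //.
  by case: (_ == _); case: (_ == _); rewrite /= ?scale1r ?scale0r subrr.
- by rewrite size_drop size_map vn -st addKn.
- by rewrite size_takel // size_map vn -st leq_addr.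
Qed.

(* Among the words on the axes these two are the only ones whose boundaries involve the
   word with g and h merged; that word is off the axes, so the coefficients cancel. *)
Lemma word_coeff_swap n p q g h (y : nerve_chain K GH n) : y \in @omega_pred K axes n ->
  size (p ++ inl_ g :: inr_ h :: q) = n -> 1 \notin p ++ inl_ g :: inr_ h :: q ->
  word_coeff K n (p ++ inl_ g :: inr_ h :: q) y = 0%R ->
  word_coeff K n (p ++ inr_ h :: inl_ g :: q) y = 0%R.
Proof.
move=> yO sn; have {sn} : (size p + size q).+2 = n by rewrite -sn size_cat /= !addnS.
case: n y yO => [//|n] y /andP[yM dyM] [sn] u1 E.
have [g1 h1 pq1] : [/\ g != 1, h != 1 & 1 \notin p ++ q].
  move: u1; rewrite !mem_cat !inE !negb_or => /and4P[-> gg hh ->]; split=> //.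
    by apply: contraNneq gg => ->.
  by apply: contraNneq hh => ->.
have := word_coeff_diff_axial g1 h1 pq1 sn yM; rewrite E add0r.
rewrite (@word_coeff_mark _ axes) // => [/esym/eqP||/marked_axial].
- by rewrite mulf_eq0 signr_eq0 => /eqP.
- rewrite mem_cat inE !negb_or; move: pq1; rewrite mem_cat negb_or => /andP[-> ->].
  by rewrite andbT; apply: contraNneq g1 => -[->].
- by rewrite /axial all_cat /= (negbTE g1) (negbTE h1) andbF.
Qed.

Lemma word_coeff_move n p q g t (y : nerve_chain K GH n) : y \in @omega_pred K axes n ->
  size (p ++ inl_ g :: map inr_ t ++ q) = n -> 1 \notin p ++ inl_ g :: map inr_ t ++ q ->
  word_coeff K n (p ++ inl_ g :: map inr_ t ++ q) y = 0%R ->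
  word_coeff K n (p ++ map inr_ t ++ inl_ g :: q) y = 0%R.
Proof.
move=> yO; elim: t p => [//|h t IH] p sn u1 E.
have := IH (rcons p (inr_ h)); rewrite !cat_rcons; apply.
- by move: sn; rewrite !size_cat.
- by move: u1; rewrite !mem_cat !inE !negb_or => /and4P[-> -> ->].
- exact: word_coeff_swap.
Qed.

(** Insertion sort: [AW] gives the coefficients of sorted words, and induction on the unsorted tail
    q moves its letters into the sorted prefix. A letter of H joins [t] directly; for one of G,
    vanishing is carried back across [t] by swaps. *)
Lemma axial_eq0 n (y : nerve_chain K GH n) : y \in @omega_pred K axes n ->
  (forall i j, (i + j)%N = n -> AW K G H n i j y = 0%R) -> y = 0%R.
Proof.
move=> yO y0.
have yM : y \in @nerve_mark K axes n by case: n y yO {y0} => [|n] y // /andP[].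
have key q s t : size (map inl_ s ++ map inr_ t ++ q) = n ->
    1 \notin map inl_ s ++ map inr_ t ++ q -> axial q ->
    word_coeff K n (map inl_ s ++ map inr_ t ++ q) y = 0%R.
  elim: q s t => [|a q IH] s t sn u1 qa.
    move: u1 sn; rewrite cats0 mem_cat negb_or notin_map_inl notin_map_inr => /andP[s1 t1].
    rewrite size_cat !size_map => st.
    by rewrite word_coeff_sorted // y0 // !linear0.
  have a1 : 1 \notin a :: q by move: u1; rewrite !mem_cat !negb_or => /and3P[].
  have qa' : axial q by case/andP: qa.
  have [[g g1 aE]|[h h1 aE]] := axial_cons a1 qa; rewrite {}aE in sn u1 *.
    have E := IH (rcons s g) t; rewrite map_rcons cat_rcons in E.
    have pc u v : perm_eq (u ++ map inr_ t ++ v :: q) (u ++ v :: map inr_ t ++ q).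
      by rewrite perm_cat2l -[v :: q]cat1s perm_catCA.
    have sn' : size (map inl_ s ++ inl_ g :: map inr_ t ++ q) = n.
      by rewrite -(perm_size (pc _ _)).
    have u1' : 1 \notin map inl_ s ++ inl_ g :: map inr_ t ++ q.
      by rewrite -(perm_mem (pc _ _)).
    by apply: word_coeff_move => //; apply: E.
  have := IH s (rcons t h); rewrite map_rcons cat_rcons; exact.
apply: chain_eq0 => w wn w1; have [wa|wa] := boolP (axial w).
  exact: (key w [::] [::]).
by apply: (@word_coeff_mark _ axes) => // /marked_axial; apply/negP.
Qed.

End Axial.

(** * Path chains of a wedge *)

Section MarkedShuffles.
Variables (K : comNzRingType) (X Y : marked_group).
Local Open Scope group_scope.
Local Notation W := (wedge X Y).

Lemma omega_mark (V : marked_group) n x : x \in @omega_pred K V n -> x \in @nerve_mark K V n.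
Proof. by case: n x => [|n] x // /andP[]. Qed.

Lemma marked_shuffle (w : seq (X * Y)) (s : seq X) (t : seq Y) :
  marked s -> marked t -> perm_eq w (map (@inl_ X Y) s ++ map (@inr_ X Y) t) ->
  @marked W w.
Proof.
move=> sM tM wP p; rewrite (perm_mem wP) mem_cat => /orP[]/mapP[g gs ->].
  by left; split=> //=; apply: sM.
by right; split=> //=; apply: tM.
Qed.

Lemma tensor_mark_cross n i j x y : x \in @nerve_mark K X i -> y \in @nerve_mark K Y j ->
  cross K X Y n i j (pure_tensor x y) \in @nerve_mark K W n.
Proof.
move=> xM yM; rewrite -[pure_tensor x y]/(purel _ y x).
apply: (nerve_mark_sub (F := comp_lin (cross K X Y n i j) (purel _ y)) _ xM) => s sM si.
rewrite comp_linE -[purel _ _ _]/(purer _ (word_sym K i s) y).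
apply: (nerve_mark_sub (F := comp_lin (cross K X Y n i j) (purer _ (word_sym K i s))) _ yM) =>
  t tM tj.
rewrite comp_linE [cross _ _ _ _ _ _ _]cross_sym //.
apply: shuffle_supp => w wP; rewrite word_chainU; apply: (@word_sym_mark K W).
exact: marked_shuffle wP.
Qed.

End MarkedShuffles.

Section OmegaWedge.
Variables (K : idomainType) (K_pid : principal_ideal_domain K).
Variables X Y : marked_group.
Local Open Scope group_scope.
Local Notation W := (wedge X Y).
Local Notation Z := (axes X Y).

Definition incO (V : marked_group) n : {linear omega K V n -> nerve K V n} := incl (@omega_pred
  K V n).

Lemma incO_diff V n x : incO V n (chain_diff (omega K V) n x) = chain_diff (nerve K V) n (incO
  V n.+1 x).
Proof. by []. Qed.

Definition incO_map V : chain_map (omega K V) (nerve K V) :=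
  @ChainMap K (omega K V) (nerve K V) (incO V) (@incO_diff V).

Definition EZ_omega_pre n : {linear tensor_complex (omega K X) (omega K Y) n -> nerve K W n} :=
  comp_lin (EZ K X Y n) (graded_tensor_map (incO X) (incO Y) n).

Lemma EZ_omega_diff n u : nerve_diff K W n (EZ_omega_pre n.+1 u) =
  EZ_omega_pre n (chain_diff (tensor_complex (omega K X) (omega K Y)) n u).
Proof.
rewrite /EZ_omega_pre !comp_linE.
by rewrite -[nerve_diff _ _ _ _]EZ_diff -(tensor_chain_mapP (incO_map X) (incO_map Y)).
Qed.

Lemma EZ_omega_mark n u : EZ_omega_pre n u \in @nerve_mark K W n.
Proof.
rewrite comp_linE -[EZ _ _ _ _ _]/(EZ_fun _) /EZ_fun.
apply: rpred_sum => i _; apply: rpred_sum => j _; rewrite comp_map.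
elim/tensor_ind: (comp u i j) => [x y|x y xP yP]; last by rewrite !linearD rpredD.
by rewrite tensor_map_pure; apply: tensor_mark_cross; apply/omega_mark/valP.
Qed.

Lemma EZ_omega_omega n u : EZ_omega_pre n u \in @omega_pred K W n.
Proof.
case: n u => [|n] u; first exact: EZ_omega_mark.
by apply/andP; split; rewrite ?EZ_omega_diff; apply: EZ_omega_mark.
Qed.

Definition EZ_omega_fun n : {linear tensor_complex (omega K X) (omega K Y) n -> omega K W n} :=
  corestr (@EZ_omega_omega n).

Lemma EZ_omega_funP n u :
  EZ_omega_fun n (chain_diff (tensor_complex (omega K X) (omega K Y)) n u) =
  chain_diff (omega K W) n (EZ_omega_fun n.+1 u).
Proof. by apply: val_inj; rewrite /= -[RHS]/(nerve_diff K W n (EZ_omega_pre n.+1 u))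
  EZ_omega_diff. Qed.

Definition EZ_omega : chain_map (tensor_complex (omega K X) (omega K Y)) (omega K W) :=
  @ChainMap K _ _ EZ_omega_fun EZ_omega_funP.

Lemma omega_free_embedded V n : free_embedded (omega K V n).
Proof. by exists _, (incO V n); apply: incl_inj. Qed.

(** [AW] recovers the components in the nerves, and by flatness tensoring the inclusions of Omega
    loses nothing. *)
Lemma EZ_omega_inj n : injective (EZ_omega n).
Proof.
apply: inj_linP => u /(congr1 val) /= u0; apply: comp_ext => i j ij.
have : comp (graded_tensor_map (incO X) (incO Y) n u) i j = 0%R.
  by rewrite -(AW_EZ _ ij) -[EZ _ _ _ _ _]/(EZ_omega_pre n u) [EZ_omega_pre n u]u0 linear0.
rewrite comp_map comp0 => E.
have P1 : projective (omega K Y j) by apply/free_embedded_projective/omega_free_embedded.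
apply: (inj_lin0 (tensor_map_injl P1 (@incl_inj _ _ (@omega_pred K X i)))).
apply: (inj_lin0 (tensor_map_injr (projective_free K (nondegenerate X i)) (@incl_inj _ _
  (@omega_pred K Y j)))).
by rewrite tensor_map_compE -[RHS]E; apply: eq_tensor_map.
Qed.

Lemma wedge_axes n x : x \in @nerve_mark K W n -> x \in @nerve_mark K Z n.
Proof.
apply: (nerve_mark_sub (F := idfun)) => w wM _; apply: (@word_sym_mark K Z) => p /wM.
by case=> -[h1 h2]; [left|right]; split.
Qed.

(** Every chain is on the marks of [full], and the boundary of a shuffle image is again a shuffle
    image. *)
Lemma EZ_axes n u : EZ K X Y n u \in @omega_pred K Z n.
Proof.
have zM (V : groupType) m (v : nerve_chain K V m) : v \in @nerve_mark K (full V) m.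
  by apply: nerve_markP => w _ []; move.
have eM m (v : tensor_complex (nerve K X) (nerve K Y) m) : EZ K X Y m v \in @nerve_mark K Z m.
  rewrite -[EZ _ _ _ _ _]/(EZ_fun _) /EZ_fun; apply: rpred_sum => i _; apply: rpred_sum => j _.
  elim/tensor_ind: (comp v i j) => [x y|x y xP yP]; last by rewrite linearD rpredD.
  by apply: (@tensor_mark_cross K (full X) (full Y)); apply: zM.
case: n u => [|n] u; first exact: eM.
by apply/andP; split; [exact: eM | rewrite -[nerve_diff _ _ _ _]EZ_diff; apply: eM].
Qed.

(** Both sides lie in Omega of the axes, where [AW] separates chains, and they have the same image
    under it. *)
Lemma EZ_AW n x : x \in @omega_pred K W n -> x = EZ K X Y n (of_comp (fun i j => AW K X Y n i j x)).
Proof.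
move=> xO; apply/eqP; rewrite -subr_eq0; apply/eqP/(@axial_eq0 K X Y).
  apply: rpredB; last exact: EZ_axes.
  case: n x xO => [|n] x; first exact: wedge_axes.
  by move=> /andP[xM dxM]; apply/andP; split; apply: wedge_axes.
by move=> i j ij; rewrite linearB AW_EZ // comp_of // subrr.
Qed.

Definition unmarked (V : marked_group) := {w : seq V | 1 \notin w /\ ~ marked w}.

(* Omega_n is the common kernel of these functionals. *)
Definition omega_test (V : marked_group) n (k : bool * unmarked V) : {linear nerve_chain K V n
  -> K^o} :=
  match k.1, n with
  | false, _ => word_coeff K n (sval k.2)
  | true, 0 => \0%R
  | true, m.+1 => comp_lin (word_coeff K m (sval k.2)) (nerve_diff K V m)
  end.

Lemma omega_testP V n x : (forall k, @omega_test V n k x = 0%R) -> x \in @omega_pred K V n.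
Proof.
move=> x0; have xM : x \in @nerve_mark K V n.
  by apply: nerve_markP => w w1 wM; apply: (x0 (false, exist _ w (conj w1 wM))).
case: n x x0 xM => [//|n] x x0 xM; apply/andP; split => //.
by apply: nerve_markP => w w1 wM; apply: (x0 (true, exist _ w (conj w1 wM))).
Qed.

Lemma AW_mark_slicel n i j x (k : unmarked X) : x \in @nerve_mark K W n ->
  slicel _ (word_coeff K i (sval k)) (AW K X Y n i j x) = 0%R.
Proof.
case: k => w [w1 wM]; rewrite -[sval _]/w.
apply: (@nerve_mark_eq0 K W _ n (comp_lin (slicel _ (word_coeff K i w)) (AW K X Y n i j))) => v
  vM vn.
rewrite comp_linE AW_sym // AW_wordsU slicel_pure.
rewrite (@word_coeff_mark _ X) ?scale0r //; apply: word_sym_mark => g /mem_take /mapP[p /vM pM ->].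
by case: pM => -[/= gM _] //; rewrite gM; apply: mg_mark1.
Qed.

Lemma AW_mark_slicer n i j x (k : unmarked Y) : x \in @nerve_mark K W n ->
  slicer _ (word_coeff K j (sval k)) (AW K X Y n i j x) = 0%R.
Proof.
case: k => w [w1 wM]; rewrite -[sval _]/w.
apply: (@nerve_mark_eq0 K W _ n (comp_lin (slicer _ (word_coeff K j w)) (AW K X Y n i j))) => v
  vM vn.
rewrite comp_linE AW_sym // AW_wordsU slicer_pure.
rewrite (@word_coeff_mark _ Y) ?scale0r //; apply: word_sym_mark => g /mem_drop /mapP[p /vM pM ->].
by case: pM => -[/= _ gM] //; rewrite gM; apply: mg_mark1.
Qed.

(** Formal: x is a shuffle image by [EZ_AW], [EZ] commutes with the differentials, and [AW] undoes
    [EZ]. *)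
Lemma AW_diff n i j x : x \in @omega_pred K W n.+1 -> (i + j)%N = n ->
  (tensor_map (nerve_diff K X i) idfun (AW K X Y n.+1 i.+1 j x) +
   (-1) ^+ i *: tensor_map idfun (nerve_diff K Y j) (AW K X Y n.+1 i j.+1 x))%R =
  AW K X Y n i j (nerve_diff K W n x).
Proof.
move=> xO ij; rewrite [in RHS](EZ_AW xO) -[nerve_diff _ _ _ _]EZ_diff AW_EZ // comp_diff.
by rewrite !comp_of ?addSn ?addnS ?ij.
Qed.

(** The tests on marks hold word by word. For those on boundaries, [AW_diff] equates the sum of the
    two partial differentials with the image of a chain on marks; slicing by a test on one factor
    commutes with the differential of the other, whose term therefore vanishes. *)
Lemma AW_omega n i j x : x \in @omega_pred K W n -> (i + j)%N = n ->
  exists y, AW K X Y n i j x = tensor_map (incO X i) (incO Y j) y.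
Proof.
move=> xO ij; have xM := omega_mark xO.
apply: (tensor_submodule (phi := @omega_test X i) (psi := @omega_test Y j)).
- exact/free_embedded_projective/(omega_free_embedded X i).
- exact: omega_testP.
- exact: omega_testP.
- case=> -[] k; last exact: AW_mark_slicel.
  case: i ij => [|i] ij.
    have [s _ ->] := tensor_expandl (AW K X Y n 0 j x).
    by rewrite linear_sum big1 // => a _; rewrite slicel_pure; apply: scale0r.
  case: n x xO xM ij => [//|n] x xO xM [ij].
  transitivity (slicel _ (word_coeff K i (sval k)) (tensor_map (nerve_diff K X i) (idfun :
    {linear nerve_chain K Y j -> _}) (AW K X Y n.+1 i.+1 j x))).
    by rewrite slicel_map.
  have := congr1 (slicel _ (word_coeff K i (sval k))) (AW_diff xO ij).
  rewrite AW_mark_slicel ?(omega_mark (omega_diff_subproof xO)) // linearD (linearZ_LR (slicel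
    _ _)).
  rewrite [X in (_ + _ *: X)%R = _ -> _]slicel_map AW_mark_slicel // linear0.
  by rewrite scaler0 addr0.
case=> -[] k; last exact: AW_mark_slicer.
case: j ij => [|j] ij.
  have [s _ ->] := tensor_expandl (AW K X Y n i 0 x).
  by rewrite linear_sum big1 // => a _; rewrite slicer_pure; apply: scale0r.
case: n x xO xM ij => [|n] x xO xM; first by rewrite addnS.
rewrite addnS => -[ij].
transitivity (slicer _ (word_coeff K j (sval k)) (tensor_map (idfun : {linear nerve_chain K X i
  -> _}) (nerve_diff K Y j) (AW K X Y n.+1 i j.+1 x))).
  by rewrite slicer_map.
have := congr1 (slicer _ (word_coeff K j (sval k))) (AW_diff xO ij).
rewrite AW_mark_slicer ?(omega_mark (omega_diff_subproof xO)) // linearD (linearZ_LR (slicer _ _)).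
rewrite [X in (X + _)%R = _ -> _]slicer_map AW_mark_slicer // linear0 add0r.
by move/(congr1 ( *:%R ((-1) ^+ i)%R)); rewrite signK scaler0.
Qed.

Lemma EZ_omega_surj n (x : omega K W n) : exists u, EZ_omega n u = x.
Proof.
have y_ex i j : exists y, (i + j)%N = n -> AW K X Y n i j (val x) = tensor_map (incO X i) (incO
  Y j) y.
  have [ij|nij] := eqVneq (i + j)%N n; last by exists 0%R => /eqP; rewrite (negbTE nij).
  by have [y yE] := AW_omega (valP x) ij; exists y.
pose y i j := projT1 (cid (y_ex i j)).
have yP i j : (i + j)%N = n -> AW K X Y n i j (val x) = tensor_map (incO X i) (incO Y j) (y i j).
  exact: projT2 (cid (y_ex i j)).
exists (of_comp y); apply: val_inj; rewrite [RHS](EZ_AW (valP x)).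
rewrite -[LHS]/(EZ K X Y n (graded_tensor_map (incO X) (incO Y) n (of_comp y))).
congr (EZ _ _ _ _ _); apply: comp_ext => i j ij.
by rewrite comp_map !comp_of // yP.
Qed.

Lemma EZ_omega_bij n : bijective (EZ_omega n).
Proof.
pose g x := projT1 (cid (@EZ_omega_surj n x)).
have gK : cancel g (EZ_omega n) by move=> x; apply: projT2 (cid (@EZ_omega_surj n x)).
by exists g => // u; apply: EZ_omega_inj; rewrite gK.
Qed.

End OmegaWedge.

(** * Naturality of the shuffle product *)

Section ShuffleNatural.
Variables (K : comNzRingType) (X Y X' Y' : marked_group).
Variables (f : marked_morphism X X') (g : marked_morphism Y Y').
Local Open Scope group_scope.
Local Notation h := (wedge_map f g).

Lemma nerve_map_sym (G H : groupType) (k : UMagmaMorphism.type G H) n w :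
  nerve_map K k n (word_sym K n w) = word_sym K n (map k w).
Proof.
have [wn|wn] := eqVneq (size w) n; last by rewrite !word_sym_size ?size_map ?linear0.
have -> : w = val (Tuple (introT eqP wn)) by [].
by rewrite !word_sym_tuple nerve_map_symbol -word_sym_tuple.
Qed.

Lemma nerve_map_word_chain (G H : groupType) (k : UMagmaMorphism.type G H) n x :
  nerve_map K k n (word_chain K G n x) = word_chain K H n (free_map K (map k) x).
Proof.
apply: (@free_ext _ _ _ (comp_lin (nerve_map K k n) (word_chain K G n))
  (comp_lin (word_chain K H n) (free_map K (map k)))) => w.
rewrite !comp_linE [word_chain K G n _]word_chainU [free_map _ _ _]free_liftU [RHS]word_chainU.
exact: nerve_map_sym.
Qed.

Lemma prew_map (G H : groupType) (k : G -> H) a x :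
  free_map K (map k) (prew K a x) = prew K (k a) (free_map K (map k) x).
Proof.
apply: (@free_ext _ _ _ (comp_lin (free_map K (map k)) (prew K a))
  (comp_lin (prew K (k a)) (free_map K (map k)))) => w.
by rewrite !comp_linE [prew K a << w >>]prewU [LHS]free_liftU
  [free_map _ _ << w >>]free_liftU [RHS]prewU.
Qed.

Lemma wedge_inl a : h (@inl_ X Y a) = @inl_ X' Y' (f a).
Proof. by congr pair; apply: gmulf1. Qed.
Lemma wedge_inr b : h (@inr_ X Y b) = @inr_ X' Y' (g b).
Proof. by congr pair; apply: gmulf1. Qed.

Lemma shuffle_map s t :
  free_map K (map h) (shuffle K s t) = shuffle K (map f s) (map g t).
Proof.
elim: s t => [|a s IH] t.
  rewrite !shuffle0s [LHS]free_liftU; congr word.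
  by rewrite -!map_comp; apply: eq_map => b; apply: wedge_inr.
elim: t => [|b t IHt].
  rewrite !shuffles0 [LHS]free_liftU; congr word.
  by rewrite -!map_comp; apply: eq_map => c; apply: wedge_inl.
rewrite -[map f _]/(f a :: map f s) -[map g _]/(g b :: map g t) !shuffle_cons.
rewrite linearD (linearZ_LR (free_map _ _)) !prew_map IH IHt size_map.
by rewrite wedge_inl wedge_inr.
Qed.

Lemma cross_natural n i j z :
  nerve_map K h n (cross K X Y n i j z) =
  cross K X' Y' n i j (tensor_map (nerve_map K f i) (nerve_map K g j) z).
Proof.
move: z; apply: (@tensor_free_ext _ _ _ _ (comp_lin (nerve_map K h n) (cross K X Y n i j))
  (comp_lin (cross K X' Y' n i j) (tensor_map (nerve_map K f i) (nerve_map K g j)))) => s t.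
rewrite !comp_linE [cross K X Y _ _ _ _]biliftU nerve_map_word_chain shuffle_map tensor_map_pure.
rewrite ![nerve_map _ _ _ << _ >>]free_liftU -!word_sym_tuple.
by rewrite [RHS]cross_sym ?size_map ?size_tuple.
Qed.

Lemma EZ_natural n u :
  nerve_map K h n (EZ K X Y n u) =
  EZ K X' Y' n (graded_tensor_map (nerve_map K f) (nerve_map K g) n u).
Proof.
rewrite -[EZ K X Y n u]/(EZ_fun _) -[RHS]/(EZ_fun _) /EZ_fun linear_sum.
apply: eq_bigr => i _; rewrite linear_sum; apply: eq_bigr => j _.
by rewrite comp_map cross_natural.
Qed.

End ShuffleNatural.

Lemma EZ_omega_natural (K : idomainType) (X Y X' Y' : marked_group)
    (f : marked_morphism X X') (g : marked_morphism Y Y') n u :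
  omega_map K (wedge_map f g) n (EZ_omega K X Y n u) =
  EZ_omega K X' Y' n (tensor_chain_map (omega_map K f) (omega_map K g) n u).
Proof.
apply: val_inj.
rewrite -[LHS]/(nerve_map K (wedge_map f g) n (EZ K X Y n (graded_tensor_map (incO K X) (incO K
  Y) n u))).
rewrite -[RHS]/(EZ K X' Y' n (graded_tensor_map (incO K X') (incO K Y') n
  (graded_tensor_map (omega_map K f) (omega_map K g) n u))).
rewrite EZ_natural; congr (EZ _ _ _ _ _); apply: comp_ext => i j _.
by rewrite !comp_map !tensor_map_compE; apply: eq_tensor_map.
Qed.

(** * Transport of the exact sequence to path homology *)

Section InverseChainMap.
Variables (K : idomainType) (C D : chain_complex K) (f : chain_map C D).
Hypothesis fb : forall n, bijective (f n).

Lemma inverse_exists n : exists g, cancel (f n) g /\ cancel g (f n).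
Proof. by have [g fK gK] := fb n; exists g. Qed.

Definition inverse_fun n : {linear D n -> C n} :=
  inv_lin (proj1 (projT2 (cid (inverse_exists n)))) (proj2 (projT2 (cid (inverse_exists n)))).

Lemma inverse_funK n : cancel (f n) (inverse_fun n).
Proof. exact: proj1 (projT2 (cid (inverse_exists n))). Qed.

Lemma inverse_funVK n : cancel (inverse_fun n) (f n).
Proof. exact: proj2 (projT2 (cid (inverse_exists n))). Qed.

Lemma inverse_funP n x :
  inverse_fun n (chain_diff D n x) = chain_diff C n (inverse_fun n.+1 x).
Proof. by apply: (can_inj (@inverse_funK n)); rewrite chain_funP !inverse_funVK. Qed.

Definition inverse_map : chain_map D C := ChainMap inverse_funP.

Lemma homology_map_inv n h : homology_map inverse_map n (homology_map f n h) = h.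
Proof.
have [z <-] := hcls_surj h; rewrite !homology_map_cls; congr (hcls _ _ _).
by apply: val_inj; apply: inverse_funK.
Qed.

Lemma homology_mapVK n h : homology_map f n (homology_map inverse_map n h) = h.
Proof.
have [z <-] := hcls_surj h; rewrite !homology_map_cls; congr (hcls _ _ _).
by apply: val_inj; apply: inverse_funVK.
Qed.

End InverseChainMap.

Theorem mainTheorem14 (K : idomainType) (K_pid : principal_ideal_domain K) :
  (forall X Y : marked_group,
     chain_isomorphic (tensor_complex (omega K X) (omega K Y))
                      (omega K (wedge X Y))) /\
  (forall n : nat,
   exists (alpha : forall X Y : marked_group,
             {linear graded_tensor (path_homology K X) (path_homology K Y) n
                     -> path_homology K (wedge X Y) n})
          (beta : forall X Y : marked_group,
             {linear path_homology K (wedge X Y) n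
                     -> graded_Tor1 (path_homology K X) (path_homology K Y) n}),
     (forall X Y, short_exact (alpha X Y) (beta X Y)) /\
     (forall (X X' Y Y' : marked_group)
             (f : marked_morphism X X') (g : marked_morphism Y Y'),
        (forall z, alpha X' Y' (graded_tensor_map (path_homology_map K f)
                                                  (path_homology_map K g) n z)
                 = path_homology_map K (wedge_map f g) n (alpha X Y z)) /\
        (forall z, beta X' Y' (path_homology_map K (wedge_map f g) n z)
                 = graded_Tor1_map (path_homology_map K f)
                                   (path_homology_map K g) n (beta X Y z)))).
Proof.
have bij X Y n := @EZ_omega_bij K K_pid X Y n.
split=> [X Y|n]; first by exists (EZ_omega K X Y) => n; apply: bij.
pose E X Y := EZ_omega K X Y; pose E' X Y := inverse_map (bij X Y).
have HO X k := @omega_free_embedded K X k.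
have EK X Y h : homology_map (E' X Y) n (homology_map (E X Y) n h) = h.
  exact: homology_map_inv.
have E'K X Y h : homology_map (E X Y) n (homology_map (E' X Y) n h) = h.
  exact: homology_mapVK.
have nat X X' Y Y' (f : marked_morphism X X') (g : marked_morphism Y Y') h :
    homology_map (omega_map K (wedge_map f g)) n (homology_map (E X Y) n h) =
    homology_map (E X' Y') n
      (homology_map (tensor_chain_map (omega_map K f) (omega_map K g)) n h).
  have [z <-] := hcls_surj h; rewrite !homology_map_cls; congr (hcls _ _ _).
  by apply: val_inj; apply: EZ_omega_natural.
exists (fun X Y => comp_lin (homology_map (E X Y) n) (kunneth_alpha (omega K X) (omega K Y) n)).
exists (fun X Y => comp_lin (kunneth_beta K_pid (HO X) (HO Y) n) (homology_map (E' X Y) n)).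
split=> [X Y|X X' Y Y' f g].
  have [ai ab bs] := kunneth_exact K_pid (HO X) (HO Y) n.
  split=> [x y /(congr1 (homology_map (E' X Y) n))|y|z].
  - by rewrite !comp_linE !EK; apply: ai.
  - rewrite comp_linE; split=> [/ab[x xE]|[x ->]].
      by exists x; rewrite comp_linE -xE E'K.
    by rewrite comp_linE EK; apply/ab; exists x.
  - by have [y ->] := bs z; exists (homology_map (E X Y) n y); rewrite comp_linE EK.
split=> z; rewrite !comp_linE.
  by rewrite /path_homology_map nat -kunneth_alpha_natural.
(* Writing z as an image under [E] reduces naturality of the inverse isomorphism to that of [E]. *)
rewrite -[z in LHS](E'K X Y) /path_homology_map nat EK.
exact: kunneth_beta_natural.
Qed.
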